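(* For integers $n\ge j\ge 1$ and $m\ge 0$, the out-degree $Y_{n,j}$ of node $j$ in a random ordered increasing $k$-tree of size $n$ satisfies \[ \mathbb{P}\{Y_{n,j}=m\}=\frac{\binom{j-\frac{k}{k+1}}{j}}{\binom{n-\frac{k}{k+1}}{n}\binom{n}{j}}\sum_{\ell=0}^{m}\binom{m}{\ell}(-1)^{\ell}\binom{n-\frac{k(2+\ell)}{k+1}}{n-j}. \] Moreover, as $n\to\infty$: (i) For fixed $j\ge1$: $n^{-\frac{k}{k+1}}Y_{n,j}$ converges in distribution to a random variable $Y_j$ which is uniquely determined by its moments, these being $\mathbb{E}(Y_j^s)=\frac{s!\,\Gamma(j+\frac{1}{k+1})}{\Gamma(j+1+\frac{k(s-1)}{k+1})}$ for all integers $s\ge0$. (ii) If $j=j(n)\to\infty$ with $j=o(n)$: $(j/n)^{\frac{k}{k+1}}Y_{n,j}$ converges in distribution to an exponential random variable with parameter $1$ (whose $s$-th moment is $s!$). (iii) If $j=j(n)\to\infty$ with $j\sim\rho n$ for some fixed $0<\rho<1$: $Y_{n,j}$ converges in distribution to a random variable $Y_\rho$ with $\mathbb{P}\{Y_\rho=m\}=\rho^{\frac{k}{k+1}}(1-\rho^{\frac{k}{k+1}})^m$ for $m\ge0$ (geometric law). (iv) If $j=j(n)\to\infty$ with $n-j=o(n)$: $\mathbb{P}\{Y_{n,j}=0\}\to1$.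
   Context: Fix an integer $k\ge1$. An ordered increasing $k$-tree of size $n\ge0$ is built as follows. Start with the root-clique $K_0$: $k$ pairwise adjacent vertices labelled $0_1,\dots,0_k$ (the root nodes; each label $0_\ell$ has value $0$). For $j=1,\dots,n$ in turn, node $j$ is inserted by choosing a currently existing $k$-clique $K$ and attaching $j$ to it, i.e. adding edges from $j$ to all $k$ vertices of $K$; $j$ is then a child of $K$ and the vertices of $K$ are the parents of $j$. The $k$-cliques available for attachment are the root-clique and, for every previously inserted node $x$ attached to a clique $K'$, the $k$ cliques $\{x\}\cup(K'\setminus\{w\})$, $w\in K'$. The children of each $k$-clique are linearly ordered: if $K$ currently has $d^+(K)$ children, there are $d^+(K)+1$ positions at which the new child may be placed, and the choice of position is part of the structure. Thus there are $1+(k+1)(j-1)$ ways to insert node $j$, and distinct sequences of choices give distinct trees. A random ordered increasing $k$-tree of size $n$ is one chosen uniformly among all of them; equivalently, it is produced by the process in which node $n$ is attached to the clique $K$ with probability $\frac{d^+(K)+1}{1+(k+1)(n-1)}$ (and a uniformly random position among the $d^+(K)+1$). The out-degree of a node $u$ is the number of nodes having $u$ as a parent (for a root node this is its number of non-root neighbours). $Y_{n,j}$ denotes the out-degree of node $j$ in a random ordered increasing $k$-tree of size $n$. For real $x$ and integer $m\ge0$, $\binom{x}{m}=x(x-1)\cdots(x-m+1)/m!$, and $\binom{x}{m}=0$ for $m<0$. *)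

(* Defs.v *)
From Stdlib Require Import Reals Lra Lia Arith List ClassicalEpsilon.
Import ListNotations.
Open Scope R_scope.

(* Vertices: root nodes 0_l (l = 1..k) and inserted nodes j >= 1. *)
Inductive node : Type := Root (l : nat) | Ins (j : nat).

Definition node_eqb (u v : node) : bool :=
  match u, v with
  | Root a, Root b => Nat.eqb a b
  | Ins a, Ins b => Nat.eqb a b
  | _, _ => false
  end.

Definition clique := list node.

Definition root_clique (k : nat) : clique := map Root (seq 1 k).

(* A choice for inserting a node: (index of the k-clique it is attached to
   in the list of currently available cliques, position among the children
   of that clique, 0 <= position <= d^+(K)).
   A tree of size n is a valid list of n choices (node x = x-th choice). *)
Definition choice := (nat * nat)%type.

(* State: list of available k-cliques (in order of creation) and
   the list of parent cliques of the inserted nodes 1, 2, ... *)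
Record state := mkState { cls : list clique ; pars : list clique }.

Definition init_state (k : nat) : state := mkState [root_clique k] [].

Definition step (s : state) (ch : choice) (x : nat) : state :=
  let K := nth (fst ch) (cls s) [] in
  mkState (cls s ++ map (fun w => Ins x :: filter (fun v => negb (node_eqb v w)) K) K)
          (pars s ++ [K]).

Fixpoint build_aux (s : state) (x : nat) (t : list choice) : state :=
  match t with
  | [] => s
  | ch :: t' => build_aux (step s ch x) (S x) t'
  end.

Definition build (k : nat) (t : list choice) : state := build_aux (init_state k) 1 t.

Definition ndeg (t : list choice) (c : nat) : nat :=
  length (filter (fun ch => Nat.eqb (fst ch) c) t).

Definition choices (k : nat) (t : list choice) : list choice :=
  flat_map (fun c => map (fun p => (c, p)) (seq 0 (S (ndeg t c))))
           (seq 0 (length (cls (build k t)))).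

Fixpoint trees (k n : nat) : list (list choice) :=
  match n with
  | O => [[]]
  | S n' => flat_map (fun t => map (fun ch => t ++ [ch]) (choices k t)) (trees k n')
  end.

Definition outdeg (k : nat) (t : list choice) (u : node) : nat :=
  length (filter (fun K => existsb (node_eqb u) K) (pars (build k t))).

Definition prob_Y (k n j m : nat) : R :=
  INR (length (filter (fun t => Nat.eqb (outdeg k t (Ins j)) m) (trees k n)))
  / INR (length (trees k n)).

Definition cdf_Y (k n j : nat) (c : R) (x : R) : R :=
  INR (length (filter (fun t => if Rle_dec (c * INR (outdeg k t (Ins j))) x
                                then true else false) (trees k n)))
  / INR (length (trees k n)).

Fixpoint falling (x : R) (m : nat) : R :=
  match m with O => 1 | S m' => falling x m' * (x - INR m') end.
Definition Rbinom (x : R) (m : nat) : R := falling x m / INR (fact m).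

(* Euler's Gamma function, via Euler's limit formula
   Gamma(x) = lim_N N! N^x / (x (x+1) ... (x+N)),  x > 0. *)
Fixpoint rising (x : R) (m : nat) : R :=
  match m with O => 1 | S m' => rising x m' * (x + INR m') end.
Definition gamma_seq (x : R) (N : nat) : R :=
  INR (fact N) * Rpower (INR N) x / rising x (S N).
Definition Gamma (x : R) : R :=
  epsilon (inhabits 0) (fun g => Un_cv (gamma_seq x) g).

Definition is_cdf (F : R -> R) : Prop :=
  (forall x y, x <= y -> F x <= F y) /\
  (forall x eps, eps > 0 -> exists d, d > 0 /\
      forall y, x <= y < x + d -> Rabs (F y - F x) < eps) /\
  (forall eps, eps > 0 -> exists M, forall x, x <= M -> Rabs (F x) < eps) /\
  (forall eps, eps > 0 -> exists M, forall x, x >= M -> Rabs (F x - 1) < eps).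

Definition conv_dist (Fn : nat -> R -> R) (F : R -> R) : Prop :=
  forall x, continuity_pt F x -> Un_cv (fun n => Fn n x) (F x).

Definition improper_int0 (f : R -> R) (l : R) : Prop :=
  (forall b, 0 <= b -> inhabited (Riemann_integrable f 0 b)) /\
  forall eps, eps > 0 -> exists B, forall b (pr : Riemann_integrable f 0 b),
      b >= B -> Rabs (RiemannInt pr - l) < eps.

(* The s-th moment of the distribution with distribution function G exists
   (absolutely) and equals mu:
     E|Y|^s = int_0^oo s x^(s-1) (P(Y>x) + P(Y<-x)) dx < oo,
     E Y^s  = int_0^oo s x^(s-1) (P(Y>x) + (-1)^s P(Y<-x)) dx. *)
Definition has_moment (G : R -> R) (s : nat) (mu : R) : Prop :=
  match s with
  | O => mu = 1
  | S _ =>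
    (exists l, improper_int0
       (fun x => INR s * x ^ (s - 1) * (1 - G x + G (- x))) l) /\
    improper_int0 (fun x => INR s * x ^ (s - 1) * (1 - G x + (-1) ^ s * G (- x))) mu
  end.

Definition exp1_cdf (x : R) : R := if Rle_dec 0 x then 1 - exp (- x) else 0.

Definition nat_cdf (p : nat -> R) (x : R) : R :=
  if Rle_dec 0 x then sum_f_R0 p (Z.to_nat (up x - 1)) else 0.

(* Main.v *)
From Stdlib Require Import Reals Arith ZArith List Lra Lia ClassicalEpsilon.
From Coquelicot Require Import Rcomplements Rbar Hierarchy Lim_seq Series PSeries ElemFct.
From Coquelicot Require Import Derive RInt RInt_analysis Compactness.
Require Import Defs.
Import ListNotations.
Open Scope R_scope.

(** Each of the [k (d + 1)] insertion positions in cliques containing node [j] (where [d] is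
    its current out-degree) raises its out-degree, so [Y_{n,j}] is a Markov chain: with
    [alpha = k / (k + 1)], it moves from [d] to [d + 1] at step [n -> n + 1] with probability
    [alpha (d + 1) / (n + 1 - alpha)].  This linear chain is solved by inclusion-exclusion:
    [P (Y >= M) = sum_l (-1)^l binom M l prod_(j < i <= n) (1 - alpha l / (i - alpha))].
    The products behave like [(j / n)^(alpha l)] and are bounded, uniformly in [n] and [j], by
    [e^(alpha l) (1 + alpha l)^(alpha l)] times that power; since [alpha < 1] this loses to [l!],
    and dominated convergence in [l] gives the limit laws termwise.  For fixed [j] the limiting
    tail is an entire function of [x]; its moments are the limits of the moments of [Y_{n,j}],
    because truncated moments converge and the truncation errors are uniformly small.  The
    limit law is determined by its moments because the difference [D] of two candidate
    distribution functions integrates to [0] against every polynomial, in particular against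
    the Taylor polynomials of the Fejer kernel [(1 - cos (T (x - c))) / (x - c)^2]; as the
    moments grow slowly these approximate the integral of [D] against the kernel itself,
    which detects the sign of [D] near [c] for large [T]. *)

(** * Evolution of the out-degree *)

(** Tails rather than point probabilities are solved for, because the tail recursion diagonalizes:
    the operator [v -> M (v (M-1) - v M)] has the eigenvectors [binom M l] with eigenvalues [-l],
    and the initial tail expands in them by the alternating binomial sum. A tail is also what a
    distribution function reads off directly, so weak convergence follows without a continuity
    theorem for transforms or moments. The obstacle is a fixed [j]: for large [l] the factors with
    small [i] are negative, the monotone comparison with a power fails there, and the uniform
    constant pays for exactly these factors. The moments come from a dual diagonalization:
    [rising (d + 1) s] is an eigenfunction of the chain. Determinacy is claimed among all laws on
    the line, so the two half-lines are folded onto [x > 0]. The kernel has to be sharpened without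
    limit, and its Taylor error is of order [(4 T^2)^M mu (2 M) / (2 M)!]; this can be made small
    for every [T] because the [Gamma] in the denominator of the limit moments outgrows every
    geometric sequence. *)

Definition rsum {T : Type} (f : T -> R) (l : list T) : R :=
  fold_right (fun x acc => f x + acc) 0 l.

Lemma rsum_app {T} (f : T -> R) l1 l2 : rsum f (l1 ++ l2) = rsum f l1 + rsum f l2.
Proof. induction l1 as [|x l1 IH]; simpl; [ring | rewrite IH; ring]. Qed.

Lemma rsum_ext_in {T} (f g : T -> R) l :
  (forall x, In x l -> f x = g x) -> rsum f l = rsum g l.
Proof.
  induction l as [|x l IH]; simpl; intros H; [reflexivity|].
  rewrite H, IH; auto.
Qed.

Lemma rsum_map {T U} (f : U -> R) (g : T -> U) l :
  rsum f (map g l) = rsum (fun x => f (g x)) l.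
Proof. induction l as [|x l IH]; simpl; [reflexivity | rewrite IH; reflexivity]. Qed.

Lemma rsum_flat_map {T U} (f : U -> R) (g : T -> list U) l :
  rsum f (flat_map g l) = rsum (fun x => rsum f (g x)) l.
Proof.
  induction l as [|x l IH]; simpl; [reflexivity | rewrite rsum_app, IH; reflexivity].
Qed.

Lemma rsum_const {T} (c : R) (l : list T) : rsum (fun _ => c) l = c * INR (length l).
Proof.
  induction l as [|x l IH]; [simpl; ring|].
  cbn [length]; rewrite S_INR; simpl; rewrite IH; ring.
Qed.

Lemma rsum_filter {T} (P : T -> bool) (l : list T) :
  INR (length (filter P l)) = rsum (fun x => if P x then 1 else 0) l.
Proof.
  induction l as [|x l IH]; [reflexivity|]; simpl filter; simpl rsum.
  destruct (P x); [cbn [length]; rewrite S_INR, IH; ring | rewrite IH; ring].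
Qed.

Lemma rsum_lin {T} (f g : T -> R) (a b : R) l :
  rsum (fun x => a * f x + b * g x) l = a * rsum f l + b * rsum g l.
Proof. induction l as [|x l IH]; simpl; [ring | rewrite IH; ring]. Qed.

Lemma rsum_scal {T} (f : T -> R) (a : R) l : rsum (fun x => a * f x) l = a * rsum f l.
Proof. induction l as [|x l IH]; simpl; [ring | rewrite IH; ring]. Qed.

Lemma rsum_le {T} (f g : T -> R) l :
  (forall x, f x <= g x) -> rsum f l <= rsum g l.
Proof. intros H; induction l as [|x l IH]; simpl; [lra | specialize (H x); lra]. Qed.

(** * Cliques and insertion positions *)

Lemma node_eqb_spec (u v : node) : node_eqb u v = true <-> u = v.
Proof.
  destruct u, v; simpl; rewrite ?Nat.eqb_eq; split; congruence.
Qed.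

Definition contains (u : node) (K : clique) : bool := existsb (node_eqb u) K.

Lemma contains_In (u : node) (K : clique) : contains u K = true <-> In u K.
Proof.
  unfold contains; rewrite existsb_exists; split.
  - intros [v [Hv E]]; apply node_eqb_spec in E; subst; exact Hv.
  - intros H; exists u; split; [exact H | apply node_eqb_spec; reflexivity].
Qed.

Lemma contains_notIn (u : node) (K : clique) : contains u K = false <-> ~ In u K.
Proof. rewrite <- contains_In; destruct (contains u K); split; congruence. Qed.

Definition without (K : clique) (w : node) : clique :=
  filter (fun v => negb (node_eqb v w)) K.

Definition new_cliques (x : nat) (K : clique) : list clique :=
  map (fun w => Ins x :: without K w) K.

Lemma In_without (u w : node) (K : clique) : In u (without K w) <-> In u K /\ u <> w.
Proof.
  unfold without; rewrite filter_In, Bool.negb_true_iff.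
  rewrite <- (node_eqb_spec u w); destruct (node_eqb u w); intuition congruence.
Qed.

Lemma length_without (K : clique) (w : node) :
  NoDup K -> In w K -> S (length (without K w)) = length K.
Proof.
  induction K as [|v K IH]; simpl; [easy|]; intros ND Hw.
  inversion ND as [|? ? Hv ND']; subst.
  destruct (node_eqb v w) eqn:E; simpl.
  - apply node_eqb_spec in E; subst v; f_equal; f_equal.
    clear IH ND ND' Hw; induction K as [|u K IH]; simpl; [reflexivity|].
    destruct (node_eqb u w) eqn:E; simpl.
    + apply node_eqb_spec in E; subst; exfalso; apply Hv; left; reflexivity.
    + f_equal; apply IH; intros H; apply Hv; right; exact H.
  - f_equal; apply IH; [exact ND'|].
    destruct Hw as [Hw|Hw]; [|exact Hw].
    apply node_eqb_spec in Hw; congruence.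
Qed.

(** For [u] in [K], only the new clique that drops [u] itself loses it. For [u] outside [K] no new
    clique can contain it, since it also differs from the inserted node. *)
Lemma count_new_cliques_containing (u : node) (x : nat) (K : clique) :
  NoDup K -> u <> Ins x ->
  length (filter (contains u) (new_cliques x K))
  = if contains u K then (length K - 1)%nat else 0%nat.
Proof.
  intros ND Hu; unfold new_cliques.
  assert (E : forall w, contains u (Ins x :: without K w)
                        = (contains u K && negb (node_eqb w u))%bool).
  { intros w; apply Bool.eq_iff_eq_true.
    rewrite Bool.andb_true_iff, Bool.negb_true_iff, !contains_In; simpl.
    rewrite In_without, <- Bool.not_true_iff_false, node_eqb_spec.
    intuition congruence. }
  assert (L : forall L, length (filter (contains u) (map (fun w => Ins x :: without K w) L))
     = length (filter (fun w => contains u K && negb (node_eqb w u))%bool L)).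
  { intros L; induction L as [|w L IH]; [reflexivity|].
    cbn [map filter]; rewrite (E w); destruct (contains u K && negb (node_eqb w u))%bool;
      cbn [length]; congruence. }
  rewrite L; clear L E.
  destruct (contains u K) eqn:C; simpl.
  - apply contains_In in C; fold (without K u).
    pose proof (length_without K u ND C); lia.
  - induction K; simpl in *; [reflexivity|]; clear.
    induction K; simpl; auto.
Qed.

(** Number of positions open to the next node in the cliques satisfying [P]. Children are recorded
    by clique index, so [c] carries the index of the head of [cl] in the full list. *)
Fixpoint weight (P : clique -> bool) (t : list choice) (c : nat) (cl : list clique) : nat :=
  match cl with
  | [] => 0
  | K :: cl' => (if P K then S (ndeg t c) else 0) + weight P t (S c) cl'
  end.

Lemma weight_app P t c l1 l2 :
  weight P t c (l1 ++ l2) = (weight P t c l1 + weight P t (c + length l1) l2)%nat.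
Proof.
  revert c; induction l1 as [|K l1 IH]; intros c; simpl.
  - f_equal; lia.
  - rewrite IH; replace (c + S (length l1))%nat with (S c + length l1)%nat by lia; lia.
Qed.

Lemma ndeg_snoc t ch c :
  ndeg (t ++ [ch]) c = (ndeg t c + if Nat.eqb (fst ch) c then 1 else 0)%nat.
Proof.
  unfold ndeg; rewrite filter_app, length_app; simpl.
  destruct (Nat.eqb (fst ch) c); reflexivity.
Qed.

Lemma ndeg_fresh t c : (forall ch, In ch t -> (fst ch < c)%nat) -> ndeg t c = 0%nat.
Proof.
  unfold ndeg; induction t as [|ch t IH]; simpl; intros H; [reflexivity|].
  pose proof (H ch (or_introl eq_refl)).
  destruct (Nat.eqb_spec (fst ch) c); [lia|]; apply IH; auto.
Qed.

Lemma weight_fresh P t c l :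
  (forall ch, In ch t -> (fst ch < c)%nat) -> weight P t c l = length (filter P l).
Proof.
  revert c; induction l as [|K l IH]; intros c H; simpl; [reflexivity|].
  rewrite IH by (intros ch Hc; specialize (H ch Hc); lia).
  rewrite ndeg_fresh by exact H; destruct (P K); reflexivity.
Qed.

Lemma weight_snoc_before P t ch c l :
  (fst ch < c)%nat -> weight P (t ++ [ch]) c l = weight P t c l.
Proof.
  revert c; induction l as [|K l IH]; intros c H; simpl; [reflexivity|].
  rewrite IH, ndeg_snoc by lia.
  destruct (Nat.eqb_spec (fst ch) c); [lia|]; destruct (P K); lia.
Qed.

Lemma weight_snoc P t ch c l :
  (c <= fst ch < c + length l)%nat ->
  weight P (t ++ [ch]) c l
  = (weight P t c l + if P (nth (fst ch - c) l []) then 1 else 0)%nat.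
Proof.
  revert c; induction l as [|K l IH]; intros c H; simpl in *; [lia|].
  rewrite ndeg_snoc; destruct (Nat.eqb_spec (fst ch) c) as [E|E].
  - rewrite weight_snoc_before by lia.
    replace (fst ch - c)%nat with 0%nat by lia; destruct (P K); lia.
  - rewrite IH by lia.
    replace (fst ch - c)%nat with (S (fst ch - S c)) by lia; destruct (P K); lia.
Qed.

Lemma rsum_choices k t (P : clique -> bool) (A B : R) :
  rsum (fun ch => if P (nth (fst ch) (cls (build k t)) []) then A else B) (choices k t)
  = A * INR (weight P t 0 (cls (build k t)))
    + B * INR (weight (fun K => negb (P K)) t 0 (cls (build k t))).
Proof.
  unfold choices; rewrite rsum_flat_map.
  generalize (cls (build k t)); intros cl.
  transitivity (rsum (fun c => (if P (nth (c - 0) cl []) then A else B)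
                               * INR (S (ndeg t c))) (seq 0 (length cl))).
  { apply rsum_ext_in; intros c _; rewrite rsum_map; simpl fst.
    rewrite Nat.sub_0_r, rsum_const, length_seq; reflexivity. }
  (* The starting index becomes arbitrary, with lookups relative to it, so that the induction can
     peel off the first clique. *)
  generalize 0%nat at 1 2 3 4; intros c0; revert c0.
  induction cl as [|K cl IH]; intros c0; [simpl; ring|].
  cbn [length seq rsum fold_right weight].
  rewrite Nat.sub_diag; simpl nth at 1.
  rewrite !plus_INR.
  fold (rsum (fun c => (if P (nth (c - c0) (K :: cl) []) then A else B)
                       * INR (S (ndeg t c))) (seq (S c0) (length cl))).
  rewrite (rsum_ext_in _ (fun c => (if P (nth (c - S c0) cl []) then A else B)
                                   * INR (S (ndeg t c)))).
  - rewrite IH; destruct (P K); simpl negb; cbn iota; simpl (INR 0); ring.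
  - intros c Hc; apply in_seq in Hc.
    replace (c - c0)%nat with (S (c - S c0)) by lia; reflexivity.
Qed.

Lemma build_snoc k t ch : build k (t ++ [ch]) = step (build k t) ch (S (length t)).
Proof.
  unfold build; change (S (length t)) with (1 + length t)%nat.
  generalize (init_state k) 1%nat; induction t as [|c t IH]; intros s x; simpl.
  - f_equal; lia.
  - rewrite IH; f_equal; lia.
Qed.

Lemma cls_step s ch x :
  cls (step s ch x) = cls s ++ new_cliques x (nth (fst ch) (cls s) []).
Proof. reflexivity. Qed.

Lemma pars_step s ch x : pars (step s ch x) = pars s ++ [nth (fst ch) (cls s) []].
Proof. reflexivity. Qed.

Definition clique_ok (k n : nat) (K : clique) : Prop :=
  NoDup K /\ length K = k /\ forall i, In (Ins i) K -> (i <= n)%nat.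

(** [ok_idx] makes the cliques created by the next step childless, [clique_ok] makes each of them
    lose exactly one node of its parent clique, and [ok_total] counts the equally likely
    positions. *)
Record tree_ok (k n : nat) (t : list choice) : Prop := {
  ok_size : length t = n;
  ok_ncls : length (cls (build k t)) = (1 + k * n)%nat;
  ok_idx : forall ch, In ch t -> (fst ch < length (cls (build k t)))%nat;
  ok_cls : forall K, In K (cls (build k t)) -> clique_ok k n K;
  ok_pars : forall K, In K (pars (build k t)) -> clique_ok k n K;
  ok_total : weight (fun _ => true) t 0 (cls (build k t)) = (1 + (k + 1) * n)%nat }.

Lemma clique_ok_root k : clique_ok k 0 (root_clique k).
Proof.
  unfold root_clique; split; [|split].
  - apply NoDup_map_NoDup_ForallPairs; [intros a b _ _ H; congruence | apply seq_NoDup].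
  - rewrite length_map, length_seq; reflexivity.
  - intros i H; apply in_map_iff in H; destruct H as [l [H _]]; discriminate.
Qed.

Lemma clique_ok_S k n K : clique_ok k n K -> clique_ok k (S n) K.
Proof. intros [H1 [H2 H3]]; split; [|split]; auto. Qed.

Lemma clique_ok_new k n K K' :
  clique_ok k n K -> In K' (new_cliques (S n) K) -> clique_ok k (S n) K'.
Proof.
  intros [H1 [H2 H3]] H; apply in_map_iff in H; destruct H as [w [<- Hw]].
  split; [|split].
  - constructor.
    + rewrite In_without; intros [H _]; apply H3 in H; lia.
    + apply NoDup_filter; exact H1.
  - cbn [length]; rewrite length_without; auto.
  - intros i [E|Hi]; [injection E; lia|].
    apply In_without in Hi; destruct Hi as [Hi _]; apply H3 in Hi; lia.
Qed.

Lemma In_choices_idx k t ch :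
  In ch (choices k t) -> (fst ch < length (cls (build k t)))%nat.
Proof.
  unfold choices; rewrite in_flat_map; intros [c [Hc H]].
  apply in_map_iff in H; destruct H as [p [<- _]]; apply in_seq in Hc; simpl; lia.
Qed.

Lemma In_trees_S k n t :
  In t (trees k (S n)) <->
  exists t' ch, t = t' ++ [ch] /\ In t' (trees k n) /\ In ch (choices k t').
Proof.
  simpl; rewrite in_flat_map; split.
  - intros [t' [Ht' H]]; apply in_map_iff in H; destruct H as [ch [<- Hch]]; eauto.
  - intros [t' [ch [-> [H1 H2]]]]; exists t'; split; [exact H1|].
    apply in_map_iff; eauto.
Qed.

(** The chosen clique gains one position, and every clique created by the step opens with exactly
    one, being childless. *)
Lemma weight_step P k n t ch :
  tree_ok k n t -> In ch (choices k t) ->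
  let K := nth (fst ch) (cls (build k t)) [] in
  weight P (t ++ [ch]) 0 (cls (build k (t ++ [ch])))
  = (weight P t 0 (cls (build k t)) + (if P K then 1 else 0)
     + length (filter P (new_cliques (S n) K)))%nat.
Proof.
  intros OK Hch K; apply In_choices_idx in Hch.
  rewrite build_snoc, (ok_size _ _ _ OK), cls_step; fold K; rewrite weight_app, weight_snoc by lia.
  rewrite Nat.sub_0_r; fold K; f_equal.
  apply weight_fresh; intros c Hc; apply in_app_or in Hc.
  destruct Hc as [Hc|[<-|[]]]; [apply (ok_idx _ _ _ OK) in Hc|]; simpl; lia.
Qed.

Lemma trees_ok k n t : In t (trees k n) -> tree_ok k n t.
Proof.
  revert t; induction n as [|n IH]; intros t Ht.
  - destruct Ht as [<-|[]]; constructor; simpl; try lia; try easy.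
    intros K [<-|[]]; apply clique_ok_root.
  - apply In_trees_S in Ht; destruct Ht as [t' [ch [-> [Ht' Hch]]]].
    specialize (IH _ Ht'); pose proof (In_choices_idx _ _ _ Hch) as Hi.
    assert (HK : clique_ok k n (nth (fst ch) (cls (build k t')) [])).
    { apply (ok_cls _ _ _ IH), nth_In, Hi. }
    pose proof (weight_step (fun _ => true) _ _ _ _ IH Hch) as W; simpl in W.
    rewrite (ok_total _ _ _ IH) in W.
    destruct IH as [I1 I2 I3 I4 I5 _].
    assert (L : length (new_cliques (S n) (nth (fst ch) (cls (build k t')) [])) = k).
    { unfold new_cliques; rewrite length_map; apply HK. }
    assert (F : forall T (l : list T), filter (fun _ => true) l = l).
    { intros T l; induction l; simpl; congruence. }
    rewrite F, L in W.
    constructor; rewrite ?W; try nia;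
      rewrite ?build_snoc, ?cls_step, ?pars_step, ?length_app, ?I1.
    + simpl; lia.
    + rewrite L, I2; nia.
    + intros c Hc.
      apply in_app_or in Hc; destruct Hc as [Hc|[<-|[]]]; [apply I3 in Hc|]; lia.
    + intros K H; apply in_app_or in H; destruct H as [H|H].
      * apply clique_ok_S; auto.
      * eapply clique_ok_new; eauto.
    + intros K H; apply in_app_or in H; destruct H as [H|[<-|[]]];
        apply clique_ok_S; auto.
Qed.

Lemma outdeg_snoc k t ch u :
  outdeg k (t ++ [ch]) u
  = (outdeg k t u
     + if contains u (nth (fst ch) (cls (build k t)) []) then 1 else 0)%nat.
Proof.
  unfold outdeg; rewrite build_snoc, pars_step, filter_app, length_app; simpl; unfold contains.
  destruct (existsb _ _); reflexivity.
Qed.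

Lemma outdeg_before k n t j :
  In t (trees k n) -> (n < j)%nat -> outdeg k t (Ins j) = 0%nat.
Proof.
  intros Ht Hj; pose proof (ok_pars _ _ _ (trees_ok _ _ _ Ht)) as H; unfold outdeg.
  induction (pars (build k t)) as [|K l IH]; simpl; [reflexivity|].
  destruct (existsb (node_eqb (Ins j)) K) eqn:E.
  - apply contains_In in E; apply H in E; [lia | left; reflexivity].
  - apply IH; intros K' HK'; apply H; right; exact HK'.
Qed.

Lemma filter_all_true {T} (P : T -> bool) l :
  (forall x, In x l -> P x = true) -> filter P l = l.
Proof.
  induction l as [|x l IH]; simpl; intros H; [reflexivity|].
  rewrite H by auto; f_equal; auto.
Qed.

Lemma not_contains_before k n t j c :
  In t (trees k n) -> (n < j)%nat -> (c < length (cls (build k t)))%nat ->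
  contains (Ins j) (nth c (cls (build k t)) []) = false.
Proof.
  intros Ht Hj Hc; apply contains_notIn; intros H.
  apply (ok_cls _ _ _ (trees_ok _ _ _ Ht)) in H; [lia | apply nth_In; exact Hc].
Qed.

Lemma weight_before k n t j :
  In t (trees k n) -> (n < j)%nat ->
  weight (contains (Ins j)) t 0 (cls (build k t)) = 0%nat.
Proof.
  intros Ht Hj; pose proof (ok_cls _ _ _ (trees_ok _ _ _ Ht)) as H.
  generalize 0%nat at 1; revert H; generalize (cls (build k t)).
  intros l; induction l as [|K l IH]; intros H c; simpl; [reflexivity|].
  replace (contains (Ins j) K) with false.
  - apply IH; intros K' HK'; apply H; right; exact HK'.
  - symmetry; apply contains_notIn; intros E; apply H in E; [lia | left; reflexivity].
Qed.

(* Each new child of a clique containing [j] occupies one more position there and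
   creates [k - 1] further cliques containing [j]. *)
Lemma weight_outdeg k n t j :
  (1 <= k)%nat -> (1 <= j <= n)%nat -> In t (trees k n) ->
  weight (contains (Ins j)) t 0 (cls (build k t)) = (k * (outdeg k t (Ins j) + 1))%nat
  /\ (n = j -> outdeg k t (Ins j) = 0%nat).
Proof.
  intros Hk Hj; revert t; induction n as [|n IH]; intros t Ht; [lia|].
  apply In_trees_S in Ht; destruct Ht as [t' [ch [-> [Ht' Hch]]]].
  pose proof (trees_ok _ _ _ Ht') as OK; pose proof (In_choices_idx _ _ _ Hch) as Hi.
  rewrite (weight_step _ _ _ _ _ OK Hch), outdeg_snoc.
  set (K := nth (fst ch) (cls (build k t')) []).
  assert (HK : clique_ok k n K) by (apply (ok_cls _ _ _ OK), nth_In, Hi).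
  destruct (Nat.eq_dec (S n) j) as [<-|Hne].
  - assert (C : contains (Ins (S n)) K = false)
      by (unfold K; apply (not_contains_before k n); auto).
    rewrite C, (weight_before k n), (outdeg_before k n) by auto.
    rewrite filter_all_true.
    + unfold new_cliques; rewrite length_map; destruct HK as [_ [-> _]].
      split; intros; nia.
    + intros K' H; apply in_map_iff in H; destruct H as [w [<- _]].
      apply contains_In; left; reflexivity.
  - destruct (IH ltac:(lia) _ Ht') as [-> _]; split; [|congruence].
    rewrite count_new_cliques_containing by (try apply HK; intros E; injection E; lia).
    destruct HK as [_ [-> _]]; destruct (contains (Ins j) K); nia.
Qed.

(** * Expectations over trees and the one-step recursion *)

Definition expect (k n j : nat) (f : nat -> R) : R :=
  rsum (fun t => f (outdeg k t (Ins j))) (trees k n) / INR (length (trees k n)).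

Lemma rsum_trees_S k n (f : list choice -> R) :
  rsum f (trees k (S n))
  = rsum (fun t => rsum (fun ch => f (t ++ [ch])) (choices k t)) (trees k n).
Proof.
  simpl; rewrite rsum_flat_map; apply rsum_ext_in; intros t _; apply rsum_map.
Qed.

Lemma weight_compl P t c l :
  (weight P t c l + weight (fun K => negb (P K)) t c l)%nat
  = weight (fun _ => true) t c l.
Proof.
  revert c; induction l as [|K l IH]; intros c; simpl; [reflexivity|].
  rewrite <- IH; destruct (P K); simpl; lia.
Qed.

Lemma rsum_choices_outdeg k n t j (f : nat -> R) :
  In t (trees k n) ->
  rsum (fun ch => f (outdeg k (t ++ [ch]) (Ins j))) (choices k t)
  = let d := outdeg k t (Ins j) in
    let w := INR (weight (contains (Ins j)) t 0 (cls (build k t))) in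
    w * f (S d) + (1 + (INR k + 1) * INR n - w) * f d.
Proof.
  intros Ht; cbv zeta; set (d := outdeg k t (Ins j)).
  set (w := INR (weight (contains (Ins j)) t 0 (cls (build k t)))).

  transitivity (rsum (fun ch : choice =>
    if contains (Ins j) (nth (fst ch) (cls (build k t)) []) then f (S d) else f d)
    (choices k t)).
  2: {
    rewrite rsum_choices.
    pose proof (weight_compl (contains (Ins j)) t 0 (cls (build k t))) as W.
    rewrite (ok_total _ _ _ (trees_ok _ _ _ Ht)) in W; apply (f_equal INR) in W.
    rewrite !plus_INR, mult_INR, plus_INR in W; simpl (INR 1) in W; fold w in W.
    fold w; replace (INR (weight _ _ _ _)) with (1 + (INR k + 1) * INR n - w) by lra.
    ring. }
  apply rsum_ext_in; intros ch _; rewrite outdeg_snoc; fold d.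
    destruct (contains _ _); f_equal; lia.
Qed.

Lemma length_trees_S k n :
  INR (length (trees k (S n)))
  = (1 + (INR k + 1) * INR n) * INR (length (trees k n)).
Proof.
  transitivity (rsum (fun _ => 1) (trees k (S n))); [rewrite rsum_const; ring|].
  rewrite rsum_trees_S, <- rsum_const; apply rsum_ext_in; intros t Ht.
  (* The node index 0 is arbitrary: for a constant function the weight cancels and the total number
     of positions remains. *)
  rewrite (rsum_choices_outdeg k n t 0 (fun _ => 1) Ht); simpl; ring.
Qed.

Lemma length_trees_pos k n : 0 < INR (length (trees k n)).
Proof.
  induction n as [|n IH]; [simpl; lra|].
  rewrite length_trees_S; apply Rmult_lt_0_compat; [|exact IH].
  pose proof (pos_INR k); pose proof (pos_INR n); nra.
Qed.

Lemma expect_ext k n j f g : (forall d, f d = g d) -> expect k n j f = expect k n j g.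
Proof.
  intros H; unfold expect; f_equal; apply rsum_ext_in; intros t _; apply H.
Qed.

Lemma expect_const k n j c : expect k n j (fun _ => c) = c.
Proof.
  unfold expect; rewrite rsum_const; field.
  apply Rgt_not_eq, length_trees_pos.
Qed.

Lemma expect_lin k n j f g a b :
  expect k n j (fun d => a * f d + b * g d) = a * expect k n j f + b * expect k n j g.
Proof.
  unfold expect; rewrite rsum_lin; field.
  apply Rgt_not_eq, length_trees_pos.
Qed.

Lemma expect_le k n j f g : (forall d, f d <= g d) -> expect k n j f <= expect k n j g.
Proof.
  intros H; unfold expect, Rdiv; apply Rmult_le_compat_r.
  - apply Rlt_le, Rinv_0_lt_compat, length_trees_pos.
  - apply rsum_le; intros t; apply H.
Qed.

Lemma expect_init k j f : (1 <= k)%nat -> (1 <= j)%nat -> expect k j j f = f 0%nat.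
Proof.
  intros Hk Hj; rewrite <- (expect_const k j j (f 0%nat)).
  unfold expect; f_equal; apply rsum_ext_in; intros t Ht.
  destruct (weight_outdeg k j t j) as [_ H]; auto; rewrite H; auto.
Qed.

Lemma expect_step k n j f :
  (1 <= k)%nat -> (1 <= j <= n)%nat ->
  let al := INR k / (INR k + 1) in
  expect k (S n) j f
  = expect k n j (fun d => f d + al / (INR n + 1 - al) * (INR (S d) * (f (S d) - f d))).
Proof.
  intros Hk Hj al.
  set (g := fun d : nat => f d + al / (INR n + 1 - al) * (INR (S d) * (f (S d) - f d))).
  unfold expect; rewrite rsum_trees_S, length_trees_S.
  pose proof (length_trees_pos k n) as Hp; pose proof (pos_INR k) as Hk0.
  pose proof (pos_INR n) as Hn.
  assert (Hd : 1 + (INR k + 1) * INR n > 0) by nra.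
  (* The total number of positions divided by [k + 1]; this turns [k (d + 1)] out of [1 + (k + 1) n]
     into the fraction with [alpha]. *)
  assert (E : INR n + 1 - al = (1 + (INR k + 1) * INR n) / (INR k + 1))
    by (unfold al; field; lra).
  transitivity ((1 + (INR k + 1) * INR n)
                * rsum (fun t => g (outdeg k t (Ins j))) (trees k n)
                / ((1 + (INR k + 1) * INR n) * INR (length (trees k n)))); [|field; lra].
  f_equal; rewrite <- rsum_scal; apply rsum_ext_in; intros t Ht.
  rewrite (rsum_choices_outdeg k n t j f Ht); cbv zeta; unfold g.
  destruct (weight_outdeg k n t j Hk Hj Ht) as [-> _].
  rewrite mult_INR, plus_INR, (S_INR (outdeg k t (Ins j))), E; unfold al; simpl (INR 1).
  field; lra.
Qed.

Definition indic (P : bool) : R := if P then 1 else 0.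

Lemma prob_Y_expect k n j m :
  prob_Y k n j m = expect k n j (fun d => indic (Nat.eqb d m)).
Proof. unfold prob_Y, expect; rewrite rsum_filter; reflexivity. Qed.

Lemma cdf_Y_expect k n j c x :
  cdf_Y k n j c x
  = expect k n j (fun d => indic (if Rle_dec (c * INR d) x then true else false)).
Proof. unfold cdf_Y, expect; rewrite rsum_filter; reflexivity. Qed.

(** * Exact distribution *)

Lemma falling_shift x m : falling x (S m) = x * falling (x - 1) m.
Proof.
  induction m as [|m IH]; [simpl; ring|].
  change (falling x (S (S m))) with (falling x (S m) * (x - INR (S m))).
  rewrite IH, S_INR; simpl; ring.
Qed.

Lemma rising_shift x m : rising x (S m) = x * rising (x + 1) m.
Proof.
  induction m as [|m IH]; [simpl; ring|].
  change (rising x (S (S m))) with (rising x (S m) * (x + INR (S m))).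
  rewrite IH, S_INR; simpl; ring.
Qed.

Lemma rising_pos x m : 0 < x -> 0 < rising x m.
Proof.
  intros Hx; induction m as [|m IH]; simpl; [lra|].
  pose proof (pos_INR m); apply Rmult_lt_0_compat; lra.
Qed.

Lemma falling_rising x m : falling x m = rising (x - INR m + 1) m.
Proof.
  revert x; induction m as [|m IH]; intros x; [reflexivity|].
  rewrite falling_shift, IH, S_INR; simpl rising.
  replace (x - 1 - INR m + 1) with (x - (INR m + 1) + 1) by ring; ring.
Qed.

Lemma falling_add x p q : falling x (p + q) = falling x p * falling (x - INR p) q.
Proof.
  induction q as [|q IH]; [rewrite Nat.add_0_r; simpl; ring|].
  rewrite Nat.add_succ_r; simpl; rewrite IH, plus_INR; ring.
Qed.

Lemma falling_fact n : falling (INR n) n = INR (fact n).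
Proof.
  induction n as [|n IH]; [reflexivity|].
  rewrite falling_shift; replace (INR (S n) - 1) with (INR n) by (rewrite S_INR; ring).
  rewrite IH; change (fact (S n)) with (S n * fact n)%nat; rewrite mult_INR; ring.
Qed.

Lemma falling_nat_0 m l : (m < l)%nat -> falling (INR m) l = 0.
Proof.
  intros H; replace l with (S m + (l - S m))%nat by lia.
  rewrite falling_add; simpl; ring.
Qed.

Lemma falling_nat n j : (j <= n)%nat ->
  falling (INR n) j * INR (fact (n - j)) = INR (fact n).
Proof.
  intros H; rewrite <- (falling_fact n), <- (falling_fact (n - j)), minus_INR by exact H.
  rewrite <- falling_add; f_equal; lia.
Qed.

Lemma Rbinom_C m l : (l <= m)%nat -> C m l = Rbinom (INR m) l.
Proof.
  intros H; unfold C, Rbinom; rewrite <- (falling_nat m l H).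
  field; split; apply INR_fact_neq_0.
Qed.

Lemma Rbinom_nat_0 m l : (m < l)%nat -> Rbinom (INR m) l = 0.
Proof. intros H; unfold Rbinom; rewrite falling_nat_0 by exact H; field; apply INR_fact_neq_0. Qed.

(** The eigenvector identity: it yields [M (binom (M-1) l - binom M l) = - l binom M l]. *)
Lemma Rbinom_absorb x l : x * Rbinom (x - 1) l = (x - INR l) * Rbinom x l.
Proof.
  unfold Rbinom; pose proof (falling_shift x l) as E; simpl in E.
  unfold Rdiv; rewrite <- !Rmult_assoc, <- E; ring.
Qed.

Lemma Rbinom_pascal x l : Rbinom (x + 1) (S l) = Rbinom x (S l) + Rbinom x l.
Proof.
  unfold Rbinom; rewrite falling_shift; replace (x + 1 - 1) with x by ring.
  change (fact (S l)) with (S l * fact l)%nat; rewrite mult_INR; simpl falling.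
  rewrite S_INR; pose proof (pos_INR l); field; split; [apply INR_fact_neq_0 | lra].
Qed.

Lemma sum_f_R0_extend f m p : (forall l, (m < l)%nat -> f l = 0) ->
  sum_f_R0 f (m + p) = sum_f_R0 f m.
Proof.
  intros H; induction p as [|p IH]; [f_equal; lia|].
  rewrite Nat.add_succ_r; simpl; rewrite IH, H by lia; ring.
Qed.

(** The product of [1 - b / (a + i)] over [i < N]. With [a = j + 1 - alpha], [b = alpha l] and
    [N = n - j] it is the product over [j < i <= n] in the tail formula. *)
Definition ratio (a b : R) (N : nat) : R := rising (a - b) N / rising a N.

Lemma ratio_S a b N : 0 < a -> ratio a b (S N) = ratio a b N * (1 - b / (a + INR N)).
Proof.
  intros Ha; unfold ratio; simpl; pose proof (rising_pos a N Ha); pose proof (pos_INR N).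
  field; lra.
Qed.

Lemma ratio_0 a N : 0 < a -> ratio a 0 N = 1.
Proof.
  intros Ha; unfold ratio; rewrite Rminus_0_r; pose proof (rising_pos a N Ha); field; lra.
Qed.

Definition alpha (k : nat) : R := INR k / (INR k + 1).

Lemma alpha_bounds k : (1 <= k)%nat -> 0 < alpha k < 1.
Proof.
  intros H; apply le_INR in H; simpl in H; unfold alpha; split.
  - apply Rdiv_lt_0_compat; lra.
  - apply Rmult_lt_reg_r with (INR k + 1); [lra|].
    unfold Rdiv; rewrite Rmult_assoc, Rinv_l; lra.
Qed.

Definition tail_sum (k j N M : nat) : R :=
  sum_f_R0 (fun l => (-1) ^ l * Rbinom (INR M) l
                     * ratio (INR j + 1 - alpha k) (alpha k * INR l) N) M.

Lemma alternating_binomial_sum M :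
  sum_f_R0 (fun l => (-1) ^ l * Rbinom (INR M) l) M = indic (Nat.leb M 0).
Proof.
  transitivity ((-1 + 1) ^ M).
  - rewrite binomial; apply sum_eq; intros i Hi.
    rewrite Rbinom_C, pow1 by exact Hi; ring.
  - destruct M; simpl; [reflexivity | ring].
Qed.

(** The recursion holds separately for each [l]: by [Rbinom_absorb] its right-hand side multiplies
    the [l]-th term by [1 - e l], which is the next factor of the product. *)
Lemma tail_step k j N M : (1 <= k)%nat -> (1 <= j)%nat ->
  let e := alpha k / (INR j + 1 - alpha k + INR N) in
  tail_sum k j (S N) (S M)
  = tail_sum k j N (S M) + e * INR (S M) * (tail_sum k j N M - tail_sum k j N (S M)).
Proof.
  intros Hk Hj e; unfold tail_sum.
  pose proof (alpha_bounds k Hk); apply le_INR in Hj; simpl in Hj; pose proof (pos_INR N).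
  (* The null term [l = M + 1] is appended so that all three sums have the same range. *)
  rewrite <- (sum_f_R0_extend (fun l => (-1) ^ l * Rbinom (INR M) l
                     * ratio (INR j + 1 - alpha k) (alpha k * INR l) N) M 1)
    by (intros l Hl; rewrite Rbinom_nat_0 by exact Hl; ring).
  rewrite Nat.add_1_r, <- minus_sum, scal_sum, <- plus_sum.
  apply sum_eq; intros l _; rewrite ratio_S by lra.
  pose proof (Rbinom_absorb (INR (S M)) l) as E.
  replace (INR (S M) - 1) with (INR M) in E by (rewrite S_INR; ring).
  set (r := ratio _ _ _) in *; set (c := Rbinom (INR (S M)) l) in *.
  transitivity ((-1) ^ l * c * r + e * (-1) ^ l * r * (INR (S M) * Rbinom (INR M) l - INR (S M) * c));
    [rewrite E; unfold e; field; lra | ring].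
Qed.

(** In [(d + 1) (f (d + 1) - f d)] the indicator [f] of [M + 1 <= d] jumps only at [d = M], where
    [d + 1] is the constant [M + 1]. Hence the tails obey the recursion of [tail_step]; both sides
    start from the indicator of [M <= 0]. *)
Lemma expect_tail k j N M : (1 <= k)%nat -> (1 <= j)%nat ->
  expect k (j + N) j (fun d => indic (Nat.leb M d)) = tail_sum k j N M.
Proof.
  intros Hk Hj; revert M; induction N as [|N IH]; intros M.
  - rewrite Nat.add_0_r, expect_init by auto; unfold tail_sum.
    rewrite <- alternating_binomial_sum; apply sum_eq; intros l _.
    unfold ratio; simpl; field.
  - destruct M as [|M].
    + transitivity (expect k (j + S N) j (fun _ => 1)); [apply expect_ext; reflexivity|].
      rewrite expect_const; unfold tail_sum; simpl.
      rewrite Rmult_0_r, ratio_0; [unfold Rbinom; simpl; field|].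
      pose proof (alpha_bounds k Hk); apply le_INR in Hj; simpl in Hj; lra.
    + rewrite Nat.add_succ_r, expect_step by lia; cbv zeta.
      rewrite tail_step by auto; cbv zeta; rewrite <- !IH.
      fold (alpha k); set (e := alpha k / (INR (j + N) + 1 - alpha k)).
      replace (alpha k / (INR j + 1 - alpha k + INR N)) with e
        by (unfold e; f_equal; rewrite plus_INR; ring).
      transitivity (expect k (j + N) j (fun d => (1 - e * INR (S M)) * indic (Nat.leb (S M) d)
                                          + e * INR (S M) * indic (Nat.leb M d)));
        [|rewrite expect_lin; ring].
      apply expect_ext; intros d.
      destruct (Nat.leb_spec (S M) (S d)), (Nat.leb_spec (S M) d), (Nat.leb_spec M d);
        unfold indic; try lia; try ring.
      replace M with d by lia; ring.
Qed.

(** In the difference of consecutive tails the term [l = 0] cancels, and Pascal's rule reduces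
    [binom (m+1) (l+1) - binom m (l+1)] to [binom m l]; this reindexing produces [1 + l]. *)
Lemma expect_eq_tail k j N m : (1 <= k)%nat -> (1 <= j)%nat ->
  expect k (j + N) j (fun d => indic (Nat.eqb d m))
  = sum_f_R0 (fun l => C m l * (-1) ^ l
               * ratio (INR j + 1 - alpha k) (alpha k * (1 + INR l)) N) m.
Proof.
  intros Hk Hj.
  transitivity (tail_sum k j N m - tail_sum k j N (S m)).
  { rewrite <- !expect_tail by auto.
    transitivity (expect k (j + N) j (fun d => 1 * indic (Nat.leb m d) + (-1) * indic (Nat.leb (S m) d)));
      [|rewrite expect_lin; ring].
    apply expect_ext; intros d.
    destruct (Nat.leb_spec (S m) d), (Nat.leb_spec m d), (Nat.eqb_spec d m);
      unfold indic; try lia; ring. }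
  unfold tail_sum.
  rewrite <- (sum_f_R0_extend (fun l => (-1) ^ l * Rbinom (INR m) l
                     * ratio (INR j + 1 - alpha k) (alpha k * INR l) N) m 1)
    by (intros l Hl; rewrite Rbinom_nat_0 by exact Hl; ring).
  rewrite Nat.add_1_r, <- minus_sum, decomp_sum by lia; simpl pred.
  symmetry; rewrite <- (Rplus_0_l (sum_f_R0 _ m)); symmetry; f_equal; [unfold Rbinom; simpl; field|].
  apply sum_eq; intros l Hl.
  rewrite Rbinom_C, (S_INR m), Rbinom_pascal, (S_INR l) by exact Hl.
  rewrite (Rplus_comm 1 (INR l)); simpl; ring.
Qed.

(** [falling (n - alpha) n] splits after [n - j] factors, and its second part cancels the numerator
    of the first binomial. The factorials cancel by [falling n j * (n - j)! = n!]. *)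
Lemma binomial_quotient_ratio k n j b :
  (1 <= k)%nat -> (1 <= j)%nat -> (j <= n)%nat ->
  Rbinom (INR j - alpha k) j / (Rbinom (INR n - alpha k) n * Rbinom (INR n) j)
  * Rbinom (INR n - alpha k - b) (n - j)
  = ratio (INR j + 1 - alpha k) b (n - j).
Proof.
  intros Hk Hj Hn; pose proof (alpha_bounds k Hk); apply le_INR in Hj; simpl in Hj.
  assert (E1 : falling (INR n - alpha k) n
               = rising (INR j + 1 - alpha k) (n - j) * falling (INR j - alpha k) j).
  { replace n with (n - j + j)%nat at 2 by lia; rewrite falling_add, falling_rising.
    rewrite minus_INR by exact Hn; f_equal; f_equal; ring. }
  unfold Rbinom, ratio; rewrite E1, (falling_rising _ (n - j)), minus_INR by exact Hn.
  replace (INR n - alpha k - b - (INR n - INR j) + 1) with (INR j + 1 - alpha k - b) by ring.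
  pose proof (falling_nat n j Hn) as E2.
  assert (0 < falling (INR j - alpha k) j)
    by (rewrite falling_rising; apply rising_pos; lra).
  assert (0 < rising (INR j + 1 - alpha k) (n - j)) by (apply rising_pos; lra).
  assert (falling (INR n) j <> 0).
  { intros E; rewrite E, Rmult_0_l in E2; apply (INR_fact_neq_0 n); auto. }
  rewrite <- E2; field; repeat split; try lra; apply INR_fact_neq_0.
Qed.

Lemma prob_Y_exact k n j m : (1 <= k)%nat -> (1 <= j)%nat -> (j <= n)%nat ->
  prob_Y k n j m =
    Rbinom (INR j - INR k / (INR k + 1)) j
    / (Rbinom (INR n - INR k / (INR k + 1)) n * Rbinom (INR n) j)
    * sum_f_R0 (fun l => C m l * (-1) ^ l
                  * Rbinom (INR n - INR k * (2 + INR l) / (INR k + 1)) (n - j)) m.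
Proof.
  intros Hk Hj Hn; rewrite prob_Y_expect.
  replace n with (j + (n - j))%nat at 1 by lia.
  rewrite expect_eq_tail, scal_sum by auto; apply sum_eq; intros l _.
  rewrite <- (binomial_quotient_ratio k n j) by auto; fold (alpha k).
  replace (INR n - INR k * (2 + INR l) / (INR k + 1))
    with (INR n - alpha k - alpha k * (1 + INR l)); [ring|].
  unfold alpha; pose proof (pos_INR k); field; lra.
Qed.

(** [f d = rising (d + 1) s] satisfies [(d + 1) (f (d + 1) - f d) = s f d], so each step multiplies
    its expectation by [1 + e s]; the product of these factors is the quotient of rising
    factorials. *)
Lemma expect_rising k j N s : (1 <= k)%nat -> (1 <= j)%nat ->
  let a := INR j + 1 - alpha k in
  expect k (j + N) j (fun d => rising (INR d + 1) s)
  = INR (fact s) * (rising (a + alpha k * INR s) N / rising a N).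
Proof.
  intros Hk Hj a; pose proof (alpha_bounds k Hk) as Hal.
  assert (Ha : 0 < a) by (apply le_INR in Hj; simpl in Hj; unfold a; lra).
  induction N as [|N IH].
  - rewrite Nat.add_0_r, expect_init by auto; simpl rising; field_simplify.
    simpl (INR 0); rewrite Rplus_0_l, <- falling_fact, falling_rising; f_equal; ring.
  - rewrite Nat.add_succ_r, expect_step by lia; cbv zeta; fold (alpha k).
    set (e := alpha k / (INR (j + N) + 1 - alpha k)).
    transitivity (expect k (j + N) j (fun d => (1 + e * INR s) * rising (INR d + 1) s + 0 * 0)).
    + apply expect_ext; intros d.
      pose proof (rising_shift (INR d + 1) s) as E; simpl in E; rewrite S_INR.
      transitivity (rising (INR d + 1) s + e * ((INR d + 1) * rising (INR d + 1 + 1) s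
                                               - (INR d + 1) * rising (INR d + 1) s));
        [ring | rewrite <- E; ring].
    + rewrite expect_lin, IH; simpl rising; unfold e; rewrite plus_INR.
      pose proof (rising_pos a N Ha); pose proof (pos_INR N); unfold a in *; field; lra.
Qed.

(** * Quotients of rising factorials *)

Lemma is_lim_seq_eq_lim (u : nat -> R) (l l' : R) :
  is_lim_seq u l' -> l' = l -> is_lim_seq u l.
Proof. intros H <-; exact H. Qed.

Lemma is_lim_seq_Rpower (u : nat -> R) (l b : R) :
  0 < l -> is_lim_seq u l -> is_lim_seq (fun n => Rpower (u n) b) (Rpower l b).
Proof.
  intros Hl Hu; apply (is_lim_seq_continuous (fun x => Rpower x b) u l); [|exact Hu].
  apply derivable_continuous_pt; exists (b * Rpower l (b - 1)).
  apply derivable_pt_lim_power; exact Hl.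
Qed.

Lemma is_lim_seq_shift_quotient (c d : R) :
  is_lim_seq (fun n => (c + INR n) / (d + INR n)) 1.
Proof.
  destruct (nfloor_ex (Rabs d) (Rabs_pos d)) as [p [_ Hp]].
  apply is_lim_seq_incr_n with (N := S p).
  assert (H : forall n, 0 < d + INR (n + S p)).
  { intros n; rewrite plus_INR, S_INR.
    pose proof (pos_INR n); pose proof (Rle_abs (- d)); rewrite Rabs_Ropp in *; lra. }
  apply is_lim_seq_ext with
    (u := fun n => 1 + (c - d) * / (d + INR (n + S p))).
  { intros n; specialize (H n); field; lra. }
  apply is_lim_seq_eq_lim with (1 + (c - d) * 0); [|ring].
  apply is_lim_seq_plus'; [apply is_lim_seq_const|].
  apply is_lim_seq_mult'; [apply is_lim_seq_const|].
  apply (is_lim_seq_incr_n (fun n => / (d + INR n)) (S p)).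
  change (Finite 0) with (Rbar_inv p_infty).
  apply is_lim_seq_inv; [|discriminate].
  apply is_lim_seq_plus with (l1 := d) (l2 := p_infty);
    [apply is_lim_seq_const | apply is_lim_seq_INR | reflexivity].
Qed.

Lemma Rpower_pos x b : 0 < Rpower x b.
Proof. apply exp_pos. Qed.

Lemma Rpower_1_l b : Rpower 1 b = 1.
Proof. unfold Rpower; rewrite ln_1, Rmult_0_r, exp_0; reflexivity. Qed.

Lemma Rpower_div x y b : 0 < x -> 0 < y -> Rpower (x / y) b = Rpower x b / Rpower y b.
Proof.
  intros Hx Hy; pose proof (Rpower_pos y b).
  apply Rmult_eq_reg_r with (Rpower y b); [|lra].
  rewrite Rpower_mult_distr; [|apply Rdiv_lt_0_compat; lra|exact Hy].
  unfold Rdiv; rewrite !Rmult_assoc, !Rinv_l by lra; rewrite !Rmult_1_r; reflexivity.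
Qed.

Lemma Rpower_ge_1 x b : 1 <= x -> 0 <= b -> 1 <= Rpower x b.
Proof.
  intros Hx Hb; rewrite <- (Rpower_1_l b); apply Rle_Rpower_l; lra.
Qed.

Lemma ln_le_sub x : 0 < x -> ln x <= x - 1.
Proof.
  intros Hx; pose proof (exp_ineq1_le (ln x)); rewrite exp_ln in *; lra.
Qed.

Lemma exp_le_compat x y : x <= y -> exp x <= exp y.
Proof. intros [H| ->]; [left; apply exp_increasing; exact H | right; reflexivity]. Qed.

(** Both factors compare with exponentials: [1 - b/x <= e^(-b/x)] and [((x+1)/x)^b <= e^(b/x)]. The
    powers telescope over [x = a, a + 1, ...], so [ratio a b N * (a + N)^b] does not increase in [N]
    once the factors are nonnegative. *)
Lemma ratio_factor_le x b : 0 < x -> 0 <= b <= x ->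
  0 <= (1 - b / x) * Rpower ((x + 1) / x) b <= 1.
Proof.
  intros Hx Hb.
  assert (Hb' : 0 <= b / x <= 1).
  { split; [apply Rdiv_le_0_compat; lra|].
    apply Rmult_le_reg_r with x; [lra|]; unfold Rdiv; rewrite Rmult_assoc, Rinv_l; lra. }
  assert (E : Rpower ((x + 1) / x) b <= exp (b / x)).
  { unfold Rpower; apply exp_le_compat.
    replace (b / x) with (b * ((x + 1) / x - 1)) by (field; lra).
    apply Rmult_le_compat_l; [lra|]; apply ln_le_sub, Rdiv_lt_0_compat; lra. }
  pose proof (Rpower_pos ((x + 1) / x) b); split; [apply Rmult_le_pos; lra|].
  apply Rle_trans with (exp (- (b / x)) * exp (b / x)).
  - apply Rmult_le_compat; try lra; pose proof (exp_ineq1_le (- (b / x))); lra.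
  - rewrite <- exp_plus, Rplus_opp_l, exp_0; lra.
Qed.

(** [1 / (1 - b/x) = 1 + b/(x-b) <= e^(b/(x-b))], and [ln ((y-1)/y) <= -1/y] at [y = x - b] turns
    the exponential into a power that telescopes as well, at the price of a shift by [b + 1]. *)
Lemma ratio_factor_ge x b : 0 <= b -> b + 1 < x ->
  Rpower ((x - b - 1) / (x - b)) b <= 1 - b / x.
Proof.
  intros Hb Hx.
  assert (E : Rpower ((x - b - 1) / (x - b)) b <= exp (- (b / (x - b)))).
  { unfold Rpower; apply exp_le_compat.
    replace (- (b / (x - b))) with (b * ((x - b - 1) / (x - b) - 1)) by (field; lra).
    apply Rmult_le_compat_l; [lra|]; apply ln_le_sub, Rdiv_lt_0_compat; lra. }
  eapply Rle_trans; [exact E|]; rewrite exp_Ropp.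
  replace (1 - b / x) with (/ (1 + b / (x - b))) by (field; lra).
  apply Rinv_le_contravar; [|apply exp_ineq1_le].
  pose proof (Rdiv_le_0_compat b (x - b)); lra.
Qed.

Lemma ratio_upper a b N : 0 < a -> 0 <= b <= a ->
  0 <= ratio a b N /\ ratio a b N * Rpower ((a + INR N) / a) b <= 1.
Proof.
  intros Ha Hb; induction N as [|N [IH0 IH]].
  - unfold ratio; simpl; rewrite Rplus_0_r; replace (a / a) with 1 by (field; lra).
    rewrite Rpower_1_l; lra.
  - rewrite ratio_S by exact Ha; pose proof (pos_INR N) as HN.
    destruct (ratio_factor_le (a + INR N) b) as [F0 F1]; [lra|lra|].
    pose proof (Rpower_pos ((a + INR N + 1) / (a + INR N)) b) as P.
    assert (0 <= 1 - b / (a + INR N)).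
    { apply Rmult_le_reg_r with (Rpower ((a + INR N + 1) / (a + INR N)) b); lra. }
    split; [apply Rmult_le_pos; assumption|].
    replace (Rpower ((a + INR (S N)) / a) b) with
      (Rpower ((a + INR N + 1) / (a + INR N)) b * Rpower ((a + INR N) / a) b).
    + apply Rle_trans with (1 * 1); [|lra].
      rewrite (Rmult_comm (Rpower _ b) (Rpower _ b)).
      replace (ratio a b N * (1 - b / (a + INR N)) * (Rpower ((a + INR N) / a) b * Rpower ((a + INR N + 1) / (a + INR N)) b))
        with ((ratio a b N * Rpower ((a + INR N) / a) b) * ((1 - b / (a + INR N)) * Rpower ((a + INR N + 1) / (a + INR N)) b)) by ring.
      apply Rmult_le_compat; try assumption.
      apply Rmult_le_pos; [exact IH0 | left; apply Rpower_pos].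
    + rewrite Rpower_mult_distr, S_INR; [f_equal; field; lra| |];
        apply Rdiv_lt_0_compat; lra.
Qed.

Lemma ratio_lower a b N : 0 <= b -> b + 1 < a ->
  Rpower ((a - b - 1) / (a - b - 1 + INR N)) b <= ratio a b N.
Proof.
  intros Hb Ha; induction N as [|N IH].
  - unfold ratio; simpl; rewrite Rplus_0_r.
    replace ((a - b - 1) / (a - b - 1)) with 1 by (field; lra).
    rewrite Rpower_1_l; lra.
  - rewrite ratio_S by lra; pose proof (pos_INR N) as HN.
    pose proof (ratio_factor_ge (a + INR N) b Hb ltac:(lra)) as F.
    apply Rle_trans with
      (Rpower ((a - b - 1) / (a - b - 1 + INR N)) b
       * Rpower ((a + INR N - b - 1) / (a + INR N - b)) b).
    + rewrite Rpower_mult_distr, S_INR by (apply Rdiv_lt_0_compat; lra).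
      right; f_equal; field; lra.
    + apply Rmult_le_compat; try assumption; left; apply Rpower_pos.
Qed.

(** Neither bound involves [N]: the normalized product tends to 1 as soon as [a] tends to infinity,
    however [N] behaves. *)
Lemma ratio_near_1 a b N : 0 <= b -> b + 1 < a ->
  Rpower (1 - (b + 1) / a) b <= ratio a b N * Rpower ((a + INR N) / a) b <= 1.
Proof.
  intros Hb Ha; pose proof (pos_INR N); split; [|apply ratio_upper; lra].
  apply Rle_trans with (Rpower ((a - b - 1) / (a - b - 1 + INR N)) b * Rpower ((a + INR N) / a) b).
  - rewrite Rpower_mult_distr by (apply Rdiv_lt_0_compat; lra).
    apply Rle_Rpower_l; [exact Hb|]; split.
    + replace (1 - (b + 1) / a) with ((a - b - 1) / a) by (field; lra).
      apply Rdiv_lt_0_compat; lra.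
    + replace ((a - b - 1) / (a - b - 1 + INR N) * ((a + INR N) / a))
        with (1 - (b + 1) / a + (1 - (b + 1) / a) * ((b + 1) / (a - b - 1 + INR N)))
        by (field; lra).
      assert (0 <= 1 - (b + 1) / a).
      { replace (1 - (b + 1) / a) with ((a - b - 1) / a) by (field; lra).
        apply Rdiv_le_0_compat; lra. }
      assert (0 <= (b + 1) / (a - b - 1 + INR N)) by (apply Rdiv_le_0_compat; lra).
      nra.
  - apply Rmult_le_compat_r; [left; apply Rpower_pos|]; apply ratio_lower; lra.
Qed.

Lemma rising_add x p q : rising x (p + q) = rising x p * rising (x + INR p) q.
Proof.
  induction q as [|q IH]; [rewrite Nat.add_0_r; simpl; ring|].
  rewrite Nat.add_succ_r; simpl; rewrite IH, plus_INR; ring.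
Qed.

Lemma ratio_add a b p q : 0 < a ->
  ratio a b (p + q) = ratio a b p * ratio (a + INR p) b q.
Proof.
  intros Ha; unfold ratio; rewrite !rising_add.
  replace (a - b + INR p) with (a + INR p - b) by ring.
  pose proof (pos_INR p).
  pose proof (rising_pos a p Ha); pose proof (rising_pos (a + INR p) q ltac:(lra)).
  field; lra.
Qed.

(** All factors are positive here, so the sequence is nonincreasing, and [ratio_lower] keeps it
    above [(a - b - 1)^b > 0]. *)
Lemma ratio_cv_large a b : 0 <= b -> b + 1 < a ->
  exists r, 0 < r /\ is_lim_seq (fun N => ratio a b N * Rpower (a + INR N) b) r.
Proof.
  intros Hb Ha.
  assert (Pos : forall N, Rpower (a - b - 1) b <= ratio a b N * Rpower (a + INR N) b).
  { intros N; pose proof (pos_INR N); pose proof (ratio_lower a b N Hb Ha).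
    apply Rle_trans with (Rpower ((a - b - 1) / (a - b - 1 + INR N)) b * Rpower (a + INR N) b);
      [|apply Rmult_le_compat_r; [left; apply Rpower_pos | assumption]].
    rewrite Rpower_mult_distr; [|apply Rdiv_lt_0_compat; lra|lra].
    apply Rle_Rpower_l; [exact Hb|]; split; [lra|].
    replace ((a - b - 1) / (a - b - 1 + INR N) * (a + INR N))
      with (a - b - 1 + (a - b - 1) * ((b + 1) / (a - b - 1 + INR N))) by (field; lra).
    assert (0 <= (b + 1) / (a - b - 1 + INR N)) by (apply Rdiv_le_0_compat; lra).
    nra. }
  destruct (ex_finite_lim_seq_decr (fun N => ratio a b N * Rpower (a + INR N) b)
              (Rpower (a - b - 1) b)) as [r Hr]; [| exact Pos |].
  - intros N; rewrite ratio_S by lra; pose proof (pos_INR N).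
    destruct (ratio_factor_le (a + INR N) b) as [F0 F1]; [lra|lra|].
    replace (Rpower (a + INR (S N)) b)
      with (Rpower ((a + INR N + 1) / (a + INR N)) b * Rpower (a + INR N) b).
    + transitivity ((ratio a b N * Rpower (a + INR N) b)
        * ((1 - b / (a + INR N)) * Rpower ((a + INR N + 1) / (a + INR N)) b));
        [right; ring|].
      rewrite <- (Rmult_1_r (ratio a b N * Rpower (a + INR N) b)) at 2.
      apply Rmult_le_compat_l; [|exact F1].
      pose proof (Pos N); pose proof (Rpower_pos (a - b - 1) b); lra.
    + rewrite Rpower_mult_distr, S_INR; [f_equal; field; lra|apply Rdiv_lt_0_compat; lra|lra].
  - exists r; split; [|exact Hr].
    apply Rlt_le_trans with (Rpower (a - b - 1) b); [apply Rpower_pos|].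
    apply (is_lim_seq_le (fun _ => Rpower (a - b - 1) b) _ (Rpower (a - b - 1) b) r Pos);
      [apply is_lim_seq_const | exact Hr].
Qed.

(** Finitely many initial factors of unknown sign are split off until the remaining product falls
    under [ratio_cv_large]; for [b < a] they are positive too. *)
Lemma ratio_cv a b : 0 < a -> 0 <= b ->
  exists r, (b < a -> 0 < r)
            /\ is_lim_seq (fun N => ratio a b N * Rpower (a + INR N) b) r.
Proof.
  intros Ha Hb; destruct (nfloor_ex (b + 1)) as [p Hp]; [lra|].
  destruct (ratio_cv_large (a + INR (S p)) b) as [r [Hr L]]; [lra|rewrite S_INR; lra|].
  exists (ratio a b (S p) * r); split.
  - intros H; apply Rmult_lt_0_compat; [|exact Hr].
    apply Rdiv_lt_0_compat; apply rising_pos; lra.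
  - apply is_lim_seq_incr_n with (N := S p).
    apply is_lim_seq_ext with (u := fun N =>
      ratio a b (S p) * (ratio (a + INR (S p)) b N * Rpower (a + INR (S p) + INR N) b)).
    + intros N; rewrite (Nat.add_comm N), ratio_add, plus_INR by exact Ha.
      rewrite Rplus_assoc; ring.
    + apply is_lim_seq_mult'; [apply is_lim_seq_const | exact L].
Qed.

Lemma pow_div_fact_le_exp x n : 0 <= x -> x ^ n / INR (fact n) <= exp x.
Proof.
  intros Hx; eapply Rle_trans; [|apply (exp_ge_taylor x n Hx)].
  assert (P : forall i, 0 <= x ^ i / INR (fact i)).
  { intros i; apply Rdiv_le_0_compat; [apply pow_le; exact Hx | apply INR_fact_lt_0]. }
  destruct n as [|n]; [simpl; lra|]; rewrite tech5.
  pose proof (cond_pos_sum _ n P); lra.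
Qed.

(** While [a + i <= b], a factor has absolute value [b / (a + i) - 1 <= b / (i + 1)], because
    [1 <= a]. *)
Lemma ratio_small_index a b N : 1 <= a -> a + INR N <= b + 1 ->
  Rabs (ratio a b N) <= b ^ N / INR (fact N).
Proof.
  intros Ha; induction N as [|N IH]; intros H.
  - unfold ratio; simpl; rewrite Rabs_pos_eq; lra.
  - rewrite S_INR in H; pose proof (pos_INR N).
    rewrite ratio_S, Rabs_mult by lra.
    change (fact (S N)) with (S N * fact N)%nat; rewrite mult_INR; simpl pow.
    replace (b * b ^ N / (INR (S N) * INR (fact N)))
      with (b ^ N / INR (fact N) * (b / INR (S N)))
      by (rewrite S_INR; field; split; [apply INR_fact_neq_0 | lra]).
    apply Rmult_le_compat; try apply Rabs_pos; [apply IH; lra|].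
    assert (1 <= b / (a + INR N)) by (apply Rle_div_r; lra).
    rewrite Rabs_left1 by lra.
    assert (b / (a + INR N) <= b / INR (S N)); [|lra].
    rewrite S_INR; apply Rmult_le_compat_l; [lra|]; apply Rinv_le_contravar; lra.
Qed.

(** As long as [a + N <= b + 1], the product is at most [b^N / N! <= e^b] and the power at most
    [(b + 1)^b]. Beyond that range the factors are nonnegative and the left-hand side does not
    increase. *)
Lemma ratio_bound a b N : 1 <= a -> 0 <= b ->
  Rabs (ratio a b N) * Rpower ((a + INR N) / a) b <= exp b * Rpower (b + 1) b.
Proof.
  intros Ha Hb; induction N as [|N IH].
  - unfold ratio; simpl; rewrite Rplus_0_r; replace (a / a) with 1 by (field; lra).
    replace (1 / 1) with 1 by field; rewrite Rpower_1_l, Rabs_R1, Rmult_1_l.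
    pose proof (exp_ineq1_le b); pose proof (Rpower_ge_1 (b + 1) b ltac:(lra) Hb); nra.
  - pose proof (pos_INR N); destruct (Rle_lt_dec (a + INR (S N)) (b + 1)) as [L|L].
    + apply Rmult_le_compat; [apply Rabs_pos | left; apply Rpower_pos | |].
      * eapply Rle_trans; [apply ratio_small_index; assumption | apply pow_div_fact_le_exp; exact Hb].
      * apply Rle_Rpower_l; [exact Hb|]; rewrite S_INR in *; split; [apply Rdiv_lt_0_compat; lra|].
        apply Rle_trans with ((a + (INR N + 1)) / 1); [|lra].
        apply Rmult_le_compat_l; [lra|]; apply Rinv_le_contravar; lra.
    + rewrite S_INR in L; eapply Rle_trans; [|exact IH].
      destruct (ratio_factor_le (a + INR N) b) as [F0 F1]; [lra|lra|].
      rewrite ratio_S, Rabs_mult by lra.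
      rewrite (Rabs_pos_eq (1 - b / (a + INR N))).
      2: { apply Rmult_le_reg_r with (Rpower ((a + INR N + 1) / (a + INR N)) b);
             [apply Rpower_pos | lra]. }
      replace (Rpower ((a + INR (S N)) / a) b) with
        (Rpower ((a + INR N + 1) / (a + INR N)) b * Rpower ((a + INR N) / a) b).
      * transitivity ((Rabs (ratio a b N) * Rpower ((a + INR N) / a) b)
          * ((1 - b / (a + INR N)) * Rpower ((a + INR N + 1) / (a + INR N)) b));
          [right; ring|].
        rewrite <- (Rmult_1_r (Rabs (ratio a b N) * Rpower _ b)) at 2.
        apply Rmult_le_compat_l; [|exact F1].
        apply Rmult_le_pos; [apply Rabs_pos | left; apply Rpower_pos].
      * rewrite Rpower_mult_distr, S_INR; [f_equal; field; lra| |];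
          apply Rdiv_lt_0_compat; lra.
Qed.

(** * Tail probabilities in the limit *)

(** Dominated convergence for series, with domination required only from some [n] on: all remainders
    beyond [K] are bounded by the remainder of [d], which leaves finitely many terms. *)
Lemma tannery (t : nat -> nat -> R) (s d : nat -> R) :
  eventually (fun n => forall l, Rabs (t n l) <= d l) ->
  ex_series d ->
  (forall l, is_lim_seq (fun n => t n l) (s l)) ->
  ex_series s /\ is_lim_seq (fun n => Series (t n)) (Series s).
Proof.
  intros Hd Sd Ht.
  assert (Hs : forall l, Rabs (s l) <= d l).
  { intros l; apply (is_lim_seq_le_loc (fun n => Rabs (t n l)) (fun _ => d l) (Rabs (s l)) (d l)).
    - destruct Hd as [N HN]; exists N; intros n Hn; apply HN, Hn.
    - apply (is_lim_seq_abs _ (s l)), Ht.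
    - apply is_lim_seq_const. }
  assert (D : forall u, (forall l, Rabs (u l) <= d l) -> ex_series u).
  { intros u Hu; apply (ex_series_le (V := R_CompleteNormedModule)) with (b := d); [exact Hu | exact Sd]. }
  split; [apply D, Hs|].
  assert (Tail : forall u K, (forall l, Rabs (u l) <= d l) ->
            Rabs (Series u - sum_f_R0 u K) <= Series d - sum_f_R0 d K).
  { intros u K Hu.
    rewrite (Series_incr_n u (S K)) by (try lia; apply D, Hu).
    rewrite (Series_incr_n d (S K)) by (try lia; exact Sd); simpl pred.
    replace (sum_f_R0 u K + _ - sum_f_R0 u K) with (Series (fun l => u (S K + l)%nat)) by ring.
    replace (sum_f_R0 d K + _ - sum_f_R0 d K) with (Series (fun l => d (S K + l)%nat)) by ring.
    assert (SK : ex_series (fun l => d (S K + l)%nat)) by (apply ex_series_incr_n; exact Sd).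
    assert (SA : ex_series (fun l => Rabs (u (S K + l)%nat))).
    { apply (ex_series_le (V := R_CompleteNormedModule)) with (b := fun l => d (S K + l)%nat); [|exact SK].
      intros l; unfold norm; simpl; unfold abs; simpl; rewrite Rabs_Rabsolu; apply Hu. }
    eapply Rle_trans; [apply Series_Rabs, SA|].
    apply Series_le; [|exact SK].
    intros l; split; [apply Rabs_pos | apply Hu]. }
  assert (Fin : forall K, is_lim_seq (fun n => sum_f_R0 (t n) K) (sum_f_R0 s K)).
  { intros K; induction K as [|K IH]; simpl; [apply Ht | apply is_lim_seq_plus'; auto]. }
  apply is_lim_seq_Reals; intros eps He.
  assert (LK : is_lim_seq (sum_f_R0 d) (Series d)).
  { apply is_lim_seq_ext with (sum_n d); [intros n; apply sum_n_Reals|].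
    apply Series_correct, Sd. }
  apply is_lim_seq_Reals in LK; destruct (LK (eps / 3)) as [K HK]; [lra|].
  specialize (HK K (le_n K)); unfold R_dist in HK; apply Rabs_def2 in HK.
  specialize (Fin K); apply is_lim_seq_Reals in Fin.
  destruct (Fin (eps / 3)) as [N1 H1]; [lra|]; destruct Hd as [N2 H2].
  exists (max N1 N2); intros n Hn; specialize (H1 n ltac:(lia)); unfold R_dist in *.
  pose proof (Tail (t n) K (H2 n ltac:(lia))) as T1; pose proof (Tail s K Hs) as T2.
  replace (Series (t n) - Series s) with
    ((Series (t n) - sum_f_R0 (t n) K) + (sum_f_R0 (t n) K - sum_f_R0 s K)
     - (Series s - sum_f_R0 s K)) by ring.
  apply Rabs_def2 in H1; apply Rabs_le_between in T1; apply Rabs_le_between in T2.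
  apply Rabs_def1; lra.
Qed.

Lemma Series_finite (f : nat -> R) M :
  (forall l, (M < l)%nat -> f l = 0) -> Series f = sum_f_R0 f M.
Proof.
  intros H; apply is_series_unique.
  apply is_lim_seq_ext_loc with (u := fun _ => sum_f_R0 f M) (l := sum_f_R0 f M);
    [|apply is_lim_seq_const].
  exists M; intros n Hn; rewrite sum_n_Reals.
  replace n with (M + (n - M))%nat by lia; rewrite sum_f_R0_extend; auto.
Qed.

(* Dominates the [l]-th term of the inclusion-exclusion sum for the tail. *)
Definition tail_dom (al Y : R) (l : nat) : R :=
  Y ^ l / INR (fact l) * (exp (al * INR l) * Rpower (al * INR l + 1) (al * INR l)).

Lemma Rpower_mult_INR x b l : 0 < x -> Rpower x (b * INR l) = Rpower x b ^ l.
Proof. intros Hx; rewrite <- Rpower_mult, Rpower_pow; [reflexivity | apply Rpower_pos]. Qed.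

Lemma exp_mult_INR x l : exp (x * INR l) = exp x ^ l.
Proof.
  induction l as [|l IH]; [simpl; rewrite Rmult_0_r; apply exp_0|].
  rewrite S_INR, Rmult_plus_distr_l, exp_plus, IH, Rmult_1_r; simpl; ring.
Qed.

Lemma tail_dom_pos al Y l : 0 <= Y -> 0 <= tail_dom al Y l.
Proof.
  intros HY; unfold tail_dom; apply Rmult_le_pos.
  - apply Rdiv_le_0_compat; [apply pow_le, HY | apply INR_fact_lt_0].
  - apply Rmult_le_pos; left; [apply exp_pos | apply Rpower_pos].
Qed.

(** [(l+1)^l / l! <= e^(l+1)] trades the factorial for [(l+1)^l], of which the power
    [(al l + 1)^(al l) <= (l+1)^(al l)] uses up only a part. The base of the remaining [l]-th power
    tends to 0. *)
Lemma tail_dom_le_pow al Y l : 0 < al < 1 -> 0 <= Y ->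
  tail_dom al Y l
  <= exp 1 * (Y * exp (1 + al) * Rpower (INR l + 1) (al - 1)) ^ l.
Proof.
  intros Hal HY; unfold tail_dom; pose proof (pos_INR l) as Hl.
  assert (F : / INR (fact l) <= exp 1 * exp 1 ^ l * / (INR l + 1) ^ l).
  { pose proof (pow_div_fact_le_exp (INR l + 1) l ltac:(lra)) as E.
    rewrite exp_plus, Rmult_comm in E.
    replace (exp (INR l)) with (exp 1 ^ l) in E by (rewrite <- exp_mult_INR; f_equal; ring).
    assert (P : 0 < (INR l + 1) ^ l) by (apply pow_lt; lra).
    apply Rmult_le_reg_l with ((INR l + 1) ^ l); [exact P|].
    replace ((INR l + 1) ^ l * (exp 1 * exp 1 ^ l * / (INR l + 1) ^ l))
      with (exp 1 * exp 1 ^ l) by (field; lra).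
    unfold Rdiv in E; lra. }
  assert (G : Rpower (al * INR l + 1) (al * INR l) <= Rpower (INR l + 1) al ^ l).
  { rewrite <- Rpower_mult_INR by lra; apply Rle_Rpower_l; [|split]; nra. }
  rewrite exp_mult_INR, !Rpow_mult_distr, exp_plus, Rpow_mult_distr.
  replace (Rpower (INR l + 1) (al - 1) ^ l) with (Rpower (INR l + 1) al ^ l * / (INR l + 1) ^ l).
  2: { unfold Rminus; rewrite Rpower_plus, Rpow_mult_distr, Rpower_Ropp, Rpower_1 by lra.
       rewrite pow_inv; reflexivity. }
  transitivity ((Y ^ l * (exp 1 * exp 1 ^ l * / (INR l + 1) ^ l))
                * (exp al ^ l * Rpower (INR l + 1) al ^ l)); [|right; ring].
  pose proof (pow_le Y l HY); pose proof (pow_lt _ l (exp_pos al)).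
  apply Rmult_le_compat.
  - apply Rdiv_le_0_compat; [assumption | apply INR_fact_lt_0].
  - apply Rmult_le_pos; [lra | left; apply Rpower_pos].
  - apply Rmult_le_compat_l; assumption.
  - apply Rmult_le_compat_l; [lra | assumption].
Qed.

Lemma ex_series_tail_dom al Y : 0 < al < 1 -> 0 <= Y -> ex_series (tail_dom al Y).
Proof.
  (* Once [(l+1)^(1-al) >= c], the base is at most [1/2] and a geometric series dominates; the [+ 1]
     keeps [c] positive when [Y = 0]. *)
  intros Hal HY; set (c := 2 * (Y * exp (1 + al)) + 1).
  assert (Hc : 1 <= c) by (unfold c; pose proof (exp_pos (1 + al)); nra).
  destruct (nfloor_ex (Rpower c (/ (1 - al)))) as [L HL]; [left; apply Rpower_pos|].
  assert (Small : forall l, (L <= l)%nat -> Y * exp (1 + al) * Rpower (INR l + 1) (al - 1) <= / 2).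
  { intros l Hl; apply le_INR in Hl; pose proof (pos_INR l).
    assert (E : c <= Rpower (INR l + 1) (1 - al)).
    { replace c with (Rpower (Rpower c (/ (1 - al))) (1 - al)).
      - apply Rle_Rpower_l; [lra|]; split; [apply Rpower_pos | lra].
      - rewrite Rpower_mult, Rinv_l, Rpower_1; lra. }
    replace (al - 1) with (- (1 - al)) by ring; rewrite Rpower_Ropp.
    apply Rmult_le_reg_r with (2 * Rpower (INR l + 1) (1 - al)); [pose proof (Rpower_pos (INR l + 1) (1 - al)); lra|].
    field_simplify; [unfold c in E; lra | pose proof (Rpower_pos (INR l + 1) (1 - al)); lra]. }
  apply (ex_series_incr_n _ L).
  apply (ex_series_le (V := R_CompleteNormedModule)) with (b := fun l => exp 1 * (/ 2) ^ l).
  - intros l; unfold norm; simpl; unfold abs; simpl.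
    rewrite Rabs_pos_eq by (apply tail_dom_pos, HY).
    eapply Rle_trans; [apply tail_dom_le_pow; assumption|].
    apply Rmult_le_compat_l; [left; apply exp_pos|].
    apply Rle_trans with ((/ 2) ^ (L + l)).
    + apply pow_incr; split; [|apply Small; lia].
      apply Rmult_le_pos; [|left; apply Rpower_pos].
      apply Rmult_le_pos; [exact HY | left; apply exp_pos].
    + rewrite pow_add; apply Rle_trans with (1 * (/ 2) ^ l); [|right; apply Rmult_1_l].
      apply Rmult_le_compat_r; [apply pow_le; lra|].
      rewrite <- (pow1 L); apply pow_incr; lra.
  - apply (ex_series_scal (V := R_NormedModule)).
    apply ex_series_geom; rewrite Rabs_pos_eq; lra.
Qed.

Lemma falling_nat_bounds M l : 0 <= falling (INR M) l <= INR M ^ l.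
Proof.
  pose proof (pos_INR M) as HM; induction l as [|l IH]; [simpl; lra|].
  destruct (le_lt_dec l M) as [H|H].
  - simpl; apply le_INR in H; pose proof (pos_INR l); split.
    + apply Rmult_le_pos; lra.
    + rewrite Rmult_comm; apply Rmult_le_compat; lra.
  - rewrite falling_nat_0 by lia; split; [lra | apply pow_le, HM].
Qed.

Lemma falling_scaled_cv (M : nat -> nat) (th : nat -> R) (y : R) l :
  is_lim_seq th 0 -> is_lim_seq (fun n => INR (M n) * th n) y ->
  is_lim_seq (fun n => falling (INR (M n)) l * th n ^ l) (y ^ l).
Proof.
  intros H0 Hy; induction l as [|l IH]; simpl.
  - apply is_lim_seq_ext with (fun _ => 1); [intros; ring | apply is_lim_seq_const].
  - apply is_lim_seq_ext with
      (fun n => (falling (INR (M n)) l * th n ^ l) * (INR (M n) * th n - INR l * th n));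
      [intros; ring|].
    apply is_lim_seq_eq_lim with (y ^ l * (y - INR l * 0)); [|ring].
    apply is_lim_seq_mult'; [exact IH|].
    apply is_lim_seq_minus'; [exact Hy|].
    apply is_lim_seq_mult'; [apply is_lim_seq_const | exact H0].
Qed.

(** Common core of the regimes in which the degree is rescaled. Multiplying and dividing the [l]-th
    term by [th^l] pairs [falling M l] with [th^l], giving [y^l], and the product with its
    normalizing power, giving [rho l]. *)
Lemma tail_cv k (jn Nn Mn : nat -> nat) (y : R) (rho : nat -> R) :
  (1 <= k)%nat -> eventually (fun n => (1 <= jn n)%nat) -> 0 <= y ->
  let a n := INR (jn n) + 1 - alpha k in
  let th n := Rpower (a n / (a n + INR (Nn n))) (alpha k) in
  is_lim_seq th 0 ->
  is_lim_seq (fun n => INR (Mn n) * th n) y ->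
  (forall l, is_lim_seq (fun n => ratio (a n) (alpha k * INR l) (Nn n)
       * Rpower ((a n + INR (Nn n)) / a n) (alpha k * INR l)) (rho l)) ->
  ex_series (fun l => (-1) ^ l * (y ^ l / INR (fact l)) * rho l) /\
  is_lim_seq (fun n => tail_sum k (jn n) (Nn n) (Mn n))
             (Series (fun l => (-1) ^ l * (y ^ l / INR (fact l)) * rho l)).
Proof.
  intros Hk Hj Hy a th H0 HM Hr; pose proof (alpha_bounds k Hk) as Hal.
  assert (Ha : eventually (fun n => 1 <= a n)).
  { destruct Hj as [n0 Hj]; exists n0; intros n Hn; specialize (Hj n Hn).
    apply le_INR in Hj; simpl in Hj; unfold a; lra. }
  assert (Hth : forall n, 1 <= a n -> forall l,
    Rpower ((a n + INR (Nn n)) / a n) (alpha k * INR l) * th n ^ l = 1).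
  { intros n Hn l; pose proof (pos_INR (Nn n)); unfold th.
    rewrite <- Rpower_mult_INR, Rpower_mult_distr by (apply Rdiv_lt_0_compat; lra).
    replace (_ / _ * _) with 1 by (field; lra); apply Rpower_1_l. }
  set (t n l := (-1) ^ l * (falling (INR (Mn n)) l * th n ^ l / INR (fact l))
                * (ratio (a n) (alpha k * INR l) (Nn n)
                   * Rpower ((a n + INR (Nn n)) / a n) (alpha k * INR l))).
  assert (Et : eventually (fun n => Series (t n) = tail_sum k (jn n) (Nn n) (Mn n))).
  { destruct Ha as [n0 Ha]; exists n0; intros n Hn; specialize (Ha n Hn).
    rewrite (Series_finite _ (Mn n)).
    - apply sum_eq; intros l _; unfold t, Rbinom; fold (a n).
      pose proof (Hth n Ha l) as E.
      set (P := Rpower _ _) in *; set (r := ratio _ _ _).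
      transitivity ((-1) ^ l * (falling (INR (Mn n)) l / INR (fact l)) * r * (P * th n ^ l));
        [field; apply INR_fact_neq_0 | rewrite E; ring].
    - intros l Hl; unfold t; rewrite falling_nat_0 by exact Hl.
      unfold Rdiv; ring. }
  (* [INR (Mn n) * th n] tends to [y], so it is eventually below [y + 1], which makes the majorant
     independent of [n]. *)
  destruct (tannery t (fun l => (-1) ^ l * (y ^ l / INR (fact l)) * rho l)
              (tail_dom (alpha k) (y + 1))) as [S1 S2].
  - assert (HM1 : eventually (fun n => INR (Mn n) * th n < y + 1)).
    { apply is_lim_seq_Reals in HM; destruct (HM 1 Rlt_0_1) as [n1 H1]; exists n1.
      intros n Hn; specialize (H1 n Hn); unfold R_dist in H1; apply Rabs_def2 in H1; lra. }
    destruct Ha as [n0 Ha]; destruct HM1 as [n1 H1]; exists (max n0 n1).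
    intros n Hn l; specialize (Ha n ltac:(lia)); specialize (H1 n ltac:(lia)).
    unfold t, tail_dom; rewrite !Rabs_mult, pow_1_abs, Rmult_1_l.
    apply Rmult_le_compat; try (apply Rmult_le_pos; apply Rabs_pos); try apply Rabs_pos.
    + pose proof (falling_nat_bounds (Mn n) l); pose proof (Rpower_pos (a n / (a n + INR (Nn n))) (alpha k)) as Pth.
      fold (th n) in Pth; pose proof (pow_lt _ l Pth); pose proof (INR_fact_lt_0 l).
      rewrite Rabs_pos_eq by (apply Rdiv_le_0_compat; [apply Rmult_le_pos; lra | lra]).
      apply Rmult_le_compat_r; [left; apply Rinv_0_lt_compat; lra|].
      apply Rle_trans with ((INR (Mn n) * th n) ^ l).
      * rewrite Rpow_mult_distr; apply Rmult_le_compat_r; lra.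
      * apply pow_incr; split; [|lra]; apply Rmult_le_pos; [apply pos_INR | lra].
    + rewrite (Rabs_pos_eq (Rpower _ _)) by (left; apply Rpower_pos).
      apply ratio_bound; [exact Ha|]; apply Rmult_le_pos; [lra | apply pos_INR].
  - apply ex_series_tail_dom; lra.
  - intros l; unfold t; apply is_lim_seq_mult'; [|apply Hr].
    apply is_lim_seq_mult'; [apply is_lim_seq_const|].
    apply is_lim_seq_mult'; [|apply is_lim_seq_const].
    apply falling_scaled_cv; assumption.
  - split; [exact S1|]; eapply is_lim_seq_ext_loc; [exact Et | exact S2].
Qed.

(** [up r] is the least integer strictly above [r], so [c Y <= x] fails exactly when
    [Y >= up (x / c)]. *)
Lemma cdf_Y_tail k n j c x : (1 <= k)%nat -> (1 <= j <= n)%nat -> 0 < c -> 0 <= x ->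
  cdf_Y k n j c x = 1 - tail_sum k j (n - j) (Z.to_nat (up (x / c))).
Proof.
  intros Hk Hj Hc Hx; rewrite cdf_Y_expect, <- expect_tail by lia.
  replace (j + (n - j))%nat with n by lia.
  transitivity (expect k n j (fun d => 1 * 1 + (-1) * indic (Nat.leb (Z.to_nat (up (x / c))) d)));
    [|rewrite expect_lin, expect_const; ring].
  apply expect_ext; intros d.
  assert (Hxc : 0 <= x / c) by (apply Rdiv_le_0_compat; lra).
  destruct (archimed (x / c)) as [A1 A2].
  assert (U : (0 < up (x / c))%Z) by (apply lt_IZR; lra).
  destruct (Nat.leb_spec (Z.to_nat (up (x / c))) d) as [L|L];
    destruct (Rle_dec (c * INR d) x) as [E|E]; unfold indic; try ring; exfalso.
  - assert (Hd : INR d <= x / c) by (apply Rle_div_r; lra).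
    assert (L' : (up (x / c) <= Z.of_nat d)%Z) by lia.
    apply IZR_le in L'; rewrite <- INR_IZR_INZ in L'; lra.
  - apply E; rewrite Rmult_comm; apply Rle_div_r; [exact Hc|].
    assert (L' : (Z.of_nat d <= up (x / c) - 1)%Z) by lia.
    apply IZR_le in L'; rewrite <- INR_IZR_INZ, minus_IZR in L'; lra.
Qed.

Lemma cdf_Y_neg k n j c x : 0 <= c -> x < 0 -> cdf_Y k n j c x = 0.
Proof.
  intros Hc Hx; rewrite cdf_Y_expect.
  transitivity (expect k n j (fun _ => 0)); [|apply expect_const].
  apply expect_ext; intros d; destruct (Rle_dec (c * INR d) x) as [E|E]; [|reflexivity].
  pose proof (Rmult_le_pos c (INR d) Hc (pos_INR d)); lra.
Qed.

Lemma ceil_scaled_cv (c : nat -> R) (x : R) :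
  (forall n, 0 < c n) -> 0 <= x -> is_lim_seq c 0 ->
  is_lim_seq (fun n => INR (Z.to_nat (up (x / c n))) * c n) x.
Proof.
  intros Hc Hx H0.
  apply is_lim_seq_le_le with (u := fun _ => x) (w := fun n => x + c n).
  - intros n; specialize (Hc n); destruct (archimed (x / c n)) as [A1 A2].
    assert (Hxc : 0 <= x / c n) by (apply Rdiv_le_0_compat; lra).
    rewrite INR_IZR_INZ, Z2Nat.id by (apply le_IZR; lra); split.
    + apply Rle_div_l; lra.
    + replace (x + c n) with ((x / c n + 1) * c n) by (field; lra).
      apply Rmult_le_compat_r; lra.
  - apply is_lim_seq_const.
  - apply is_lim_seq_eq_lim with (x + 0); [|ring].
    apply is_lim_seq_plus'; [apply is_lim_seq_const | exact H0].
Qed.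

Lemma ratio_near_1_cv (a : nat -> R) (Nn : nat -> nat) b :
  0 <= b -> is_lim_seq a p_infty ->
  is_lim_seq (fun n => ratio (a n) b (Nn n) * Rpower ((a n + INR (Nn n)) / a n) b) 1.
Proof.
  intros Hb Ha.
  apply is_lim_seq_le_le_loc with
    (u := fun n => Rpower (1 - (b + 1) / a n) b) (w := fun _ => 1).
  - destruct (proj2 (is_lim_seq_spec _ p_infty) Ha (b + 1)) as [n0 H0].
    exists n0; intros n Hn; apply ratio_near_1; auto.
  - apply is_lim_seq_eq_lim with (Rpower 1 b); [|apply Rpower_1_l].
    apply is_lim_seq_Rpower; [lra|].
    apply is_lim_seq_eq_lim with (1 - (b + 1) * 0); [|ring].
    apply is_lim_seq_minus'; [apply is_lim_seq_const|].
    apply is_lim_seq_mult'; [apply is_lim_seq_const|].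
    change (Finite 0) with (Rbar_inv p_infty); apply is_lim_seq_inv; [exact Ha | discriminate].
  - apply is_lim_seq_const.
Qed.

Lemma ratio_rho_cv (a : nat -> R) (Nn : nat -> nat) (b rho : R) :
  0 <= b -> is_lim_seq a p_infty -> 0 < rho ->
  is_lim_seq (fun n => a n / (a n + INR (Nn n))) rho ->
  is_lim_seq (fun n => ratio (a n) b (Nn n)) (Rpower rho b).
Proof.
  intros Hb Ha Hrho Hr.
  apply is_lim_seq_ext_loc with (fun n =>
    (ratio (a n) b (Nn n) * Rpower ((a n + INR (Nn n)) / a n) b)
    * Rpower (a n / (a n + INR (Nn n))) b).
  - destruct (proj2 (is_lim_seq_spec _ p_infty) Ha 0) as [n0 H0].
    exists n0; intros n Hn; specialize (H0 n Hn); pose proof (pos_INR (Nn n)).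
    rewrite Rmult_assoc, Rpower_mult_distr by (apply Rdiv_lt_0_compat; lra).
    replace (_ / _ * _) with 1 by (field; lra); rewrite Rpower_1_l; ring.
  - apply is_lim_seq_eq_lim with (1 * Rpower rho b); [|ring].
    apply is_lim_seq_mult'; [apply ratio_near_1_cv; assumption|].
    apply is_lim_seq_Rpower; assumption.
Qed.

(** * Growing node index *)

Lemma is_lim_seq_inv_INR (c : R) : is_lim_seq (fun n => / (INR n + c)) 0.
Proof.
  change (Finite 0) with (Rbar_inv p_infty); apply is_lim_seq_inv; [|discriminate].
  apply is_lim_seq_plus with (l1 := p_infty) (l2 := c);
    [apply is_lim_seq_INR | apply is_lim_seq_const | reflexivity].
Qed.

Lemma eventually_INR_pos : eventually (fun n => 0 < INR n).
Proof. exists 1%nat; intros n Hn; apply lt_0_INR; lia. Qed.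

Lemma shifted_quotient_cv (jn : nat -> nat) (c rho : R) : 0 < c ->
  is_lim_seq (fun n => INR (jn n) / INR n) rho ->
  is_lim_seq (fun n => (INR (jn n) + c) / (INR n + c)) rho.
Proof.
  intros Hc H.
  apply is_lim_seq_ext_loc with
    (fun n => INR (jn n) / INR n * ((0 + INR n) / (c + INR n)) + c * / (INR n + c)).
  - destruct eventually_INR_pos as [n0 H0]; exists n0; intros n Hn; specialize (H0 n Hn).
    field; lra.
  - apply is_lim_seq_eq_lim with (rho * 1 + c * 0); [|ring].
    apply is_lim_seq_plus'; apply is_lim_seq_mult'; try assumption.
    + apply is_lim_seq_shift_quotient.
    + apply is_lim_seq_const.
    + apply is_lim_seq_inv_INR.
Qed.

Section ParamSequence.

Variables (k : nat) (jn : nat -> nat).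
Hypothesis Hk : (1 <= k)%nat.
Hypothesis Hjn : eventually (fun n => (1 <= jn n <= n)%nat).

Let a n := INR (jn n) + 1 - alpha k.

Lemma index_sum : eventually (fun n => a n + INR (n - jn n) = INR n + (1 - alpha k)).
Proof.
  destruct Hjn as [n0 H0]; exists n0; intros n Hn; specialize (H0 n Hn).
  rewrite minus_INR by lia; unfold a; ring.
Qed.

Lemma index_quotient_cv (rho : R) :
  is_lim_seq (fun n => INR (jn n) / INR n) rho ->
  is_lim_seq (fun n => a n / (a n + INR (n - jn n))) rho.
Proof.
  intros H; pose proof (alpha_bounds k Hk) as Hal.
  eapply is_lim_seq_ext_loc; [|apply (shifted_quotient_cv jn (1 - alpha k) rho); [lra | exact H]].
  destruct index_sum as [n0 H0]; exists n0; intros n Hn; rewrite (H0 n Hn).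
  unfold a; f_equal; ring.
Qed.

Lemma index_infty : cv_infty (fun n => INR (jn n)) -> is_lim_seq a p_infty.
Proof.
  intros H; apply is_lim_seq_spec; intros M; destruct (H M) as [n0 H0].
  exists n0; intros n Hn; specialize (H0 n Hn).
  pose proof (alpha_bounds k Hk); unfold a; lra.
Qed.

Lemma prob_Y_0 n j : (1 <= j <= n)%nat ->
  prob_Y k n j 0 = ratio (INR j + 1 - alpha k) (alpha k) (n - j).
Proof.
  intros Hj; rewrite prob_Y_expect; replace n with (j + (n - j))%nat at 1 by lia.
  rewrite expect_eq_tail by lia; simpl; unfold C; simpl.
  replace (alpha k * (1 + 0)) with (alpha k) by ring; field.
Qed.

Lemma prob_zero_cv :
  cv_infty (fun n => INR (jn n)) ->
  Un_cv (fun n => INR (n - jn n) / INR n) 0 ->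
  Un_cv (fun n => prob_Y k n (jn n) 0) 1.
Proof.
  intros Hinf H; apply is_lim_seq_Reals in H; apply is_lim_seq_Reals.
  pose proof (alpha_bounds k Hk) as Hal.
  assert (Q : is_lim_seq (fun n => INR (jn n) / INR n) 1).
  { apply is_lim_seq_ext_loc with (fun n => 1 - INR (n - jn n) / INR n).
    - destruct eventually_INR_pos as [n0 H0]; destruct Hjn as [n1 H1].
      exists (max n0 n1); intros n Hn; specialize (H0 n ltac:(lia)); specialize (H1 n ltac:(lia)).
      rewrite minus_INR by lia; field; lra.
    - apply is_lim_seq_eq_lim with (1 - 0); [|ring].
      apply is_lim_seq_minus'; [apply is_lim_seq_const | exact H]. }
  apply is_lim_seq_ext_loc with (fun n => ratio (a n) (alpha k) (n - jn n)).
  - destruct Hjn as [n0 H0]; exists n0; intros n Hn; rewrite prob_Y_0; auto.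
  - apply is_lim_seq_eq_lim with (Rpower 1 (alpha k)); [|apply Rpower_1_l].
    apply ratio_rho_cv; [lra | apply index_infty, Hinf | lra | apply index_quotient_cv, Q].
Qed.

Lemma geometric_sum (q : R) m :
  sum_f_R0 (fun i => (1 - q) * q ^ i) m = 1 - q ^ (S m).
Proof. induction m as [|m IH]; [simpl; ring|]; rewrite tech5, IH; simpl; ring. Qed.

(** There is no rescaling, so [M] is fixed and the tail is a finite sum with limit
    [sum_l binom M l (- p)^l = (1 - p)^M]. *)
Lemma geometric_limit rho : 0 < rho < 1 ->
  cv_infty (fun n => INR (jn n)) ->
  Un_cv (fun n => INR (jn n) / INR n) rho ->
  conv_dist (fun n => cdf_Y k n (jn n) 1)
    (nat_cdf (fun m => Rpower rho (alpha k) * (1 - Rpower rho (alpha k)) ^ m)).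
Proof.
  intros Hrho Hinf H x _; apply is_lim_seq_Reals in H; apply is_lim_seq_Reals.
  pose proof (alpha_bounds k Hk) as Hal; unfold nat_cdf.
  set (p := Rpower rho (alpha k)); destruct (Rle_dec 0 x) as [Hx|Hx].
  2: { apply is_lim_seq_ext with (fun _ => 0); [|apply is_lim_seq_const].
       intros n; symmetry; apply cdf_Y_neg; lra. }
  set (M := Z.to_nat (up (x / 1))).
  (* [nat_cdf] sums up to the integer part of [x], whereas the complementary tail starts one above
     it. *)
  assert (EM : S (Z.to_nat (up x - 1)) = M).
  { unfold M; rewrite Rdiv_1_r; destruct (archimed x) as [A1 A2].
    assert (0 < up x)%Z by (apply lt_IZR; lra); lia. }
  apply is_lim_seq_ext_loc with (fun n => 1 - tail_sum k (jn n) (n - jn n) M).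
  { destruct Hjn as [n0 H0]; exists n0; intros n Hn; symmetry; apply cdf_Y_tail; auto; lra. }
  apply is_lim_seq_eq_lim with (1 - sum_f_R0 (fun l => C M l * (- p) ^ l * 1 ^ (M - l)) M).
  - apply is_lim_seq_minus'; [apply is_lim_seq_const|]; unfold tail_sum.
    (* The summation bound is detached from the [M] inside the binomials, so that the induction
       leaves the terms unchanged. *)
    assert (F : forall K, (K <= M)%nat -> is_lim_seq (fun n => sum_f_R0 (fun l =>
        (-1) ^ l * Rbinom (INR M) l
        * ratio (INR (jn n) + 1 - alpha k) (alpha k * INR l) (n - jn n)) K)
      (sum_f_R0 (fun l => C M l * (- p) ^ l * 1 ^ (M - l)) K)).
    { assert (T : forall l, (l <= M)%nat -> is_lim_seq (fun n =>
        (-1) ^ l * Rbinom (INR M) l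
        * ratio (INR (jn n) + 1 - alpha k) (alpha k * INR l) (n - jn n))
        (C M l * (- p) ^ l * 1 ^ (M - l))).
      { intros l Hl; apply is_lim_seq_eq_lim with ((-1) ^ l * Rbinom (INR M) l * Rpower rho (alpha k * INR l)).
        - apply is_lim_seq_mult'; [apply is_lim_seq_const|].
          apply (ratio_rho_cv a (fun n => (n - jn n)%nat));
            [apply Rmult_le_pos; [lra | apply pos_INR] | apply index_infty, Hinf | lra
            | apply index_quotient_cv, H].
        - rewrite Rpower_mult_INR, Rbinom_C, pow1 by (lra || exact Hl); fold p.
          replace (- p) with (-1 * p) by ring; rewrite Rpow_mult_distr; ring. }
      intros K; induction K as [|K IH]; intros HK; simpl sum_f_R0; [apply T; lia|].
      apply is_lim_seq_plus'; [apply IH | apply T]; lia. }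
    apply F; lia.
  - rewrite <- binomial; replace (- p + 1) with (1 - p) by ring.
    rewrite <- EM, <- geometric_sum; apply sum_eq; intros i _; f_equal; ring.
Qed.

(** Since [j] tends to infinity all normalized products tend to 1, and the limiting tail is the
    exponential series at [- x]. *)
Lemma exponential_limit :
  cv_infty (fun n => INR (jn n)) ->
  Un_cv (fun n => INR (jn n) / INR n) 0 ->
  conv_dist (fun n => cdf_Y k n (jn n) (Rpower (INR (jn n) / INR n) (alpha k))) exp1_cdf.
Proof.
  intros Hinf H x _; apply is_lim_seq_Reals in H; apply is_lim_seq_Reals.
  pose proof (alpha_bounds k Hk) as Hal; unfold exp1_cdf.
  set (c := fun n => Rpower (INR (jn n) / INR n) (alpha k)).
  assert (Hc : forall n, 0 < c n) by (intros n; apply Rpower_pos).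
  destruct (Rle_dec 0 x) as [Hx|Hx].
  2: { apply is_lim_seq_ext with (fun _ => 0); [|apply is_lim_seq_const].
       intros n; symmetry; apply cdf_Y_neg; [left; apply Hc | lra]. }
  (* Continuity of the power at a positive point does not cover the limit 0; the threshold
     [eps^(1/alpha)] replaces it. *)
  assert (Root : forall u : nat -> R, eventually (fun n => 0 < u n) -> is_lim_seq u 0 ->
            is_lim_seq (fun n => Rpower (u n) (alpha k)) 0).
  { intros u [n1 Hu] Hu0; apply is_lim_seq_Reals in Hu0; apply is_lim_seq_Reals.
    intros eps He; destruct (Hu0 (Rpower eps (/ alpha k)) (Rpower_pos _ _)) as [n0 H0].
    exists (max n0 n1); intros n Hn; specialize (H0 n ltac:(lia)); specialize (Hu n ltac:(lia)).
    unfold R_dist in *; rewrite Rminus_0_r in *; rewrite Rabs_pos_eq in * by (left; assumption || apply Rpower_pos).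
    replace eps with (Rpower (Rpower eps (/ alpha k)) (alpha k)).
    - apply Rlt_Rpower_l; lra.
    - rewrite Rpower_mult, Rinv_l, Rpower_1; lra. }
  assert (Jpos : eventually (fun n => 0 < INR (jn n) /\ 0 < INR n)).
  { destruct Hjn as [n0 H0]; exists n0; intros n Hn; specialize (H0 n Hn).
    split; apply lt_0_INR; lia. }
  assert (C0 : is_lim_seq c 0).
  { apply Root; [|exact H]; destruct Jpos as [n0 H0]; exists n0; intros n Hn.
    destruct (H0 n Hn); apply Rdiv_lt_0_compat; assumption. }
  set (Mn := fun n => Z.to_nat (up (x / c n))).
  assert (Hsum := index_sum).
  (* The scaling [(j/n)^alpha] is asymptotically equal to the quantity [th] of [tail_cv], which
     carries the shifts by [1 - alpha]. *)
  assert (TH : is_lim_seq (fun n => Rpower (a n / (a n + INR (n - jn n))) (alpha k) / c n) 1).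
  { apply is_lim_seq_ext_loc with (fun n =>
      Rpower ((1 + (1 - alpha k) * / INR (jn n)) * ((0 + INR n) / (1 - alpha k + INR n))) (alpha k)).
    - destruct Hsum as [n0 H0]; destruct Jpos as [n1 H1]; exists (max n0 n1); intros n Hn.
      specialize (H1 n ltac:(lia)); unfold c; rewrite (H0 n) by lia; unfold a.
      rewrite <- Rpower_div by (apply Rdiv_lt_0_compat; lra).
      f_equal; field; lra.
    - apply is_lim_seq_eq_lim with (Rpower 1 (alpha k)); [|apply Rpower_1_l].
      apply is_lim_seq_Rpower; [lra|].
      apply is_lim_seq_eq_lim with ((1 + (1 - alpha k) * 0) * 1); [|ring].
      apply is_lim_seq_mult'; [|apply is_lim_seq_shift_quotient].
      apply is_lim_seq_plus'; [apply is_lim_seq_const|].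
      apply is_lim_seq_mult'; [apply is_lim_seq_const|].
      change (Finite 0) with (Rbar_inv p_infty); apply is_lim_seq_inv; [|discriminate].
      apply is_lim_seq_spec; exact Hinf. }
  destruct (tail_cv k jn (fun n => (n - jn n)%nat) Mn x (fun _ => 1)) as [_ T]; auto.
  - destruct Hjn as [n0 H0]; exists n0; intros n Hn; apply H0, Hn.
  - change (is_lim_seq (fun n => Rpower (a n / (a n + INR (n - jn n))) (alpha k)) 0).
    apply Root.
    + destruct Hsum as [n0 H0]; destruct Jpos as [n1 H1]; exists (max n0 n1); intros n Hn.
      specialize (H1 n ltac:(lia)); rewrite (H0 n) by lia; unfold a.
      apply Rdiv_lt_0_compat; lra.
    + apply index_quotient_cv, H.
  - change (is_lim_seq (fun n => INR (Mn n) * Rpower (a n / (a n + INR (n - jn n))) (alpha k)) x).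
    apply is_lim_seq_ext with (fun n => INR (Mn n) * c n
       * (Rpower (a n / (a n + INR (n - jn n))) (alpha k) / c n)).
    + intros n; specialize (Hc n); field; lra.
    + apply is_lim_seq_eq_lim with (x * 1); [|ring].
      apply is_lim_seq_mult'; [|exact TH]; apply ceil_scaled_cv; assumption.
  - intros l; apply ratio_near_1_cv; [apply Rmult_le_pos; [lra | apply pos_INR]|].
    apply index_infty, Hinf.
  - apply is_lim_seq_ext_loc with (fun n => 1 - tail_sum k (jn n) (n - jn n) (Mn n)).
    + destruct Hjn as [n0 H0]; exists n0; intros n Hn; symmetry.
      apply cdf_Y_tail; auto; apply Hc.
    + apply is_lim_seq_minus'; [apply is_lim_seq_const|].
      apply is_lim_seq_eq_lim with (1 := T).
      pose proof (is_exp_Reals (- x)) as E; apply is_pseries_unique in E.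
      rewrite <- E; apply Series_ext; intros l.
      replace (- x) with (-1 * x) by ring; rewrite Rpow_mult_distr; unfold Rdiv; ring.
Qed.

End ParamSequence.

(** * The Gamma function and the limit law for a fixed node *)

(** [N!] is [rising 1 N] with [1 = (x + 1) - x], so Euler's sequence is a normalized product and
    converges by [ratio_cv]. *)
Lemma gamma_seq_ratio x N : 0 < x ->
  gamma_seq x N = Rpower (INR N) x / x * ratio (x + 1) x N.
Proof.
  intros Hx; unfold gamma_seq, ratio; rewrite rising_shift, <- falling_fact, falling_rising.
  replace (INR N - INR N + 1) with (x + 1 - x) by ring.
  pose proof (rising_pos (x + 1) N ltac:(lra)); field; lra.
Qed.

Lemma Rpower_shift_quotient_cv (c d b : R) : 0 < c -> 0 < d ->
  is_lim_seq (fun n => Rpower (c + INR n) b / Rpower (d + INR n) b) 1.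
Proof.
  intros Hc Hd; apply is_lim_seq_ext with (fun n => Rpower ((c + INR n) / (d + INR n)) b).
  - intros n; pose proof (pos_INR n); apply Rpower_div; lra.
  - apply is_lim_seq_eq_lim with (Rpower 1 b); [|apply Rpower_1_l].
    apply is_lim_seq_Rpower; [lra | apply is_lim_seq_shift_quotient].
Qed.

Lemma Rpower_INR_quotient_cv (d b : R) : 0 < d ->
  is_lim_seq (fun n => Rpower (INR n) b / Rpower (d + INR n) b) 1.
Proof.
  intros Hd; apply is_lim_seq_incr_1.
  apply is_lim_seq_ext with (fun n => Rpower (1 + INR n) b / Rpower (d + 1 + INR n) b).
  - intros n; rewrite S_INR; f_equal; f_equal; ring.
  - apply Rpower_shift_quotient_cv; lra.
Qed.

(** [Gamma] is a choice operator; existence of the limit is what gives it its value. Positivity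
    comes from [ratio_cv] with [b = x < x + 1 = a]. *)
Lemma Gamma_cv x : 0 < x -> is_lim_seq (gamma_seq x) (Gamma x) /\ 0 < Gamma x.
Proof.
  intros Hx; destruct (ratio_cv (x + 1) x) as [r [Hr L]]; [lra|lra|].
  assert (G : is_lim_seq (gamma_seq x) (r / x)).
  { apply is_lim_seq_ext with (fun N => (Rpower (INR N) x / Rpower (x + 1 + INR N) x)
        * (ratio (x + 1) x N * Rpower (x + 1 + INR N) x) * / x).
    - intros N; rewrite gamma_seq_ratio by exact Hx.
      pose proof (Rpower_pos (x + 1 + INR N) x); field; lra.
    - apply is_lim_seq_eq_lim with (1 * r * / x); [|field; lra].
      apply is_lim_seq_mult'; [|apply is_lim_seq_const].
      apply is_lim_seq_mult'; [apply Rpower_INR_quotient_cv; lra | exact L]. }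
  assert (E : Un_cv (gamma_seq x) (Gamma x)).
  { unfold Gamma; apply epsilon_spec; exists (r / x); apply is_lim_seq_Reals, G. }
  apply is_lim_seq_Reals in E; split; [exact E|].
  apply is_lim_seq_unique in E; apply is_lim_seq_unique in G; rewrite E in G.
  injection G as ->; apply Rdiv_lt_0_compat; [apply Hr|]; lra.
Qed.

Lemma Gamma_pos x : 0 < x -> 0 < Gamma x.
Proof. apply Gamma_cv. Qed.

(** A quotient of two Euler sequences, in which the factorials cancel. The sequence at [N] has
    [N + 1] rising factors, hence the shift of the index. *)
Lemma rising_quotient_cv a b : 0 < a -> 0 <= b ->
  is_lim_seq (fun N => rising (a + b) N / rising a N * Rpower (a + INR N) (- b))
             (Gamma a / Gamma (a + b)).
Proof.
  intros Ha Hb; pose proof (Gamma_pos (a + b) ltac:(lra)) as Hg; apply is_lim_seq_incr_1.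
  apply is_lim_seq_ext_loc with (fun N => gamma_seq a N / gamma_seq (a + b) N
      * (Rpower (INR N) b / Rpower (a + 1 + INR N) b)).
  - exists 1%nat; intros N HN; apply lt_0_INR in HN; rewrite S_INR, Rpower_Ropp.
    unfold gamma_seq; rewrite Rpower_plus.
    pose proof (rising_pos a (S N) Ha); pose proof (rising_pos (a + b) (S N) ltac:(lra)).
    replace (a + (INR N + 1)) with (a + 1 + INR N) by ring.
    pose proof (Rpower_pos (INR N) a); pose proof (Rpower_pos (INR N) b).
    pose proof (Rpower_pos (a + 1 + INR N) b); pose proof (INR_fact_lt_0 N).
    field; repeat split; lra.
  - apply is_lim_seq_eq_lim with (Gamma a / Gamma (a + b) * 1); [|ring].
    apply is_lim_seq_mult'; [|apply Rpower_INR_quotient_cv; lra].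
    apply is_lim_seq_div'; [apply Gamma_cv; lra | apply Gamma_cv; lra | lra].
Qed.

(** For [b = 1] the quotient in [rising_quotient_cv] is explicit, [rising (x+1) N / rising x N = (x
    + N) / x], so the limit there is also [1 / x]. *)
Lemma Gamma_succ x : 0 < x -> Gamma (x + 1) = x * Gamma x.
Proof.
  intros Hx; pose proof (rising_quotient_cv x 1 Hx Rle_0_1) as L.
  assert (L1 : is_lim_seq (fun N => rising (x + 1) N / rising x N * Rpower (x + INR N) (- (1))) (/ x)).
  { apply is_lim_seq_ext with (fun _ => / x); [|apply is_lim_seq_const].
    intros N; pose proof (rising_pos x N Hx) as P; pose proof (pos_INR N).
    pose proof (rising_shift x N) as E; simpl in E.
    rewrite Rpower_Ropp, Rpower_1 by lra.
    apply Rmult_eq_reg_r with (x * rising x N * (x + INR N));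
      [|apply Rgt_not_eq, Rmult_lt_0_compat; [apply Rmult_lt_0_compat|]; lra].
    field_simplify; lra. }
  apply is_lim_seq_unique in L; apply is_lim_seq_unique in L1; rewrite L in L1.
  injection L1 as E; pose proof (Gamma_pos (x + 1) ltac:(lra)).
  apply Rmult_eq_reg_r with (/ Gamma (x + 1) * / x); [|apply Rgt_not_eq, Rmult_lt_0_compat; apply Rinv_0_lt_compat; lra].
  transitivity (Gamma x / Gamma (x + 1)); [rewrite E; field; lra | field; lra].
Qed.

Lemma Gamma_add_nat x p : 0 < x -> Gamma (x + INR p) = rising x p * Gamma x.
Proof.
  intros Hx; induction p as [|p IH]; [simpl; rewrite Rplus_0_r; ring|].
  pose proof (pos_INR p); rewrite S_INR, <- Rplus_assoc, Gamma_succ, IH by lra; simpl; ring.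
Qed.

(** A finite radius [r] would keep the terms at [|r| + 1] from tending to 0. *)
Lemma continuity_entire (c : nat -> R) :
  (forall y, 0 <= y -> ex_series (fun l => c l * y ^ l)) -> forall x, continuity_pt (PSeries c) x.
Proof.
  intros H x; apply PSeries_continuity.
  destruct (CV_radius c) as [r| |] eqn:E; [|exact I|].
  - exfalso; set (y := Rabs r + 1); pose proof (Rabs_pos r).
    apply (CV_disk_outside c y).
    + rewrite E; simpl; unfold y; rewrite (Rabs_pos_eq (_ + 1)) by lra.
      pose proof (Rle_abs r); lra.
    + apply ex_series_lim_0, H; unfold y; lra.
  - pose proof (CV_radius_ge_0 c) as P; rewrite E in P; destruct P.
Qed.

Lemma Rpower_INR_neg_cv b : 0 < b -> is_lim_seq (fun n => Rpower (INR n) (- b)) 0.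
Proof.
  intros Hb; apply is_lim_seq_Reals; intros eps He.
  destruct (nfloor_ex (Rpower (/ eps) (/ b))) as [p [_ Hp]]; [left; apply Rpower_pos|].
  exists (S p); intros n Hn; apply le_INR in Hn; rewrite S_INR in Hn.
  unfold R_dist; rewrite Rminus_0_r, Rabs_pos_eq by (left; apply Rpower_pos).
  assert (E : / eps < Rpower (INR n) b).
  { replace (/ eps) with (Rpower (Rpower (/ eps) (/ b)) b).
    - apply Rlt_Rpower_l; [exact Hb|]; split; [apply Rpower_pos | lra].
    - rewrite Rpower_mult, Rinv_l, Rpower_1; [reflexivity | apply Rinv_0_lt_compat; lra | lra]. }
  rewrite Rpower_Ropp; apply Rinv_lt_contravar in E.
  - rewrite Rinv_inv in E; exact E.
  - apply Rmult_lt_0_compat; [apply Rinv_0_lt_compat; lra | apply Rpower_pos].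
Qed.

(** Here [a] stays fixed, so [th * n^alpha] tends to [A = a^alpha] and the limiting tail is a power
    series in [x A]. The series is continuous on the whole line but describes the tail only for
    [x >= 0]. *)
Lemma fixed_index_limit k j : (1 <= k)%nat -> (1 <= j)%nat ->
  exists S : R -> R, (forall x, continuity_pt S x) /\
    forall x, 0 <= x ->
      is_lim_seq (fun n => cdf_Y k n j (Rpower (INR n) (- alpha k)) x) (1 - S x).
Proof.
  intros Hk Hj; pose proof (alpha_bounds k Hk) as Hal.
  set (a := INR j + 1 - alpha k).
  assert (Ha : 0 < a) by (apply le_INR in Hj; simpl in Hj; unfold a; lra).
  set (A := Rpower a (alpha k)); assert (HA : 0 < A) by apply Rpower_pos.
  set (q := fun l n => ratio a (alpha k * INR l) (n - j)
       * Rpower ((a + INR (n - j)) / a) (alpha k * INR l)).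
  assert (Hq : forall l, exists r : R, is_lim_seq (q l) r).
  { intros l; assert (Hb : 0 <= alpha k * INR l) by (apply Rmult_le_pos; [lra | apply pos_INR]).
    destruct (ratio_cv a (alpha k * INR l) Ha Hb) as [r [_ L]].
    exists (r / Rpower a (alpha k * INR l)); apply is_lim_seq_incr_n with (N := j).
    apply is_lim_seq_ext with (fun n => ratio a (alpha k * INR l) n
      * Rpower (a + INR n) (alpha k * INR l) * / Rpower a (alpha k * INR l)).
    - intros n; unfold q; rewrite Nat.add_sub; pose proof (pos_INR n).
      rewrite Rpower_div by lra; unfold Rdiv; ring.
    - apply is_lim_seq_mult'; [exact L | apply is_lim_seq_const]. }
  (* The limits are chosen from their existence and stay abstract; the law is identified through its
     moments. *)
  set (rho := fun l => proj1_sig (constructive_indefinite_description _ (Hq l))).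
  assert (Hrho : forall l, is_lim_seq (q l) (rho l)).
  { intros l; unfold rho; destruct (constructive_indefinite_description _ (Hq l)); assumption. }
  set (jn := fun _ : nat => j).
  assert (Hjn : eventually (fun n => (1 <= jn n <= n)%nat)).
  { exists j; intros n Hn; unfold jn; lia. }
  assert (Theta : is_lim_seq (fun n => Rpower (a / (a + INR (n - j))) (alpha k)
                                       / Rpower (INR n) (- alpha k)) A).
  { apply is_lim_seq_ext_loc with
      (fun n => A * (Rpower (INR n) (alpha k) / Rpower (1 - alpha k + INR n) (alpha k))).
    - exists j; intros n Hn; assert (0 < INR n) by (apply lt_0_INR; lia).
      rewrite minus_INR by exact Hn.
      replace (a + (INR n - INR j)) with (1 - alpha k + INR n) by (unfold a; ring).
      rewrite Rpower_div, Rpower_Ropp by lra; fold A.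
      pose proof (Rpower_pos (INR n) (alpha k)).
      pose proof (Rpower_pos (1 - alpha k + INR n) (alpha k)); field; lra.
    - apply is_lim_seq_eq_lim with (A * 1); [|ring].
      apply is_lim_seq_mult'; [apply is_lim_seq_const | apply Rpower_INR_quotient_cv; lra]. }
  assert (C0 := Rpower_INR_neg_cv (alpha k) (proj1 Hal)).
  set (M := fun x n => Z.to_nat (up (x / Rpower (INR n) (- alpha k)))).
  assert (T : forall x, 0 <= x ->
    ex_series (fun l => (-1) ^ l * ((x * A) ^ l / INR (fact l)) * rho l) /\
    is_lim_seq (fun n => tail_sum k j (n - j) (M x n))
               (Series (fun l => (-1) ^ l * ((x * A) ^ l / INR (fact l)) * rho l))).
  { intros x Hx; apply (tail_cv k jn (fun n => (n - j)%nat)); auto.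
    - destruct Hjn as [n0 H0]; exists n0; intros n Hn; apply H0, Hn.
    - apply Rmult_le_pos; lra.
    - apply is_lim_seq_ext with (fun n => (Rpower (a / (a + INR (n - j))) (alpha k)
          / Rpower (INR n) (- alpha k)) * Rpower (INR n) (- alpha k)).
      + intros n; unfold jn; fold a; pose proof (Rpower_pos (INR n) (- alpha k)); field; lra.
      + apply is_lim_seq_eq_lim with (A * 0); [|ring].
        apply is_lim_seq_mult'; assumption.
    - apply is_lim_seq_ext with (fun n => (INR (M x n) * Rpower (INR n) (- alpha k))
        * (Rpower (a / (a + INR (n - j))) (alpha k) / Rpower (INR n) (- alpha k))).
      + intros n; unfold jn; fold a; pose proof (Rpower_pos (INR n) (- alpha k)); field; lra.
      + apply is_lim_seq_mult'; [|exact Theta].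
        apply (ceil_scaled_cv (fun n => Rpower (INR n) (- alpha k)) x); auto.
        intros n; apply Rpower_pos. }
  set (cf := fun l => (-1) ^ l * rho l / INR (fact l)).
  exists (fun x => PSeries cf (x * A)); split.
  - intros x; apply (continuity_pt_comp (fun x => x * A) (PSeries cf)).
    + apply continuity_pt_mult; [apply derivable_continuous_pt, derivable_pt_id|].
      apply continuity_pt_const; intros u v; reflexivity.
    + apply continuity_entire; intros y Hy.
      destruct (T (y / A)) as [T1 _]; [apply Rdiv_le_0_compat; lra|].
      eapply ex_series_ext; [|exact T1]; intros l; simpl.
      replace (y / A * A) with y by (field; lra); unfold cf, Rdiv; ring.
  - intros x Hx; destruct (T x Hx) as [_ T2].
    apply is_lim_seq_ext_loc with (fun n => 1 - tail_sum k j (n - j) (M x n)).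
    + exists j; intros n Hn; symmetry; apply cdf_Y_tail; auto; apply Rpower_pos.
    + apply is_lim_seq_minus'; [apply is_lim_seq_const|].
      apply is_lim_seq_eq_lim with (1 := T2); unfold PSeries; apply Series_ext.
      intros l; unfold cf, Rdiv; ring.
Qed.

(** The rising-factorial moments converge by [expect_rising] and [rising_quotient_cv]; they differ
    from power moments by lower-order terms, each carrying an extra factor [c n], which tends to
    0. *)
Lemma scaled_moment_cv k j s : (1 <= k)%nat -> (1 <= j)%nat ->
  is_lim_seq (fun n => expect k n j (fun d => (Rpower (INR n) (- alpha k) * INR d) ^ s))
    (INR (fact s) * Gamma (INR j + 1 - alpha k) / Gamma (INR j + 1 - alpha k + alpha k * INR s)).
Proof.
  intros Hk Hj; pose proof (alpha_bounds k Hk) as Hal.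
  set (a := INR j + 1 - alpha k).
  assert (Ha : 0 < a) by (apply le_INR in Hj; simpl in Hj; unfold a; lra).
  set (c := fun n => Rpower (INR n) (- alpha k)).
  assert (C0 : is_lim_seq c 0) by apply Rpower_INR_neg_cv, Hal.
  set (L := fun s => INR (fact s) * Gamma a / Gamma (a + alpha k * INR s)).
  assert (Base : forall q, is_lim_seq (fun n => expect k n j (fun d => c n ^ q * rising (INR d + 1) q + 0 * 0)) (L q)).
  { intros q; assert (Hb : 0 <= alpha k * INR q) by (apply Rmult_le_pos; [lra | apply pos_INR]).
    apply is_lim_seq_incr_n with (N := j).
    apply is_lim_seq_ext with (fun N => INR (fact q) * (rising (a + alpha k * INR q) N / rising a N
       * Rpower (a + INR N) (- (alpha k * INR q)))
       * (Rpower (INR j + INR N) (- (alpha k * INR q)) / Rpower (a + INR N) (- (alpha k * INR q)))).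
    - intros N; rewrite expect_lin, (Nat.add_comm N), expect_rising by auto; fold a.
      unfold c; rewrite plus_INR; assert (0 < INR j) by (apply lt_0_INR; lia).
      pose proof (pos_INR N); rewrite <- Rpower_mult_INR by lra.
      rewrite (Ropp_mult_distr_l (alpha k)).
      pose proof (rising_pos a N Ha); pose proof (Rpower_pos (a + INR N) (- alpha k * INR q)).
      field; lra.
    - apply is_lim_seq_eq_lim with (INR (fact q) * (Gamma a / Gamma (a + alpha k * INR q)) * 1);
        [|unfold L, Rdiv; ring].
      apply is_lim_seq_mult'.
      + apply is_lim_seq_mult'; [apply is_lim_seq_const | apply rising_quotient_cv; assumption].
      + apply Rpower_shift_quotient_cv; [apply lt_0_INR; lia | exact Ha]. }
  (* [d * rising (d+1) q = rising (d+1) (q+1) - (q+1) rising (d+1) q]: converts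
     rising-factorial moments into power moments one factor at a time. *)
  assert (Conv : forall p q, is_lim_seq
    (fun n => expect k n j (fun d => (c n * INR d) ^ p * (c n ^ q * rising (INR d + 1) q))) (L (p + q)%nat)).
  { induction p as [|p IH]; intros q.
    - eapply is_lim_seq_ext; [|apply Base]; intros n; apply expect_ext; intros d; simpl; ring.
    - apply is_lim_seq_ext with (fun n =>
        1 * expect k n j (fun d => (c n * INR d) ^ p * (c n ^ S q * rising (INR d + 1) (S q)))
        + (- (INR q + 1) * c n) * expect k n j (fun d => (c n * INR d) ^ p * (c n ^ q * rising (INR d + 1) q))).
      + intros n; rewrite <- expect_lin; apply expect_ext; intros d; simpl; ring.
      + replace (S p + q)%nat with (p + S q)%nat by lia.
        apply is_lim_seq_eq_lim with (1 * L (p + S q)%nat + (- (INR q + 1) * 0) * L (p + q)%nat); [|ring].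
        apply is_lim_seq_plus'; apply is_lim_seq_mult'; try apply IH; [apply is_lim_seq_const|].
        apply is_lim_seq_mult'; [apply is_lim_seq_const | exact C0]. }
  eapply is_lim_seq_ext; [|specialize (Conv s 0%nat); rewrite Nat.add_0_r in Conv; exact Conv].
  intros n; apply expect_ext; intros d; unfold c; simpl; ring.
Qed.

(** * Moments of the limit law *)

(** Polya's theorem on a compact interval: near [t], monotonicity squeezes [g n x] between its
    values at two fixed points close to [t], where pointwise convergence suffices. *)
Lemma uniform_cv_of_monotone (g : nat -> R -> R) (surv : R -> R) (b : R) :
  0 < b ->
  (forall n x y, x <= y -> g n y <= g n x) ->
  (forall x, continuity_pt surv x) ->
  (forall x, 0 <= x -> is_lim_seq (fun n => g n x) (surv x)) ->
  forall eps, 0 < eps ->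
    eventually (fun n => forall x, 0 <= x <= b -> Rabs (g n x - surv x) <= eps).
Proof.
  intros Hb Hmon Hcont Hlim eps He.
  assert (Cv : forall x d, 0 <= x -> 0 < d -> exists N, forall n, (N <= n)%nat -> Rabs (g n x - surv x) < d).
  { intros x d Hx Hd; specialize (Hlim x Hx); apply is_lim_seq_Reals in Hlim.
    destruct (Hlim d Hd) as [N HN]; exists N; intros n Hn; apply HN; exact Hn. }
  (* The radius also encodes a rank: [/ (N + 1)] bounds it from above. *)
  assert (Loc : forall t, exists d : posreal, 0 <= t -> exists N : nat, d <= / (INR N + 1) /\
            forall n x, (N <= n)%nat -> 0 <= x -> Rabs (x - t) < d -> Rabs (g n x - surv x) <= eps).
  { intros t; destruct (Rle_dec 0 t) as [Ht|Ht]; [|exists (mkposreal 1 Rlt_0_1); lra].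
    destruct (Hcont t (eps / 4)) as [d0 [Hd0 HS]]; [lra|].
    set (d1 := d0 / 2); assert (Hd1 : 0 < d1) by (unfold d1; lra).
    (* The left comparison point is clipped at 0 because convergence is known only for nonnegative
       arguments. *)
    set (l := Rmax 0 (t - d1)).
    assert (NS : forall x, Rabs (x - t) <= d1 -> Rabs (surv x - surv t) < eps / 4).
    { intros x Hx; destruct (Req_dec x t) as [-> |Hne]; [rewrite Rminus_diag, Rabs_R0; lra|].
      apply (HS x); split; [split; [exact I | auto]|]; unfold dist; simpl; unfold R_dist.
      unfold d1 in Hx; lra. }
    assert (Hl : 0 <= l /\ Rabs (l - t) <= d1).
    { unfold l, Rmax; destruct (Rle_dec 0 (t - d1)); split; try lra.
      - rewrite Rabs_left; lra.
      - rewrite Rabs_left1; lra. }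
    destruct (Cv l (eps / 4)) as [N1 H1]; [apply Hl|lra|].
    destruct (Cv (t + d1) (eps / 4)) as [N2 H2]; [lra|lra|].
    set (N := max N1 N2); pose proof (pos_INR N).
    assert (Hd : 0 < Rmin d1 (/ (INR N + 1))) by (apply Rmin_pos; [lra | apply Rinv_0_lt_compat; lra]).
    exists (mkposreal _ Hd); intros _; exists N; split; [apply Rmin_r|].
    intros n x Hn Hx Hxt; simpl in Hxt.
    assert (Hxd : Rabs (x - t) < d1) by (eapply Rlt_le_trans; [exact Hxt | apply Rmin_l]).
    specialize (H1 n ltac:(lia)); specialize (H2 n ltac:(lia)).
    pose proof (NS l (proj2 Hl)) as S1; pose proof (NS x (Rlt_le _ _ Hxd)) as Sx.
    assert (S2 : Rabs (surv (t + d1) - surv t) < eps / 4).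
    { apply NS; replace (t + d1 - t) with d1 by ring; rewrite Rabs_pos_eq; lra. }
    apply Rabs_def2 in Hxd; apply Rabs_def2 in H1; apply Rabs_def2 in H2.
    apply Rabs_def2 in S1; apply Rabs_def2 in S2; apply Rabs_def2 in Sx.
    assert (l <= x) by (unfold l; apply Rmax_lub; lra).
    pose proof (Hmon n l x ltac:(lra)); pose proof (Hmon n x (t + d1) ltac:(lra)).
    apply Rabs_le; lra. }
  set (delta := fun t => proj1_sig (constructive_indefinite_description _ (Loc t))).
  assert (Hdelta : forall t, 0 <= t -> exists N : nat, delta t <= / (INR N + 1) /\
            forall n x, (N <= n)%nat -> 0 <= x -> Rabs (x - t) < delta t -> Rabs (g n x - surv x) <= eps).
  { intros t; unfold delta; destruct (constructive_indefinite_description _ (Loc t)); assumption. }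
  (* Compactness gives a lower bound [d] for the radii in use. As a radius is at most [1 / (N + 1)],
     this bounds the ranks [N] by the integer part of [1 / d]. *)
  destruct (compactness_value_1d 0 b delta) as [d Hd]; pose proof (cond_pos d) as Pd.
  destruct (nfloor_ex (/ d)) as [K HK]; [left; apply Rinv_0_lt_compat; exact Pd|].
  exists K; intros n Hn x Hx.
  specialize (Hd x Hx); apply NNPP in Hd; destruct Hd as [t [Ht [Hxt Hdt]]].
  destruct (Hdelta t (proj1 Ht)) as [N [HN Hg]]; apply Hg; [|lra|exact Hxt].
  assert (d <= / (INR N + 1)) by lra; pose proof (pos_INR N).
  assert (INR N + 1 <= / d).
  { rewrite <- (Rinv_inv (INR N + 1)); apply Rinv_le_contravar; lra. }
  assert (N < K + 1)%nat by (apply INR_lt; rewrite plus_INR; simpl; lra).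
  lia.
Qed.

(** * Truncated moments as integrals of tails *)

Lemma is_RInt_eq_val (f : R -> R) (a b u v : R) : is_RInt f a b u -> u = v -> is_RInt f a b v.
Proof. intros H <-; exact H. Qed.

Lemma is_RInt_ext_le (f g : R -> R) (a b v : R) : a <= b ->
  (forall x, a < x < b -> f x = g x) -> is_RInt f a b v -> is_RInt g a b v.
Proof.
  intros Hab H; apply is_RInt_ext; intros x; rewrite Rmin_left, Rmax_right by exact Hab; apply H.
Qed.

Lemma is_RInt_zero (a b : R) : is_RInt (fun _ => 0) a b 0.
Proof.
  apply is_RInt_eq_val with (scal (b - a) 0); [apply (is_RInt_const (V := R_NormedModule))|].
  apply Rmult_0_r.
Qed.

Lemma is_RInt_rsum {T : Type} (f : T -> R -> R) (v : T -> R) (a b : R) (l : list T) :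
  (forall t, is_RInt (f t) a b (v t)) ->
  is_RInt (fun x => rsum (fun t => f t x) l) a b (rsum v l).
Proof.
  intros H; induction l as [|t l IH]; simpl.
  - apply is_RInt_zero.
  - apply (is_RInt_plus (V := R_NormedModule)); [apply H | exact IH].
Qed.

Lemma is_RInt_pow (s : nat) (a b : R) :
  is_RInt (fun x => INR (S s) * x ^ s) a b (b ^ S s - a ^ S s).
Proof.
  apply (is_RInt_derive (V := R_CompleteNormedModule) (fun x => x ^ S s)).
  - intros x _; apply is_derive_Reals; apply (derivable_pt_lim_pow x (S s)).
  - intros x _; apply continuity_pt_filterlim.
    apply continuity_pt_mult; [apply continuity_pt_const; intros u v; reflexivity|].
    apply derivable_continuous_pt, derivable_pt_pow.
Qed.

Lemma is_RInt_truncated_pow (s : nat) (z b : R) : 0 <= z -> 0 <= b ->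
  is_RInt (fun x => INR (S s) * x ^ s * indic (if Rle_dec z x then false else true))
          0 b (Rmin z b ^ S s).
Proof.
  intros Hz Hb; set (m := Rmin z b).
  assert (Hm : 0 <= m <= b /\ m <= z).
  { unfold m; repeat split; [apply Rmin_glb; assumption | apply Rmin_r | apply Rmin_l]. }
  apply is_RInt_eq_val with ((m ^ S s - 0 ^ S s) + 0); [|simpl; ring].
  apply (is_RInt_Chasles (V := R_NormedModule)) with m.
  - apply is_RInt_ext_le with (fun x => INR (S s) * x ^ s); [lra| |apply is_RInt_pow].
    intros x Hx.
    destruct (Rle_dec z x); [lra|]; unfold indic; ring.
  - apply is_RInt_ext_le with (fun _ => 0); [lra| |apply is_RInt_zero].
    intros x Hx.
    destruct (Rle_dec z x) as [_|H]; unfold indic; [ring|]; exfalso.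
    unfold m, Rmin in *; destruct (Rle_dec z b); lra.
Qed.

(** Layer-cake formula cut off at [b], exact because the expectation is a finite sum of integrals of
    step functions times a power. *)
Lemma is_RInt_truncated_moment k n j c s b : 0 < c -> 0 <= b ->
  is_RInt (fun x => INR (S s) * x ^ s * (1 - cdf_Y k n j c x)) 0 b
          (expect k n j (fun d => Rmin (c * INR d) b ^ S s)).
Proof.
  intros Hc Hb.
  apply is_RInt_ext_le with (fun x => / INR (length (trees k n)) *
    rsum (fun t => INR (S s) * x ^ s * indic (if Rle_dec (c * INR (outdeg k t (Ins j))) x then false else true)) (trees k n)).
  - exact Hb.
  - intros x _; rewrite cdf_Y_expect.
    transitivity (expect k n j (fun d => INR (S s) * x ^ s * 1 + (- (INR (S s) * x ^ s)) * indic (if Rle_dec (c * INR d) x then true else false)));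
      [|rewrite expect_lin, expect_const; ring].
    unfold expect, Rdiv; rewrite Rmult_comm; f_equal; apply rsum_ext_in; intros t _.
    destruct (Rle_dec _ x); unfold indic; ring.
  - unfold expect, Rdiv; rewrite Rmult_comm.
    apply (is_RInt_scal (V := R_NormedModule)).
    apply (is_RInt_rsum (fun t x => INR (S s) * x ^ s * indic (if Rle_dec (c * INR (outdeg k t (Ins j))) x then false else true))).
    intros t; apply is_RInt_truncated_pow; [|exact Hb].
    apply Rmult_le_pos; [lra | apply pos_INR].
Qed.

(** The difference vanishes for [z <= b]; for [z > b] it is at most [z^s], and [z / b >= 1] can be
    inserted. *)
Lemma truncation_error (z b : R) (s : nat) : 0 <= z -> 0 < b ->
  0 <= z ^ s - Rmin z b ^ s <= z ^ S s / b.
Proof.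
  intros Hz Hb; pose proof (pow_le z s Hz).
  unfold Rmin; destruct (Rle_dec z b) as [H1|H1].
  - rewrite Rminus_diag; split; [lra|]; apply Rdiv_le_0_compat; [apply pow_le; exact Hz | exact Hb].
  - split.
    + pose proof (pow_incr b z s ltac:(lra)); lra.
    + pose proof (pow_le b s ltac:(lra)).
      apply Rle_trans with (z ^ s); [lra|].
      apply Rle_div_r; [exact Hb|]; simpl; rewrite (Rmult_comm z).
      apply Rmult_le_compat_l; lra.
Qed.

Section LimitMoments.

Variables (k j : nat) (c : nat -> R) (surv : R -> R) (mu : nat -> R).
Hypothesis c_pos : forall n, 0 < c n.
Hypothesis S_cont : forall x, continuity_pt surv x.
Hypothesis S_lim : forall x, 0 <= x -> is_lim_seq (fun n => cdf_Y k n j (c n) x) (1 - surv x).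
Hypothesis mu_lim : forall s, is_lim_seq (fun n => expect k n j (fun d => (c n * INR d) ^ s)) (mu s).

Lemma cdf_Y_monotone n x y : x <= y -> cdf_Y k n j (c n) x <= cdf_Y k n j (c n) y.
Proof.
  intros H; rewrite !cdf_Y_expect; apply expect_le; intros d.
  destruct (Rle_dec _ x), (Rle_dec _ y); unfold indic; lra.
Qed.

Lemma cdf_Y_bounds n x : 0 <= cdf_Y k n j (c n) x <= 1.
Proof.
  rewrite cdf_Y_expect; split.
  - rewrite <- (expect_const k n j 0); apply expect_le; intros d.
    destruct (Rle_dec _ x); unfold indic; lra.
  - rewrite <- (expect_const k n j 1); apply expect_le; intros d.
    destruct (Rle_dec _ x); unfold indic; lra.
Qed.

Lemma survival_lim x : 0 <= x -> is_lim_seq (fun n => 1 - cdf_Y k n j (c n) x) (surv x).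
Proof.
  intros Hx; apply is_lim_seq_eq_lim with (1 - (1 - surv x)); [|ring].
  apply is_lim_seq_minus'; [apply is_lim_seq_const | apply S_lim; exact Hx].
Qed.

Lemma weighted_survival_integrable s b : ex_RInt (fun x => INR (S s) * x ^ s * surv x) 0 b.
Proof.
  apply (ex_RInt_continuous (V := R_CompleteNormedModule)); intros x _.
  apply continuity_pt_filterlim.
  apply continuity_pt_mult; [|apply S_cont].
  apply continuity_pt_mult; [apply continuity_pt_const; intros u v; reflexivity|].
  apply derivable_continuous_pt, derivable_pt_pow.
Qed.

Lemma truncated_moment_cv s b : 0 < b ->
  is_lim_seq (fun n => expect k n j (fun d => Rmin (c n * INR d) b ^ S s))
             (RInt (fun x => INR (S s) * x ^ s * surv x) 0 b).
Proof.
  intros Hb; set (W := INR (S s) * b ^ s).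
  assert (HW : 0 < W).
  { unfold W; apply Rmult_lt_0_compat; [apply lt_0_INR; lia | apply pow_lt; exact Hb]. }
  apply is_lim_seq_Reals; intros eps He.
  destruct (uniform_cv_of_monotone (fun n x => 1 - cdf_Y k n j (c n) x) surv b Hb) with
    (eps := eps / (2 * (b * W))) as [N HN].
  - intros n x y H; pose proof (cdf_Y_monotone n x y H); lra.
  - exact S_cont.
  - exact survival_lim.
  - apply Rdiv_lt_0_compat; [lra | nra].
  - exists N; intros n Hn; unfold R_dist.
    pose proof (is_RInt_truncated_moment k n j (c n) s b (c_pos n) (Rlt_le _ _ Hb)) as I1.
    pose proof (RInt_correct _ _ _ (weighted_survival_integrable s b)) as I2.
    pose proof (is_RInt_minus _ _ _ _ _ _ I1 I2) as I3.
    match type of I3 with is_RInt ?f _ _ _ => match goal with |- Rabs ?u < _ =>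
      replace u with (RInt f 0 b) by exact (is_RInt_unique _ _ _ _ I3) end end.
    apply Rle_lt_trans with ((b - 0) * (W * (eps / (2 * (b * W))))).
    + apply abs_RInt_le_const; [lra | eexists; exact I3|].
      intros x Hx; change (Rabs (INR (S s) * x ^ s * (1 - cdf_Y k n j (c n) x)
        - INR (S s) * x ^ s * surv x) <= W * (eps / (2 * (b * W)))).
      rewrite <- Rmult_minus_distr_l.
      rewrite Rabs_mult; apply Rmult_le_compat; try apply Rabs_pos; [|apply HN; auto].
      rewrite Rabs_pos_eq by (apply Rmult_le_pos; [apply pos_INR | apply pow_le; lra]).
      apply Rmult_le_compat_l; [apply pos_INR | apply pow_incr; lra].
    + replace ((b - 0) * (W * (eps / (2 * (b * W))))) with (eps / 2) by (field; lra); lra.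
Qed.

(** [truncation_error] bounds the error for each [n] by the moment of order [s + 2] over [b], and
    these moments converge. Letting [b] grow then exchanges the two limits and identifies the moment
    of the limit law. *)
Lemma truncated_moment_bound s b : 0 < b ->
  0 <= mu (S s) - RInt (fun x => INR (S s) * x ^ s * surv x) 0 b
    <= mu (S (S s)) / b.
Proof.
  intros Hb.
  assert (L : is_lim_seq (fun n => expect k n j (fun d => (c n * INR d) ^ S s)
     - expect k n j (fun d => Rmin (c n * INR d) b ^ S s))
     (mu (S s) - RInt (fun x => INR (S s) * x ^ s * surv x) 0 b)).
  { apply is_lim_seq_minus'; [apply mu_lim | apply truncated_moment_cv; exact Hb]. }
  assert (Z : forall n d, 0 <= c n * INR d).
  { intros n d; apply Rmult_le_pos; [left; apply c_pos | apply pos_INR]. }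
  split.
  - apply (is_lim_seq_le (fun _ => 0) _ 0 _) with (3 := L); [|apply is_lim_seq_const].
    intros n; pose proof (expect_le k n j (fun d => Rmin (c n * INR d) b ^ S s)
      (fun d => (c n * INR d) ^ S s)) as E.
    assert (Rmin_pow : forall d, Rmin (c n * INR d) b ^ S s <= (c n * INR d) ^ S s).
    { intros d; pose proof (truncation_error _ b (S s) (Z n d) Hb); lra. }
    specialize (E Rmin_pow); lra.
  - apply (is_lim_seq_le _ (fun n => / b * expect k n j (fun d => (c n * INR d) ^ S (S s)) + 0 * expect k n j (fun d => 0)) _ (mu (S (S s)) / b)) with (2 := L).
    + intros n; rewrite <- expect_lin.
      pose proof (expect_lin k n j (fun d => (c n * INR d) ^ S s)
        (fun d => Rmin (c n * INR d) b ^ S s) 1 (-1)) as E.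
      transitivity (expect k n j (fun d => 1 * (c n * INR d) ^ S s
         + (-1) * Rmin (c n * INR d) b ^ S s)); [lra|].
      apply expect_le; intros d.
      pose proof (truncation_error _ b (S s) (Z n d) Hb); lra.
    + apply is_lim_seq_eq_lim with (/ b * mu (S (S s)) + 0); [|field; lra].
      apply is_lim_seq_plus'.
      * apply is_lim_seq_mult'; [apply is_lim_seq_const | apply mu_lim].
      * apply is_lim_seq_ext with (fun _ => 0); [intros n; ring | apply is_lim_seq_const].
Qed.

Definition limit_cdf (x : R) : R := if Rle_dec 0 x then 1 - surv x else 0.

Lemma survival_bounds x : 0 <= x -> 0 <= surv x <= 1.
Proof.
  intros Hx; split.
  - apply (is_lim_seq_le (fun _ => 0) _ 0 (surv x)) with (3 := survival_lim x Hx);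
      [|apply is_lim_seq_const]; intros n; pose proof (cdf_Y_bounds n x); lra.
  - apply (is_lim_seq_le _ (fun _ => 1) (surv x) 1) with (2 := survival_lim x Hx);
      [|apply is_lim_seq_const]; intros n; pose proof (cdf_Y_bounds n x); lra.
Qed.

Lemma survival_antitone x y : 0 <= x <= y -> surv y <= surv x.
Proof.
  intros H; apply (is_lim_seq_le _ _ (surv y) (surv x)) with (2 := survival_lim y ltac:(lra))
    (3 := survival_lim x ltac:(lra)).
  intros n; pose proof (cdf_Y_monotone n x y ltac:(lra)); lra.
Qed.

(** Monotonicity gives [x * surv x <= int_0^x surv], which is at most [mu 1]. This prevents mass
    from escaping to infinity, so that the limit is a proper distribution function. *)
Lemma survival_markov x : 0 < x -> surv x <= mu 1 / x.
Proof.
  intros Hx; pose proof (truncated_moment_bound 0 x Hx) as [B _].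
  assert (I : x * surv x <= RInt (fun t => INR 1 * t ^ 0 * surv t) 0 x).
  { replace (x * surv x) with (RInt (fun _ => surv x) 0 x).
    - apply RInt_le; [lra | apply ex_RInt_const | apply weighted_survival_integrable|].
      intros t Ht; simpl; rewrite !Rmult_1_l; apply survival_antitone; lra.
    - rewrite RInt_const; unfold scal; simpl; unfold mult; simpl; ring. }
  apply Rle_div_r; lra.
Qed.

Lemma limit_cdf_is_cdf : is_cdf limit_cdf.
Proof.
  unfold limit_cdf; split; [|split; [|split]].
  - intros x y H; destruct (Rle_dec 0 x), (Rle_dec 0 y); try lra.
    + pose proof (survival_antitone x y ltac:(lra)); lra.
    + pose proof (survival_bounds y ltac:(lra)); lra.
  - intros x eps He; destruct (Rle_dec 0 x) as [Hx|Hx].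
    + destruct (S_cont x eps He) as [d [Hd H]]; exists d; split; [exact Hd|].
      intros y Hy; destruct (Rle_dec 0 y); [|lra].
      replace (1 - surv y - (1 - surv x)) with (- (surv y - surv x)) by ring; rewrite Rabs_Ropp.
      destruct (Req_dec y x) as [-> |Hne]; [rewrite Rminus_diag, Rabs_R0; exact He|].
      apply (H y); split; [split; [exact I | auto]|]; unfold dist; simpl; unfold R_dist.
      rewrite Rabs_pos_eq; lra.
    + exists (- x); split; [lra|]; intros y Hy; destruct (Rle_dec 0 y); [lra|].
      rewrite Rminus_diag, Rabs_R0; exact He.
  - intros eps He; exists (-1); intros x Hx; destruct (Rle_dec 0 x); [lra|].
    rewrite Rabs_R0; exact He.
  - intros eps He; exists (Rmax 1 ((Rabs (mu 1) + 1) / eps)); intros x Hx.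
    assert (1 <= x) by (pose proof (Rmax_l 1 ((Rabs (mu 1) + 1) / eps)); lra).
    assert (E : (Rabs (mu 1) + 1) / eps <= x) by (pose proof (Rmax_r 1 ((Rabs (mu 1) + 1) / eps)); lra).
    destruct (Rle_dec 0 x); [|lra].
    replace (1 - surv x - 1) with (- surv x) by ring; rewrite Rabs_Ropp.
    pose proof (survival_bounds x ltac:(lra)); rewrite Rabs_pos_eq by lra.
    apply Rle_div_l in E; [|exact He]; pose proof (Rle_abs (mu 1)).
    eapply Rle_lt_trans; [apply survival_markov; lra|].
    apply Rlt_div_l; lra.
Qed.

Lemma limit_cdf_cv : conv_dist (fun n => cdf_Y k n j (c n)) limit_cdf.
Proof.
  intros x _; apply is_lim_seq_Reals; unfold limit_cdf; destruct (Rle_dec 0 x) as [Hx|Hx].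
  - apply S_lim; exact Hx.
  - apply is_lim_seq_ext with (fun _ => 0); [|apply is_lim_seq_const].
    intros n; symmetry; apply cdf_Y_neg; [left; apply c_pos | lra].
Qed.

(** Agreement is asked only for [x > 0], because at 0 the integrand of [has_moment] contains the
    value of the limit law at [- 0], outside the branch [x < 0]. *)
Lemma improper_int0_survival s (f : R -> R) :
  (forall x, 0 < x -> f x = INR (S s) * x ^ s * surv x) ->
  improper_int0 f (mu (S s)).
Proof.
  intros Hf.
  assert (Ext : forall b, 0 <= b -> forall x, Rmin 0 b < x < Rmax 0 b -> INR (S s) * x ^ s * surv x = f x).
  { intros b Hb x Hx; rewrite Rmin_left in Hx by lra; symmetry; apply Hf; lra. }
  split.
  - intros b Hb; constructor; apply ex_RInt_Reals_0.
    eapply ex_RInt_ext; [apply Ext, Hb | apply weighted_survival_integrable].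
  - intros eps He; set (m := Rabs (mu (S (S s)))).
    exists ((m + 1) / eps + 1); intros b pr Hb; pose proof (Rabs_pos (mu (S (S s)))) as Hm; fold m in Hm.
    assert (P : 0 < (m + 1) / eps) by (apply Rdiv_lt_0_compat; lra).
    rewrite <- RInt_Reals, <- (RInt_ext _ _ _ _ (Ext b ltac:(lra))).
    pose proof (truncated_moment_bound s b ltac:(lra)) as [B1 B2].
    rewrite Rabs_minus_sym, Rabs_pos_eq by lra.
    eapply Rle_lt_trans; [exact B2|]; apply Rlt_div_l; [lra|].
    assert (E : (m + 1) / eps <= b) by lra; apply Rle_div_l in E; [|exact He].
    pose proof (Rle_abs (mu (S (S s)))); fold m in H; lra.
Qed.

Lemma limit_cdf_moment s : (s = 0%nat -> mu s = 1) -> has_moment limit_cdf s (mu s).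
Proof.
  destruct s as [|s]; cbn [has_moment]; intros H0; [auto|].
  assert (E : forall x, 0 < x -> limit_cdf x = 1 - surv x /\ limit_cdf (- x) = 0).
  { intros x Hx; unfold limit_cdf; destruct (Rle_dec 0 x), (Rle_dec 0 (- x)); split; lra. }
  split; [exists (mu (S s))|]; apply improper_int0_survival; intros x Hx;
    destruct (E x Hx) as [-> ->]; replace (S s - 1)%nat with s by lia; ring.
Qed.

End LimitMoments.

(** * Taylor polynomials of the Fejer kernel *)

Definition cos_taylor (N : nat) (v : R) : R :=
  sum_f_R0 (fun m => (-1) ^ m * v ^ (2 * m) / INR (fact (2 * m))) N.
Definition sin_taylor (N : nat) (v : R) : R :=
  sum_f_R0 (fun m => (-1) ^ m * v ^ (2 * m + 1) / INR (fact (2 * m + 1))) N.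

Lemma is_derive_ext_real (f g : R -> R) (v l : R) :
  (forall z, f z = g z) -> is_derive f v l -> is_derive g v l.
Proof. intros H; apply is_derive_ext; exact H. Qed.

Lemma is_derive_pow_fact n v :
  is_derive (fun v => v ^ S n / INR (fact (S n))) v (v ^ n / INR (fact n)).
Proof.
  apply is_derive_Reals.
  replace (v ^ n / INR (fact n)) with (/ INR (fact (S n)) * (INR (S n) * v ^ n)).
  - apply derivable_pt_lim_ext with (fun v => / INR (fact (S n)) * v ^ S n).
    + intros z; unfold Rdiv; apply Rmult_comm.
    + apply derivable_pt_lim_scal; apply (derivable_pt_lim_pow v (S n)).
  - change (fact (S n)) with (S n * fact n)%nat; rewrite mult_INR.
    field; split; [apply INR_fact_neq_0 | apply not_0_INR; lia].
Qed.

Lemma is_derive_sin_taylor N v : is_derive (sin_taylor N) v (cos_taylor N v).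
Proof.
  assert (T : forall m, is_derive (fun v => (-1) ^ m * v ^ (2 * m + 1) / INR (fact (2 * m + 1))) v
                     ((-1) ^ m * v ^ (2 * m) / INR (fact (2 * m)))).
  { intros m; rewrite Nat.add_1_r; unfold Rdiv.
    apply is_derive_ext_real with (fun v => (-1) ^ m * (v ^ S (2 * m) / INR (fact (S (2 * m))))).
    - intros z; unfold Rdiv; ring.
    - rewrite Rmult_assoc; apply is_derive_scal, is_derive_pow_fact. }
  induction N as [|N IH]; unfold sin_taylor, cos_taylor in *; [apply T|].
  rewrite tech5; apply (is_derive_plus (V := R_NormedModule)); [exact IH | apply T].
Qed.

Lemma is_derive_cos_taylor N v : is_derive (cos_taylor (S N)) v (- sin_taylor N v).
Proof.
  assert (T : forall m, is_derive (fun v => (-1) ^ S m * v ^ (2 * S m) / INR (fact (2 * S m))) v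
                     (- ((-1) ^ m * v ^ (2 * m + 1) / INR (fact (2 * m + 1))))).
  { intros m; replace (2 * S m)%nat with (S (2 * m + 1)) by lia.
    apply is_derive_ext_real with (fun v => (-1) ^ S m * (v ^ S (2 * m + 1) / INR (fact (S (2 * m + 1))))).
    - intros z; unfold Rdiv; ring.
    - replace (- _) with ((-1) ^ S m * (v ^ (2 * m + 1) / INR (fact (2 * m + 1))))
        by (unfold Rdiv; simpl; ring).
      apply is_derive_scal, is_derive_pow_fact. }
  induction N as [|N IH].
  - apply is_derive_ext_real with (fun v => 1 + (-1) ^ 1 * v ^ (2 * 1) / INR (fact (2 * 1))).
    + intros z; unfold cos_taylor; simpl; field.
    + replace (- sin_taylor 0 v) with (0 + - sin_taylor 0 v) by ring.
      apply (is_derive_plus (V := R_NormedModule)); [apply (is_derive_const (V := R_NormedModule)) | apply T].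
  - unfold sin_taylor, cos_taylor in *; rewrite tech5.
    replace (- (_ + _)) with (- sum_f_R0 (fun m => (-1) ^ m * v ^ (2 * m + 1) / INR (fact (2 * m + 1))) N
       + - ((-1) ^ S N * v ^ (2 * S N + 1) / INR (fact (2 * S N + 1)))) by ring.
    apply (is_derive_plus (V := R_NormedModule)); [exact IH | apply T].
Qed.

Lemma nonneg_of_derive (f df : R -> R) : f 0 = 0 ->
  (forall v, is_derive f v (df v)) -> (forall v, 0 <= v -> 0 <= df v) ->
  forall v, 0 <= v -> 0 <= f v.
Proof.
  intros H0 Hd Hp v Hv.
  destruct (MVT_gen f 0 v df) as [w [Hw E]].
  - intros x _; apply Hd.
  - intros x _; apply derivable_continuous_pt; exists (df x); apply is_derive_Reals, Hd.
  - rewrite Rmin_left, Rmax_right in Hw by lra.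
    rewrite H0 in E; specialize (Hp w ltac:(lra)); nra.
Qed.

Lemma cos_taylor_0 N : cos_taylor N 0 = 1.
Proof.
  induction N as [|N IH]; unfold cos_taylor in *; [simpl; field|].
  rewrite tech5, IH, pow_i by lia; unfold Rdiv; ring.
Qed.

Lemma sin_taylor_0 N : sin_taylor N 0 = 0.
Proof.
  induction N as [|N IH]; unfold sin_taylor in *; [simpl; field|].
  rewrite tech5, IH, pow_i by lia; unfold Rdiv; ring.
Qed.

(** The inequality [cos v <= 1] is integrated from 0 repeatedly, alternating between [sin] and
    [cos]; each passage from [sin] back to [cos] flips the sign. *)
Lemma cos_sin_taylor_sign N :
  (forall v, 0 <= v -> 0 <= (-1) ^ S N * (cos v - cos_taylor N v)) /\
  (forall v, 0 <= v -> 0 <= (-1) ^ S N * (sin v - sin_taylor N v)).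
Proof.
  assert (Step : forall N, (forall v, 0 <= v -> 0 <= (-1) ^ S N * (cos v - cos_taylor N v)) ->
     forall v, 0 <= v -> 0 <= (-1) ^ S N * (sin v - sin_taylor N v)).
  { intros n H; apply nonneg_of_derive with (fun v => (-1) ^ S n * (cos v - cos_taylor n v)); [| |exact H].
    - rewrite sin_0, sin_taylor_0; ring.
    - intros v; apply is_derive_scal, (is_derive_minus (V := R_NormedModule)); [|apply is_derive_sin_taylor].
      apply is_derive_Reals, derivable_pt_lim_sin. }
  induction N as [|N [_ IH]]; split.
  - intros v _; unfold cos_taylor; simpl; pose proof (COS_bound v); lra.
  - apply Step; intros v _; unfold cos_taylor; simpl; pose proof (COS_bound v); lra.
  - apply nonneg_of_derive with (fun v => (-1) ^ S N * (sin v - sin_taylor N v)); [| |exact IH].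
    + rewrite cos_0, cos_taylor_0; ring.
    + intros v; replace ((-1) ^ S N * (sin v - sin_taylor N v))
        with ((-1) ^ S (S N) * (- sin v - - sin_taylor N v)) by (simpl; ring).
      apply is_derive_scal, (is_derive_minus (V := R_NormedModule)); [|apply is_derive_cos_taylor].
      apply is_derive_Reals, derivable_pt_lim_cos.
  - apply Step; apply nonneg_of_derive with (fun v => (-1) ^ S N * (sin v - sin_taylor N v)); [| |exact IH].
    + rewrite cos_0, cos_taylor_0; ring.
    + intros v; replace ((-1) ^ S N * (sin v - sin_taylor N v))
        with ((-1) ^ S (S N) * (- sin v - - sin_taylor N v)) by (simpl; ring).
      apply is_derive_scal, (is_derive_minus (V := R_NormedModule)); [|apply is_derive_cos_taylor].
      apply is_derive_Reals, derivable_pt_lim_cos.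
Qed.

Lemma cos_taylor_even N v : cos_taylor N (- v) = cos_taylor N v.
Proof.
  apply sum_eq; intros m _; f_equal; f_equal; rewrite !pow_mult; f_equal; ring.
Qed.

(** By the sign lemma at [N] and [N + 1], [cos v] lies between consecutive partial sums, so the
    error is at most the first omitted term. *)
Lemma cos_taylor_error N v :
  Rabs (cos v - cos_taylor N v) <= v ^ (2 * S N) / INR (fact (2 * S N)).
Proof.
  assert (P : forall v, 0 <= v -> Rabs (cos v - cos_taylor N v) <= v ^ (2 * S N) / INR (fact (2 * S N))).
  { clear v; intros v Hv; destruct (cos_sin_taylor_sign N) as [C0 _].
    destruct (cos_sin_taylor_sign (S N)) as [C1 _]; specialize (C0 v Hv); specialize (C1 v Hv).
    unfold cos_taylor in C1; rewrite tech5 in C1; fold (cos_taylor N v) in C1.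
    set (e := cos v - cos_taylor N v) in *.
    replace ((-1) ^ S (S N) * _) with
      (- ((-1) ^ S N * e) + ((-1) ^ S N * (-1) ^ S N) * (v ^ (2 * S N) / INR (fact (2 * S N)))) in C1
      by (unfold e, Rdiv; simpl pow; ring).
    rewrite <- Rpow_mult_distr in C1; replace (-1 * -1) with 1 in C1 by ring; rewrite pow1 in C1.
    replace (Rabs e) with (Rabs ((-1) ^ S N * e)) by (rewrite Rabs_mult, pow_1_abs; ring).
    rewrite Rabs_pos_eq by exact C0; lra. }
  destruct (Rle_dec 0 v) as [H|H]; [apply P, H|].
  rewrite <- (cos_taylor_even N v), <- cos_neg.
  replace (v ^ (2 * S N)) with ((- v) ^ (2 * S N)).
  - apply P; lra.
  - rewrite !pow_mult; f_equal; ring.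
Qed.

(* Taylor polynomials of the Fejer kernel [(1 - cos (T u)) / u^2]. *)
Definition fejer_poly (T : R) (N : nat) (u : R) : R :=
  sum_f_R0 (fun m => (-1) ^ m * T ^ (2 * S m) / INR (fact (2 * S m)) * u ^ (2 * m)) N.

Lemma fejer_poly_cos T N u : u ^ 2 * fejer_poly T N u = 1 - cos_taylor (S N) (T * u).
Proof.
  unfold fejer_poly, cos_taylor; rewrite (decomp_sum _ (S N)) by lia; simpl pred.
  rewrite scal_sum; replace ((-1) ^ 0 * (T * u) ^ (2 * 0) / INR (fact (2 * 0))) with 1 by (simpl; field).
  transitivity ((-1) * sum_f_R0 (fun i => (-1) ^ S i * (T * u) ^ (2 * S i) / INR (fact (2 * S i))) N); [|ring].
  rewrite scal_sum; apply sum_eq; intros i _.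
  rewrite Rpow_mult_distr; replace (u ^ (2 * S i)) with (u ^ (2 * i) * u ^ 2).
  - simpl ((-1) ^ S i); unfold Rdiv; ring.
  - rewrite <- pow_add; f_equal; lia.
Qed.

Lemma fejer_poly_0 T N : fejer_poly T N 0 = T ^ 2 / 2.
Proof.
  induction N as [|N IH]; unfold fejer_poly in *; [simpl; field|].
  rewrite tech5, IH, (pow_i (2 * S N)) by lia; ring.
Qed.

(** First omitted term of the series of [1 - cos (T u)], divided by [u^2]. Being an even power of
    [u], it can be controlled by moments. *)
Definition fejer_error (T : R) (N : nat) (u : R) : R :=
  T ^ (2 * S (S N)) * u ^ (2 * S N) / INR (fact (2 * S (S N))).

Lemma pow_even_nonneg x n : 0 <= x ^ (2 * n).
Proof. rewrite pow_mult; apply pow_le, pow2_ge_0. Qed.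

Lemma fejer_error_nonneg T N u : 0 <= fejer_error T N u.
Proof.
  apply Rdiv_le_0_compat; [apply Rmult_le_pos; apply pow_even_nonneg | apply INR_fact_lt_0].
Qed.

Lemma fejer_poly_approx T N u :
  Rabs (u ^ 2 * fejer_poly T N u - (1 - cos (T * u))) <= u ^ 2 * fejer_error T N u.
Proof.
  rewrite fejer_poly_cos; pose proof (cos_taylor_error (S N) (T * u)) as E.
  replace (1 - _ - _) with (cos (T * u) - cos_taylor (S N) (T * u)) by ring.
  eapply Rle_trans; [exact E|]; right; unfold fejer_error; rewrite Rpow_mult_distr.
  replace (u ^ (2 * S (S N))) with (u ^ 2 * u ^ (2 * S N)); [unfold Rdiv; ring|].
  rewrite <- pow_add; f_equal; lia.
Qed.

Lemma fejer_poly_nonneg T N u : - fejer_error T N u <= fejer_poly T N u.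
Proof.
  pose proof (fejer_error_nonneg T N u) as P.
  destruct (Req_dec u 0) as [-> |H]; [rewrite fejer_poly_0; pose proof (pow2_ge_0 T); lra|].
  pose proof (fejer_poly_approx T N u) as E; apply Rabs_le_between in E.
  pose proof (COS_bound (T * u)); pose proof (pow2_gt_0 u H).
  apply Rmult_le_reg_l with (u ^ 2); lra.
Qed.

(** With [v = T u] and [|v| <= 1], [1 - cos v >= v^2/2 - v^4/24 >= v^2/4]; this is the origin of
    [T^2 / 4]. *)
Lemma fejer_poly_near T N u : 0 < T -> Rabs u <= / T ->
  T ^ 2 / 4 - fejer_error T N u <= fejer_poly T N u.
Proof.
  intros HT Hu; pose proof (fejer_error_nonneg T N u) as P; pose proof (pow2_gt_0 T ltac:(lra)).
  destruct (Req_dec u 0) as [-> |H0]; [rewrite fejer_poly_0; lra|].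
  pose proof (fejer_poly_approx T N u) as E; apply Rabs_le_between in E.
  pose proof (pow2_gt_0 u H0).
  assert (Hv : (T * u) ^ 2 <= 1).
  { rewrite <- Rsqr_pow2, <- (Rsqr_1); apply Rsqr_le_abs_1.
    rewrite Rabs_mult, Rabs_R1, (Rabs_pos_eq T) by lra.
    apply Rmult_le_reg_l with (/ T); [apply Rinv_0_lt_compat; exact HT|].
    rewrite <- Rmult_assoc, Rinv_l by lra; lra. }
  pose proof (cos_taylor_error 1 (T * u)) as C; apply Rabs_le_between in C.
  assert (C1 : cos_taylor 1 (T * u) = 1 - (T * u) ^ 2 / 2) by (unfold cos_taylor; simpl; field).
  assert (C2 : (T * u) ^ (2 * 2) / INR (fact (2 * 2)) = (T * u) ^ 2 * (T * u) ^ 2 / 24).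
  { replace (INR (fact (2 * 2))) with 24 by (simpl; ring); rewrite <- pow_add; reflexivity. }
  rewrite C1, C2 in C; pose proof (pow2_ge_0 (T * u)) as Hv0.
  assert (C3 : (T * u) ^ 2 / 4 <= 1 - cos (T * u)) by nra.
  apply Rmult_le_reg_l with (u ^ 2); [assumption|].
  replace (u ^ 2 * (T ^ 2 / 4 - fejer_error T N u))
    with ((T * u) ^ 2 / 4 - u ^ 2 * fejer_error T N u) by field; lra.
Qed.

Lemma fejer_poly_far T N u r : 0 < r -> r <= Rabs u ->
  Rabs (fejer_poly T N u) <= 2 / r ^ 2 + fejer_error T N u.
Proof.
  intros Hr Hu; pose proof (fejer_error_nonneg T N u) as P.
  pose proof (fejer_poly_approx T N u) as E; apply Rabs_le_between in E.
  pose proof (COS_bound (T * u)).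
  assert (Hru : r ^ 2 <= u ^ 2).
  { rewrite <- (pow2_abs u); apply pow_incr; lra. }
  pose proof (pow_lt r 2 Hr).
  apply Rmult_le_reg_l with (u ^ 2); [lra|].
  rewrite <- (Rabs_pos_eq (u ^ 2)) at 1 by lra; rewrite <- Rabs_mult.
  assert (Q : 2 <= u ^ 2 * (2 / r ^ 2)).
  { replace (u ^ 2 * (2 / r ^ 2)) with (2 * (u ^ 2 / r ^ 2)) by (field; lra).
    assert (1 <= u ^ 2 / r ^ 2) by (apply Rle_div_r; lra); lra. }
  rewrite Rmult_plus_distr_l; apply Rabs_le; lra.
Qed.

(** Separates [u] from the centre by [(x + w)^p <= 2^p (x^p + w^p)]. The exponent is first raised to
    the odd [p = 2 M - 1], [M = N + 2], possible since [w >= 1]: this is the weight belonging to the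
    even moment [mu (2 M)]. *)
Lemma fejer_error_bound T N u c :
  fejer_error T N (u - c)
  <= (4 * T ^ 2) ^ S (S N) / INR (fact (2 * S (S N)))
     * (Rabs u ^ (2 * S N + 1) + (1 + Rabs c) ^ (2 * S N + 1)).
Proof.
  assert (Hu : Rabs (u - c) <= 1 + Rabs c + Rabs u).
  { pose proof (Rabs_triang u (- c)) as H; rewrite Rabs_Ropp in H; unfold Rminus; lra. }
  unfold fejer_error.
  set (w := 1 + Rabs c) in *; set (x := Rabs u) in *.
  assert (Hw : 1 <= w) by (unfold w; pose proof (Rabs_pos c); lra).
  assert (Hx : 0 <= x) by apply Rabs_pos.
  assert (E1 : (u - c) ^ (2 * S N) <= (x + w) ^ (2 * S N + 1)).
  { rewrite <- (Rabs_pos_eq ((u - c) ^ (2 * S N))) by apply pow_even_nonneg.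
    rewrite <- RPow_abs; apply Rle_trans with ((x + w) ^ (2 * S N)).
    - apply pow_incr; split; [apply Rabs_pos | lra].
    - apply Rle_pow; [lra | lia]. }
  assert (E2 : (x + w) ^ (2 * S N + 1) <= 4 ^ S (S N) * (x ^ (2 * S N + 1) + w ^ (2 * S N + 1))).
  { pose proof (Rmax_l x w); pose proof (Rmax_r x w).
    apply Rle_trans with ((2 * Rmax x w) ^ (2 * S N + 1)); [apply pow_incr; lra|].
    rewrite Rpow_mult_distr; apply Rmult_le_compat.
    - apply pow_le; lra.
    - apply pow_le; lra.
    - replace 4 with (2 ^ 2) by ring; rewrite <- pow_mult; apply Rle_pow; [lra | lia].
    - pose proof (pow_le x (2 * S N + 1) Hx); pose proof (pow_le w (2 * S N + 1) ltac:(lra)).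
      unfold Rmax; destruct (Rle_dec x w); lra. }
  rewrite Rpow_mult_distr, <- (pow_mult T 2 (S (S N))); unfold Rdiv.
  pose proof (Rinv_0_lt_compat _ (INR_fact_lt_0 (2 * S (S N)))); pose proof (pow_even_nonneg T (S (S N))) as PT.
  transitivity (/ INR (fact (2 * S (S N))) * (T ^ (2 * S (S N)) * (4 ^ S (S N) * (x ^ (2 * S N + 1) + w ^ (2 * S N + 1)))));
    [|right; ring].
  rewrite Rmult_comm; apply Rmult_le_compat_l; [lra|].
  apply Rmult_le_compat_l; [exact PT | lra].
Qed.

(** * Determinacy of the moment problem *)

Lemma improper_int0_RInt f l : improper_int0 f l ->
  (forall b, 0 <= b -> ex_RInt f 0 b) /\
  (forall eps, 0 < eps -> exists B, forall b, B <= b -> 0 <= b -> Rabs (RInt f 0 b - l) < eps).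
Proof.
  intros [H1 H2]; split.
  - intros b Hb; destruct (H1 b Hb) as [pr]; apply ex_RInt_Reals_1; exact pr.
  - intros eps He; destruct (H2 eps He) as [B HB]; exists B; intros b Hb Hb0.
    destruct (H1 b Hb0) as [pr]; rewrite (RInt_Reals _ _ _ pr); apply HB; lra.
Qed.

Lemma improper_int0_nonneg_le f l b : improper_int0 f l ->
  (forall x, 0 < x -> 0 <= f x) -> 0 <= b -> RInt f 0 b <= l.
Proof.
  intros H Hf Hb; apply improper_int0_RInt in H; destruct H as [H1 H2].
  apply Rnot_lt_le; intros Hlt; destruct (H2 (RInt f 0 b - l)) as [B HB]; [lra|].
  pose proof (Rmax_l B b); pose proof (Rmax_r B b).
  specialize (HB (Rmax B b) ltac:(lra) ltac:(lra)); apply Rabs_def2 in HB.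
  assert (E1 : ex_RInt f b (Rmax B b)).
  { apply (ex_RInt_Chasles_2 (V := R_CompleteNormedModule)) with 0; [lra | apply H1; lra]. }
  pose proof (RInt_Chasles (V := R_CompleteNormedModule) f 0 b (Rmax B b) (H1 b Hb) E1) as E.
  pose proof (RInt_ge_0 f b (Rmax B b) ltac:(lra) E1) as P.
  assert (P1 : 0 <= RInt f b (Rmax B b)) by (apply P; intros x Hx; apply Hf; lra).
  assert (E2 : RInt f 0 b + RInt f b (Rmax B b) = RInt f 0 (Rmax B b)) by exact E; lra.
Qed.

Lemma is_cdf_bounds F x : is_cdf F -> 0 <= F x <= 1.
Proof.
  intros [Mon [_ [Low High]]]; split; apply Rnot_lt_le; intros H.
  - destruct (Low (- F x)) as [M HM]; [lra|].
    specialize (HM (Rmin M x) (Rmin_l _ _)); pose proof (Mon (Rmin M x) x (Rmin_r _ _)).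
    rewrite Rabs_left in HM; lra.
  - destruct (High (F x - 1)) as [M HM]; [lra|].
    specialize (HM (Rmax M x) (Rle_ge _ _ (Rmax_l _ _))); pose proof (Mon x (Rmax M x) (Rmax_r _ _)).
    rewrite Rabs_pos_eq in HM; lra.
Qed.

Section Determinacy.

Variables (F G : R -> R) (mu : nat -> R).
Hypothesis F_cdf : is_cdf F.
Hypothesis G_cdf : is_cdf G.
Hypothesis F_mom : forall s, has_moment F s (mu s).
Hypothesis G_mom : forall s, has_moment G s (mu s).

Let D x := F x - G x.
Let H x := (1 - F x + F (- x)) + (1 - G x + G (- x)).

(** At [x] the difference is bounded by the two right tails, at [- x] by the two left ones. [H] is
    thus a majorant whose integrals are controlled by moments. *)
Lemma tails_dominate x : Rabs (D x) + Rabs (D (- x)) <= H x.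
Proof.
  unfold D, H; pose proof (is_cdf_bounds F x F_cdf); pose proof (is_cdf_bounds G x G_cdf).
  pose proof (is_cdf_bounds F (- x) F_cdf); pose proof (is_cdf_bounds G (- x) G_cdf).
  unfold Rabs; destruct (Rcase_abs _), (Rcase_abs _); lra.
Qed.

Lemma tails_nonneg x : 0 <= H x.
Proof.
  pose proof (tails_dominate x); pose proof (Rabs_pos (D x)); pose proof (Rabs_pos (D (- x))); lra.
Qed.

Lemma RInt_lin (f g : R -> R) (u v a b : R) : ex_RInt f a b -> ex_RInt g a b ->
  is_RInt (fun x => u * f x + v * g x) a b (u * RInt f a b + v * RInt g a b).
Proof.
  intros Hf Hg; apply (is_RInt_plus (V := R_NormedModule));
    apply (is_RInt_scal (V := R_NormedModule)); apply (RInt_correct (V := R_CompleteNormedModule)); assumption.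
Qed.

Lemma tail_moment_integrable m b : 0 <= b -> ex_RInt (fun x => x ^ m * H x) 0 b.
Proof.
  intros Hb; destruct (F_mom (S m)) as [[lF HF] _]; destruct (G_mom (S m)) as [[lG HG] _].
  apply improper_int0_RInt in HF; apply improper_int0_RInt in HG.
  destruct HF as [HF _]; destruct HG as [HG _].
  eapply ex_RInt_ext; [|eexists; apply (RInt_lin _ _ (/ INR (S m)) (/ INR (S m)) _ _ (HF b Hb) (HG b Hb))].
  intros x _; cbv beta; replace (S m - 1)%nat with m by lia; unfold H.
  match goal with |- ?u = ?v => change (@eq R u v) end.
  field; apply not_0_INR; lia.
Qed.

Lemma tails_integral_bounded : exists C0, 0 <= C0 /\ forall b, 0 <= b -> RInt H 0 b <= C0.
Proof.
  destruct (F_mom 1) as [[lF HF] _]; destruct (G_mom 1) as [[lG HG] _].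
  exists (Rabs lF + Rabs lG); split; [pose proof (Rabs_pos lF); pose proof (Rabs_pos lG); lra|].
  intros b Hb; pose proof (improper_int0_RInt _ _ HF) as [EF _]; pose proof (improper_int0_RInt _ _ HG) as [EG _].
  assert (PF : RInt (fun x => INR 1 * x ^ (1 - 1) * (1 - F x + F (- x))) 0 b <= lF).
  { apply improper_int0_nonneg_le; [exact HF| |exact Hb]; intros x Hx; simpl; rewrite !Rmult_1_l.
    pose proof (is_cdf_bounds F x F_cdf); pose proof (is_cdf_bounds F (- x) F_cdf); lra. }
  assert (PG : RInt (fun x => INR 1 * x ^ (1 - 1) * (1 - G x + G (- x))) 0 b <= lG).
  { apply improper_int0_nonneg_le; [exact HG| |exact Hb]; intros x Hx; simpl; rewrite !Rmult_1_l.
    pose proof (is_cdf_bounds G x G_cdf); pose proof (is_cdf_bounds G (- x) G_cdf); lra. }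
  pose proof (RInt_lin _ _ 1 1 _ _ (EF b Hb) (EG b Hb)) as I.
  apply (is_RInt_unique (V := R_CompleteNormedModule)) in I.
  assert (E : RInt H 0 b = 1 * RInt (fun x => INR 1 * x ^ (1 - 1) * (1 - F x + F (- x))) 0 b
     + 1 * RInt (fun x => INR 1 * x ^ (1 - 1) * (1 - G x + G (- x))) 0 b).
  { rewrite <- I; apply RInt_ext; intros x _; unfold H; simpl.
    match goal with |- ?u = ?v => change (@eq R u v) end; ring. }
  rewrite E; pose proof (Rle_abs lF); pose proof (Rle_abs lG); lra.
Qed.

(** For an even order the signed moment is the absolute one, so [mu] itself bounds the two-sided
    tails; the factor [2 M >= 1] is given away. *)
Lemma tail_moment_bounded M b : (1 <= M)%nat -> 0 <= b ->
  RInt (fun x => x ^ (2 * M - 1) * H x) 0 b <= 2 * mu (2 * M).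
Proof.
  intros HM Hb; pose proof (F_mom (2 * M)) as MF; pose proof (G_mom (2 * M)) as MG.
  remember (2 * M)%nat as s eqn:Es; destruct s as [|s]; [lia|].
  destruct MF as [_ HF]; destruct MG as [_ HG].
  assert (Hsgn : (-1) ^ S s = 1) by (rewrite Es, pow_mult; replace ((-1) ^ 2) with 1 by ring; apply pow1).
  rewrite Hsgn in HF, HG.
  pose proof (improper_int0_RInt _ _ HF) as [EF _]; pose proof (improper_int0_RInt _ _ HG) as [EG _].
  assert (Hs1 : 1 <= INR (S s)) by (rewrite S_INR; pose proof (pos_INR s); lra).
  assert (Pos : forall K : R -> R, is_cdf K -> forall x, 0 < x ->
            0 <= INR (S s) * x ^ (S s - 1) * (1 - K x + 1 * K (- x))).
  { intros K HK x Hx; pose proof (is_cdf_bounds K x HK); pose proof (is_cdf_bounds K (- x) HK).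
    apply Rmult_le_pos; [|lra]; apply Rmult_le_pos; [lra | apply pow_le; lra]. }
  pose proof (improper_int0_nonneg_le _ _ b HF (Pos F F_cdf) Hb) as PF.
  pose proof (improper_int0_nonneg_le _ _ b HG (Pos G G_cdf) Hb) as PG.
  pose proof (RInt_lin _ _ 1 1 _ _ (EF b Hb) (EG b Hb)) as I.
  apply Rle_trans with (1 * RInt (fun x => INR (S s) * x ^ (S s - 1) * (1 - F x + 1 * F (- x))) 0 b
     + 1 * RInt (fun x => INR (S s) * x ^ (S s - 1) * (1 - G x + 1 * G (- x))) 0 b); [|lra].
  rewrite <- (is_RInt_unique _ _ _ _ I); apply RInt_le.
  - exact Hb.
  - apply tail_moment_integrable; exact Hb.
  - eexists; exact I.
  - intros x Hx; pose proof (tails_nonneg x) as Hn; pose proof (pow_le x (S s - 1) ltac:(lra)) as Hp.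
    transitivity (INR (S s) * (x ^ (S s - 1) * H x)); [|right; unfold H; ring].
    rewrite <- (Rmult_1_l (x ^ (S s - 1) * H x)) at 1.
    apply Rmult_le_compat_r; [apply Rmult_le_pos; assumption | exact Hs1].
Qed.

(* [fold p] on the half-line integrates like [p * D] on the whole line. *)
Let fold (p : R -> R) (x : R) := p x * D x + p (- x) * D (- x).

(** The integral of [p * D] over the line is 0, taken as a limit over symmetric intervals. *)
Definition annihilates (p : R -> R) : Prop :=
  (forall b, 0 <= b -> ex_RInt (fold p) 0 b) /\
  (forall eps, 0 < eps -> exists B, forall b, B <= b -> 0 <= b -> Rabs (RInt (fold p) 0 b) < eps).

Lemma annihilates_ext p q : (forall x, p x = q x) -> annihilates p -> annihilates q.
Proof.
  intros E [H1 H2].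
  assert (Ex : forall x, fold p x = fold q x) by (intros x; unfold fold; rewrite !E; reflexivity).
  split.
  - intros b Hb; eapply ex_RInt_ext; [|apply H1, Hb]; intros x _; apply Ex.
  - intros eps He; destruct (H2 eps He) as [B HB]; exists B; intros b Hb Hb0.
    rewrite <- (RInt_ext (fold p) (fold q)) by (intros x _; apply Ex); apply HB; assumption.
Qed.

Lemma annihilates_lin p q u v : annihilates p -> annihilates q ->
  annihilates (fun x => u * p x + v * q x).
Proof.
  intros [P1 P2] [Q1 Q2].
  assert (I : forall b, 0 <= b -> is_RInt (fold (fun x => u * p x + v * q x)) 0 b
     (u * RInt (fold p) 0 b + v * RInt (fold q) 0 b)).
  { intros b Hb; eapply is_RInt_ext; [|apply (RInt_lin _ _ u v _ _ (P1 b Hb) (Q1 b Hb))].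
    intros x _; unfold fold; match goal with |- ?u = ?v => change (@eq R u v) end; ring. }
  split; [intros b Hb; eexists; apply I, Hb|].
  intros eps He; set (w := Rabs u + Rabs v + 1).
  pose proof (Rabs_pos u) as Hu; pose proof (Rabs_pos v) as Hv.
  destruct (P2 (eps / w)) as [B1 H1]; [apply Rdiv_lt_0_compat; unfold w; lra|].
  destruct (Q2 (eps / w)) as [B2 H2]; [apply Rdiv_lt_0_compat; unfold w; lra|].
  exists (Rmax B1 B2); intros b Hb Hb0; pose proof (Rmax_l B1 B2); pose proof (Rmax_r B1 B2).
  rewrite (is_RInt_unique _ _ _ _ (I b Hb0)).
  specialize (H1 b ltac:(lra) Hb0); specialize (H2 b ltac:(lra) Hb0).
  eapply Rle_lt_trans; [apply Rabs_triang|]; rewrite !Rabs_mult.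
  apply Rle_lt_trans with (Rabs u * (eps / w) + Rabs v * (eps / w)).
  - apply Rplus_le_compat; apply Rmult_le_compat_l; lra.
  - assert (0 < eps / w) by (apply Rdiv_lt_0_compat; unfold w; lra).
    replace eps with (w * (eps / w)) at 3 by (field; unfold w; lra); unfold w at 3; lra.
Qed.

(** The tail integrals for the moments of order [m + 1] of [F] and [G] have the same limit. In their
    difference the constant 1 cancels, leaving [m + 1] times the folded integral of [x^m * D]. *)
Lemma annihilates_pow m : annihilates (fun x => x ^ m).
Proof.
  destruct (F_mom (S m)) as [_ HF]; destruct (G_mom (S m)) as [_ HG].
  apply improper_int0_RInt in HF; apply improper_int0_RInt in HG.
  destruct HF as [F1 F2]; destruct HG as [G1 G2]; set (s := INR (S m)) in *.
  assert (Hs : 0 < s) by (apply lt_0_INR; lia).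
  assert (I : forall b, 0 <= b -> is_RInt (fold (fun x => x ^ m)) 0 b
     ((- / s) * RInt (fun x => s * x ^ (S m - 1) * (1 - F x + (-1) ^ S m * F (- x))) 0 b
      + / s * RInt (fun x => s * x ^ (S m - 1) * (1 - G x + (-1) ^ S m * G (- x))) 0 b)).
  { intros b Hb; eapply is_RInt_ext; [|apply (RInt_lin _ _ (- / s) (/ s) _ _ (F1 b Hb) (G1 b Hb))].
    intros x _; unfold fold, D; match goal with |- ?u = ?v => change (@eq R u v) end.
    replace (S m - 1)%nat with m by lia.
    replace ((- x) ^ m) with ((-1) ^ m * x ^ m) by (rewrite <- Rpow_mult_distr; f_equal; ring).
    simpl pow; field; lra. }
  split; [intros b Hb; eexists; apply I, Hb|].
  intros eps He; assert (Hes : 0 < eps * s / 2) by nra.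
  destruct (F2 _ Hes) as [B1 H1]; destruct (G2 _ Hes) as [B2 H2].
  exists (Rmax B1 B2); intros b Hb Hb0; pose proof (Rmax_l B1 B2); pose proof (Rmax_r B1 B2).
  rewrite (is_RInt_unique _ _ _ _ (I b Hb0)).
  specialize (H1 b ltac:(lra) Hb0); specialize (H2 b ltac:(lra) Hb0).
  revert H1 H2; match goal with |- _ -> _ -> Rabs (- / s * ?u0 + / s * ?v0) < _ =>
    generalize u0 v0 end; intros u v H1 H2.
  replace (- / s * u + / s * v) with ((v - mu (S m) - (u - mu (S m))) / s) by (field; lra).
  apply Rabs_def2 in H1; apply Rabs_def2 in H2.
  apply Rabs_def1; [apply Rlt_div_l | apply Rlt_div_r]; lra.
Qed.

(** The extra factor [x^m] absorbs the [x] of [(x - c)^(n+1) = x (x - c)^n - c (x - c)^n]. *)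
Lemma annihilates_shifted_pow c n m : annihilates (fun x => x ^ m * (x - c) ^ n).
Proof.
  revert m; induction n as [|n IH]; intros m.
  - eapply annihilates_ext; [|apply (annihilates_pow m)]; intros x; simpl; ring.
  - eapply annihilates_ext; [|apply (annihilates_lin _ _ 1 (- c) (IH (S m)) (IH m))].
    intros x; simpl; ring.
Qed.

Lemma annihilates_fejer T N c : annihilates (fun x => fejer_poly T N (x - c)).
Proof.
  assert (M : forall u m, annihilates (fun x => u * (x - c) ^ m)).
  { intros u m; eapply annihilates_ext;
      [|apply (annihilates_lin _ _ u 0 (annihilates_shifted_pow c m 0) (annihilates_pow 0))].
    intros x; simpl; ring. }
  induction N as [|N IH]; unfold fejer_poly in *; [apply M|].
  eapply annihilates_ext; [|apply (annihilates_lin _ _ 1 1 IH (M ((-1) ^ S N * T ^ (2 * S (S N)) / INR (fact (2 * S (S N)))) (2 * S N)%nat))].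
  intros x; rewrite tech5; ring.
Qed.

(** The two indicators cut out the window [|c| - 1/T <= x < |c| + 1/T], where the kernel gains
    [dl T^2 / 4]. Elsewhere within [r] of [c], [D] is positive and the kernel nonnegative up to its
    Taylor error; farther away the kernel is at most [2 / r^2] up to that error. All losses are
    charged to [H x]. *)
Lemma fejer_lower_bound T N c r dl x :
  0 < T -> 0 < r -> / T <= r -> r <= Rabs c -> 0 < dl ->
  (forall z, Rabs (z - c) <= r -> dl <= D z) -> 0 < x ->
  dl * (T ^ 2 / 4) * (indic (if Rle_dec (Rabs c + / T) x then false else true)
                      - indic (if Rle_dec (Rabs c - / T) x then false else true))
  - (2 / r ^ 2 + (4 * T ^ 2) ^ S (S N) / INR (fact (2 * S (S N)))
       * (x ^ (2 * S N + 1) + (1 + Rabs c) ^ (2 * S N + 1))) * H x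
  <= fold (fun x => fejer_poly T N (x - c)) x.
Proof.
  intros HT Hr HTr Hrc Hdl HD Hx.
  set (E := (4 * T ^ 2) ^ S (S N) / _ * _).
  assert (HTi : 0 < / T) by (apply Rinv_0_lt_compat; exact HT).
  assert (HE : forall z, Rabs z = x -> fejer_error T N (z - c) <= E).
  { intros z Hz; pose proof (fejer_error_bound T N z c) as B; rewrite Hz in B; exact B. }
  assert (Hr2 : 0 < 2 / r ^ 2) by (apply Rdiv_lt_0_compat; [lra | apply pow_lt; exact Hr]).
  assert (E0 : 0 <= E).
  { eapply Rle_trans; [apply (fejer_error_nonneg T N (x - c)) | apply HE; apply Rabs_pos_eq; lra]. }
  assert (T2 : 0 < T ^ 2) by (apply pow_lt; exact HT).
  assert (Any : forall z, Rabs z = x -> - (2 / r ^ 2 + E) * Rabs (D z) <= fejer_poly T N (z - c) * D z).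
  { intros z Hz; pose proof (fejer_error_nonneg T N (z - c)); specialize (HE z Hz).
    pose proof (Rabs_pos (D z)).
    destruct (Rle_dec (Rabs (z - c)) r) as [Hn|Hf].
    - specialize (HD z Hn); pose proof (fejer_poly_nonneg T N (z - c)).
      rewrite Rabs_pos_eq by lra; apply Rmult_le_compat_r; lra.
    - pose proof (fejer_poly_far T N (z - c) r Hr ltac:(lra)) as Far.
      replace (- (2 / r ^ 2 + E) * Rabs (D z)) with (- ((2 / r ^ 2 + E) * Rabs (D z))) by ring.
      apply Ropp_le_cancel; rewrite Ropp_involutive.
      eapply Rle_trans; [apply Rle_abs|]; rewrite Rabs_Ropp, Rabs_mult.
      apply Rmult_le_compat_r; lra. }
  assert (Near : forall z, Rabs z = x -> Rabs (z - c) <= / T ->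
     dl * (T ^ 2 / 4) - (2 / r ^ 2 + E) * Rabs (D z) <= fejer_poly T N (z - c) * D z).
  { intros z Hz Hn; pose proof (fejer_error_nonneg T N (z - c)); specialize (HE z Hz).
    specialize (HD z ltac:(lra)); rewrite Rabs_pos_eq by lra.
    pose proof (fejer_poly_near T N (z - c) HT Hn) as P.
    apply Rle_trans with ((T ^ 2 / 4 - fejer_error T N (z - c)) * D z);
      [|apply Rmult_le_compat_r; lra].
    assert (dl * (T ^ 2 / 4) <= T ^ 2 / 4 * D z) by nra.
    assert (fejer_error T N (z - c) * D z <= (2 / r ^ 2 + E) * D z) by (apply Rmult_le_compat_r; lra).
    lra. }
  assert (Ax : Rabs x = x) by (apply Rabs_pos_eq; lra).
  assert (Anx : Rabs (- x) = x) by (rewrite Rabs_Ropp; exact Ax).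
  pose proof (Any x Ax) as A1; pose proof (Any (- x) Anx) as A2.
  pose proof (tails_dominate x) as TD.
  assert (TD' : (2 / r ^ 2 + E) * (Rabs (D x) + Rabs (D (- x))) <= (2 / r ^ 2 + E) * H x)
    by (apply Rmult_le_compat_l; lra).
  unfold fold.
  assert (P4 : 0 < dl * (T ^ 2 / 4)) by nra.
  destruct (Rle_dec (Rabs c + / T) x) as [L1|L1], (Rle_dec (Rabs c - / T) x) as [L2|L2];
    unfold indic; try lra.
  (* In the window the point near [c] is [x] or [- x] according to the sign of [c]; the opposite
     point is covered by [Any]. *)
  destruct (Rle_dec 0 c) as [Hc|Hc].
  - rewrite (Rabs_pos_eq c) in * by exact Hc.
    pose proof (Near x Ax ltac:(apply Rabs_le; lra)); lra.
  - rewrite (Rabs_left c) in * by lra.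
    pose proof (Near (- x) Anx ltac:(apply Rabs_le; lra)); lra.
Qed.

(** [A] stands for [4 T^2] with [T] arbitrarily large, hence all [A]; smallness along an unbounded
    set of orders is enough, since the Taylor degree is free. *)
Hypothesis growth : forall A eps n0, 0 < A -> 0 < eps ->
  exists M, (n0 <= M)%nat /\ A ^ M * mu (2 * M) / INR (fact (2 * M)) < eps.

(** Integrated over a window of width [2 / T], the gain is [dl T / 2], while the far loss stays
    below [2 C0 / r^2] and the Taylor errors are made small by the degree. For large [T] this
    contradicts annihilation. *)
Lemma not_separated c r dl : 0 < r -> r <= Rabs c -> 0 < dl ->
  (forall z, Rabs (z - c) <= r -> dl <= D z) -> False.
Proof.
  intros Hr Hrc Hdl HD; destruct tails_integral_bounded as [C0 [HC0 HC]].
  assert (Hr2 : 0 < 2 / r ^ 2) by (apply Rdiv_lt_0_compat; [lra | apply pow_lt; exact Hr]).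
  (* The 3 covers the annihilated integral, the constant part of the Taylor error and its moment
     part, each at most 1. *)
  set (T := Rmax (/ r) ((2 / r ^ 2 * C0 + 3) * 2 / dl)).
  assert (HTr : / T <= r).
  { rewrite <- (Rinv_inv r); apply Rinv_le_contravar; [apply Rinv_0_lt_compat; exact Hr | apply Rmax_l]. }
  assert (HT : 0 < T) by (eapply Rlt_le_trans; [apply (Rinv_0_lt_compat r Hr) | apply Rmax_l]).
  assert (HTd : 2 / r ^ 2 * C0 + 3 <= dl * T / 2).
  { assert (Q : (2 / r ^ 2 * C0 + 3) * 2 / dl <= T) by apply Rmax_r.
    apply Rle_div_l in Q; lra. }
  set (w := 1 + Rabs c); assert (Hw : 1 <= w) by (unfold w; pose proof (Rabs_pos c); lra).
  set (A := 4 * T ^ 2); assert (HA : 0 < A) by (unfold A; pose proof (pow_lt T 2 HT); lra).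
  pose proof (cv_speed_pow_fact (A * w ^ 2)) as Cv.
  destruct (Cv (/ (C0 + 1))) as [n1 Hn1]; [apply Rinv_0_lt_compat; lra|].
  (* [M >= 2] allows [M = N + 2], and [M >= n1] makes the constant part of the Taylor error small by
     [(A w^2)^M / M!]. *)
  destruct (growth A (/ 2) (max 2 n1)) as [M [HM Hg]]; [exact HA | lra|].
  destruct M as [|[|N]]; try lia.
  set (e := A ^ S (S N) / INR (fact (2 * S (S N)))) in *.
  assert (He : 0 < e) by (apply Rdiv_lt_0_compat; [apply pow_lt; exact HA | apply INR_fact_lt_0]).
  assert (Hg2 : e * (2 * mu (2 * S (S N))) <= 1).
  { replace (e * (2 * mu (2 * S (S N)))) with (2 * (A ^ S (S N) * mu (2 * S (S N)) / INR (fact (2 * S (S N)))))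
      by (unfold e, Rdiv; ring); lra. }
  assert (He2 : e * w ^ (2 * S N + 1) * C0 <= 1).
  { specialize (Hn1 (S (S N)) ltac:(lia)); unfold R_dist in Hn1; rewrite Rminus_0_r in Hn1.
    assert (Q : e * w ^ (2 * S N + 1) <= (A * w ^ 2) ^ S (S N) / INR (fact (S (S N)))).
    { rewrite Rpow_mult_distr, <- (pow_mult w 2 (S (S N))); unfold e, Rdiv.
      transitivity (A ^ S (S N) * w ^ (2 * S N + 1) * / INR (fact (2 * S (S N)))); [right; ring|].
      pose proof (pow_lt A (S (S N)) HA); pose proof (pow_lt w (2 * S N + 1) ltac:(lra)).
      apply Rmult_le_compat; [nra | left; apply Rinv_0_lt_compat, INR_fact_lt_0 | |].
      - apply Rmult_le_compat_l; [lra|]; apply Rle_pow; [lra | lia].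
      - apply Rinv_le_contravar; [apply INR_fact_lt_0|]; apply le_INR, fact_le; lia. }
    pose proof (Rle_abs ((A * w ^ 2) ^ S (S N) / INR (fact (S (S N))))).
    assert (Q2 : e * w ^ (2 * S N + 1) <= / (C0 + 1)) by lra.
    apply Rle_trans with (/ (C0 + 1) * C0); [apply Rmult_le_compat_r; lra|].
    rewrite Rmult_comm; apply Rle_div_l; lra. }
  destruct (annihilates_fejer T N c) as [A1 A2]; destruct (A2 1 Rlt_0_1) as [B HB].
  set (b := Rmax B (Rabs c + r)); pose proof (Rmax_l B (Rabs c + r)); pose proof (Rmax_r B (Rabs c + r)).
  assert (Hb : 0 <= b) by (unfold b; lra); specialize (HB b ltac:(unfold b; lra) Hb).
  assert (HTi : 0 < / T) by (apply Rinv_0_lt_compat; exact HT).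
  assert (Z : forall z, 0 <= z <= b -> is_RInt (fun x => indic (if Rle_dec z x then false else true)) 0 b z).
  { intros z Hz; pose proof (is_RInt_truncated_pow 0 z b ltac:(lra) Hb) as I.
    rewrite Rmin_left, pow_1 in I by lra; eapply is_RInt_ext; [|exact I].
    intros x _; match goal with |- ?u = ?v => change (@eq R u v) end; simpl; ring. }
  assert (I1 := Z (Rabs c + / T) ltac:(unfold b; lra)).
  assert (I2 := Z (Rabs c - / T) ltac:(unfold b; lra)).
  assert (HI0 : ex_RInt H 0 b).
  { eapply ex_RInt_ext; [|apply (tail_moment_integrable 0 b Hb)].
    intros x _; match goal with |- ?u = ?v => change (@eq R u v) end; simpl; ring. }
  pose proof (tail_moment_integrable (2 * S N + 1) b Hb) as HI1.
  pose proof (RInt_lin _ _ 1 (-1) _ _ (ex_intro _ _ I1) (ex_intro _ _ I2)) as J1.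
  pose proof (RInt_lin _ _ (- (2 / r ^ 2 + e * w ^ (2 * S N + 1))) (- e) _ _ HI0 HI1) as J2.
  cbv beta in J1, J2; pose proof (RInt_lin _ _ (dl * (T ^ 2 / 4)) 1 _ _ (ex_intro _ _ J1) (ex_intro _ _ J2)) as J.
  cbv beta in J; rewrite (is_RInt_unique _ _ _ _ J1), (is_RInt_unique _ _ _ _ J2),
    (is_RInt_unique _ _ _ _ I1), (is_RInt_unique _ _ _ _ I2) in J.
  assert (L : RInt (fun x => dl * (T ^ 2 / 4) * (1 * indic (if Rle_dec (Rabs c + / T) x then false else true)
      + -1 * indic (if Rle_dec (Rabs c - / T) x then false else true))
      + 1 * (- (2 / r ^ 2 + e * w ^ (2 * S N + 1)) * H x + - e * (x ^ (2 * S N + 1) * H x))) 0 b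
    <= RInt (fold (fun x => fejer_poly T N (x - c))) 0 b).
  { apply RInt_le; [exact Hb | eexists; exact J | apply A1, Hb|].
    intros x Hx; eapply Rle_trans; [|apply (fejer_lower_bound T N c r dl x); auto; lra].
    right; fold A e w; fold (A ^ S (S N)); unfold e, w, A; ring. }
  rewrite (is_RInt_unique _ _ _ _ J) in L.
  pose proof (HC b Hb) as K0; pose proof (tail_moment_bounded (S (S N)) b ltac:(lia) Hb) as K1.
  replace (2 * S (S N) - 1)%nat with (2 * S N + 1)%nat in K1 by lia.
  set (R0 := RInt H 0 b) in *; set (R1 := RInt (fun x => x ^ (2 * S N + 1) * H x) 0 b) in *.
  assert (Q1 : dl * (T ^ 2 / 4) * (1 * (Rabs c + / T) + -1 * (Rabs c - / T)) = dl * T / 2) by (field; lra).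
  assert (Q2 : 2 / r ^ 2 * R0 <= 2 / r ^ 2 * C0) by (apply Rmult_le_compat_l; lra).
  assert (Q3 : e * w ^ (2 * S N + 1) * R0 <= e * w ^ (2 * S N + 1) * C0).
  { apply Rmult_le_compat_l; [|lra]; apply Rmult_le_pos; [lra | apply pow_le; lra]. }
  assert (Q4 : e * R1 <= e * (2 * mu (2 * S (S N)))) by (apply Rmult_le_compat_l; lra).
  rewrite Q1 in L; apply Rabs_def2 in HB; lra.
Qed.

(** If [F x] exceeds [G x] by [3 dl], right continuity of both keeps [D >= dl] on an interval to the
    right of [x], which [not_separated] excludes. The centre is moved to the right of [x] so that a
    two-sided neighbourhood fits. *)
Lemma cdf_le_of_moments x : F x <= G x.
Proof.
  apply Rnot_lt_le; intros Hlt; set (dl := (F x - G x) / 3); assert (Hdl : 0 < dl) by (unfold dl; lra).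
  destruct F_cdf as [_ [FR _]]; destruct G_cdf as [_ [GR _]].
  destruct (FR x dl Hdl) as [d1 [Hd1 H1]]; destruct (GR x dl Hdl) as [d2 [Hd2 H2]].
  assert (Sep : forall z, x <= z < x + Rmin d1 d2 -> dl <= D z).
  { intros z Hz; pose proof (Rmin_l d1 d2); pose proof (Rmin_r d1 d2).
    specialize (H1 z ltac:(lra)); specialize (H2 z ltac:(lra)).
    apply Rabs_def2 in H1; apply Rabs_def2 in H2; unfold D, dl in *; lra. }
  assert (Hd : 0 < Rmin d1 d2) by (apply Rmin_pos; lra); set (d := Rmin d1 d2) in *.
  destruct (Rle_dec 0 x) as [Hx|Hx].
  - apply (not_separated (x + d / 3) (d / 3) dl); try lra.
    + rewrite Rabs_pos_eq; lra.
    + intros z Hz; apply Rabs_le_between in Hz; apply Sep; lra.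
  (* For negative [x] the interval is cut at 0, so that its centre stays at least its radius away
     from 0. *)
  - set (d' := Rmin d (- x)); pose proof (Rmin_l d (- x)); pose proof (Rmin_r d (- x)).
    assert (Hd' : 0 < d') by (apply Rmin_pos; lra).
    apply (not_separated (x + d' / 3) (d' / 3) dl); try lra.
    + unfold d' in *; rewrite Rabs_left; lra.
    + intros z Hz; apply Rabs_le_between in Hz; apply Sep; unfold d' in *; lra.
Qed.

End Determinacy.

(** * Growth of the limit moments, and the fixed-node law *)

Lemma fact_le_rising a p : 1 <= a -> INR (fact p) <= rising a p.
Proof.
  intros Ha; induction p as [|p IH]; [simpl; lra|].
  change (fact (S p)) with (S p * fact p)%nat; rewrite mult_INR, S_INR; simpl.
  rewrite Rmult_comm; pose proof (pos_INR p); pose proof (INR_fact_lt_0 p).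
  apply Rmult_le_compat; lra.
Qed.

Definition limit_moment (k j s : nat) : R :=
  INR (fact s) * Gamma (INR j + 1 / (INR k + 1))
  / Gamma (INR j + 1 + INR k * (INR s - 1) / (INR k + 1)).

Lemma limit_moment_alpha k j s : limit_moment k j s =
  INR (fact s) * Gamma (INR j + 1 - alpha k) / Gamma (INR j + 1 - alpha k + alpha k * INR s).
Proof.
  unfold limit_moment, alpha; pose proof (pos_INR k).
  replace (INR j + 1 / (INR k + 1)) with (INR j + 1 - INR k / (INR k + 1)) by (field; lra).
  replace (INR j + 1 + INR k * (INR s - 1) / (INR k + 1))
    with (INR j + 1 - INR k / (INR k + 1) + INR k / (INR k + 1) * INR s) by (field; lra).
  reflexivity.
Qed.

(** The [(2 M)!] of the moment cancels, leaving [A^M Gamma a / Gamma (a + 2 alpha M)]. For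
    [M = (k + 1) r] this is [(A^(k+1))^r / rising a (2 k r)], at most [(A^(k+1))^r / r!]. *)
Lemma limit_moment_growth k j : (1 <= k)%nat -> (1 <= j)%nat ->
  forall A eps n0, 0 < A -> 0 < eps ->
  exists M, (n0 <= M)%nat /\ A ^ M * limit_moment k j (2 * M) / INR (fact (2 * M)) < eps.
Proof.
  intros Hk Hj A eps n0 HA He; pose proof (alpha_bounds k Hk) as Hal.
  set (a := INR j + 1 - alpha k).
  assert (Ha : 1 <= a) by (apply le_INR in Hj; simpl in Hj; unfold a; lra).
  destruct (cv_speed_pow_fact (A ^ (k + 1)) eps He) as [r0 Hr]; set (r := max r0 n0).
  (* For these indices [alpha k * INR (2 * M)] is an integer. *)
  exists ((k + 1) * r)%nat; split; [nia|].
  specialize (Hr r ltac:(lia)); unfold R_dist in Hr; rewrite Rminus_0_r in Hr.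
  rewrite Rabs_pos_eq in Hr
    by (apply Rdiv_le_0_compat; [apply pow_le, pow_le; lra | apply INR_fact_lt_0]).
  eapply Rle_lt_trans; [|exact Hr].
  rewrite limit_moment_alpha; fold a.
  replace (alpha k * INR (2 * ((k + 1) * r))) with (INR (2 * (k * r)))
    by (unfold alpha; rewrite !mult_INR, plus_INR; simpl (INR 1); pose proof (pos_INR k); field; lra).
  rewrite Gamma_add_nat by lra; rewrite <- pow_mult.
  pose proof (Gamma_pos a ltac:(lra)); pose proof (rising_pos a (2 * (k * r)) ltac:(lra)).
  pose proof (INR_fact_lt_0 (2 * ((k + 1) * r))) as Pf.
  replace (_ / INR (fact (2 * ((k + 1) * r)))) with (A ^ ((k + 1) * r) * / rising a (2 * (k * r)))
    by (field; lra).
  apply Rmult_le_compat_l; [apply pow_le; lra|].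
  apply Rinv_le_contravar; [apply INR_fact_lt_0|].
  eapply Rle_trans; [|apply fact_le_rising; exact Ha].
  apply le_INR, fact_le; nia.
Qed.

Lemma fixed_index k j : (1 <= k)%nat -> (1 <= j)%nat ->
  exists F : R -> R,
    is_cdf F /\
    conv_dist (fun n => cdf_Y k n j (Rpower (INR n) (- alpha k))) F /\
    (forall s, has_moment F s (limit_moment k j s)) /\
    (forall G : R -> R, is_cdf G -> (forall s, has_moment G s (limit_moment k j s)) ->
       forall x, G x = F x).
Proof.
  intros Hk Hj; pose proof (alpha_bounds k Hk) as Hal.
  destruct (fixed_index_limit k j Hk Hj) as [surv [Hcont Hlim]].
  set (c := fun n => Rpower (INR n) (- alpha k)) in *.
  assert (Hc : forall n, 0 < c n) by (intros n; apply Rpower_pos).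
  assert (Hmu : forall s, is_lim_seq (fun n => expect k n j (fun d => (c n * INR d) ^ s)) (limit_moment k j s)).
  { intros s; rewrite limit_moment_alpha; apply scaled_moment_cv; assumption. }
  assert (Hcdf : is_cdf (limit_cdf surv)).
  { exact (limit_cdf_is_cdf k j c surv (limit_moment k j) Hc Hcont Hlim Hmu). }
  assert (Hmom : forall s, has_moment (limit_cdf surv) s (limit_moment k j s)).
  { intros s; apply (limit_cdf_moment k j c surv (limit_moment k j) Hc Hcont Hlim Hmu).
    intros ->; rewrite limit_moment_alpha; simpl INR; rewrite Rmult_0_r, Rplus_0_r.
    apply le_INR in Hj; simpl in Hj; pose proof (Gamma_pos (INR j + 1 - alpha k) ltac:(lra)).
    field; lra. }
  exists (limit_cdf surv); split; [exact Hcdf|]; split; [|split; [exact Hmom|]].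
  - exact (limit_cdf_cv k j c surv Hc Hlim).
  - intros G HG HGm x; pose proof (limit_moment_growth k j Hk Hj) as Gr.
    apply Rle_antisym; eapply cdf_le_of_moments; eassumption.
Qed.

Theorem theorem1 (k : nat) (Hk : (1 <= k)%nat) :
  (* exact distribution *)
  (forall n j m : nat, (1 <= j)%nat -> (j <= n)%nat ->
     prob_Y k n j m =
       Rbinom (INR j - INR k / (INR k + 1)) j
       / (Rbinom (INR n - INR k / (INR k + 1)) n * Rbinom (INR n) j)
       * sum_f_R0 (fun l => C m l * (-1) ^ l
                     * Rbinom (INR n - INR k * (2 + INR l) / (INR k + 1)) (n - j)) m) /\
  (* (i) fixed j *)
  (forall j : nat, (1 <= j)%nat ->
     exists F : R -> R,
       is_cdf F /\
       conv_dist (fun n => cdf_Y k n j (Rpower (INR n) (- (INR k / (INR k + 1))))) F /\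
       (forall s : nat, has_moment F s
          (INR (fact s) * Gamma (INR j + 1 / (INR k + 1))
           / Gamma (INR j + 1 + INR k * (INR s - 1) / (INR k + 1)))) /\
       (forall G : R -> R, is_cdf G ->
          (forall s : nat, has_moment G s
             (INR (fact s) * Gamma (INR j + 1 / (INR k + 1))
              / Gamma (INR j + 1 + INR k * (INR s - 1) / (INR k + 1)))) ->
          forall x, G x = F x)) /\
  (* (ii) j -> oo, j = o(n) *)
  (forall jn : nat -> nat,
     (exists N, forall n, (N <= n)%nat -> (1 <= jn n <= n)%nat) ->
     cv_infty (fun n => INR (jn n)) ->
     Un_cv (fun n => INR (jn n) / INR n) 0 ->
     conv_dist (fun n => cdf_Y k n (jn n)
                  (Rpower (INR (jn n) / INR n) (INR k / (INR k + 1)))) exp1_cdf) /\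
  (* (iii) j ~ rho n *)
  (forall (rho : R) (jn : nat -> nat), 0 < rho < 1 ->
     (exists N, forall n, (N <= n)%nat -> (1 <= jn n <= n)%nat) ->
     cv_infty (fun n => INR (jn n)) ->
     Un_cv (fun n => INR (jn n) / INR n) rho ->
     conv_dist (fun n => cdf_Y k n (jn n) 1)
       (nat_cdf (fun m => Rpower rho (INR k / (INR k + 1))
                          * (1 - Rpower rho (INR k / (INR k + 1))) ^ m))) /\
  (* (iv) n - j = o(n) *)
  (forall jn : nat -> nat,
     (exists N, forall n, (N <= n)%nat -> (1 <= jn n <= n)%nat) ->
     cv_infty (fun n => INR (jn n)) ->
     Un_cv (fun n => INR (n - jn n) / INR n) 0 ->
     Un_cv (fun n => prob_Y k n (jn n) 0) 1).
Proof.
  split; [|split; [|split; [|split]]].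
  - intros n j m Hj Hn; exact (prob_Y_exact k n j m Hk Hj Hn).
  - intros j Hj; exact (fixed_index k j Hk Hj).
  - intros jn Hjn Hinf Hq; exact (exponential_limit k jn Hk Hjn Hinf Hq).
  - intros rho jn Hrho Hjn Hinf Hq; exact (geometric_limit k jn Hk Hjn rho Hrho Hinf Hq).
  - intros jn Hjn Hinf Hq; exact (prob_zero_cv k jn Hk Hjn Hinf Hq).
Qed.
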